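(* Let $\omega\approx 0.371859+0.519411i$ be the root of the polynomial $1-2z+2z^2-2z^5+2z^8$ with this approximate value. Then (1) $\omega\in\mathcal{M}$, $\omega\in\mathcal{M}_0$ and $\omega\in\mathcal{M}_1$; in fact $f\Lambda_\omega\cap g\Lambda_\omega=\{1/2\}$; (2) there are points of $\mathbb{D}^*\setminus\mathcal{M}$ arbitrarily close to $\omega$; (3) there are infinitely many rings of concentric closed loops contained in the interior of $\mathcal{M}$, each encircling $\omega$, which nest down to the point $\omega$. Consequently $\mathcal{M}$ has infinitely many holes, and these holes accumulate at $\omega$.
   Context: For $z\in\mathbb{D}^*=\{0<|z|<1\}$ let $f(x)=zx$, $g(x)=z(x-1)+1$, and let $\Lambda_z$ be the unique nonempty compact subset of $\mathbb{C}$ with $\Lambda_z=f(\Lambda_z)\cup g(\Lambda_z)$; write $f\Lambda_z=f(\Lambda_z)$, $g\Lambda_z=g(\Lambda_z)$. Define $\mathcal{M}=\{z\in\mathbb{D}^*:\Lambda_z\text{ connected}\}$, $\mathcal{M}_0=\{z\in\mathbb{D}^*:1/2\in\Lambda_z\}$, and $\mathcal{M}_1=\{z\in\mathbb{D}^*:\Lambda_z\text{ is connected and full}\}$, where a set is full if its complement in $\mathbb{C}$ is connected. One has $\mathcal{M}\subseteq\{|z|\ge 1/2\}$. A hole in $\mathcal{M}$ is a connected component of $\mathbb{D}^*\setminus\mathcal{M}$ other than the component containing $\{0<|z|<1/2\}$. *)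

(* Defs.v *)
From HB Require Import structures.
From mathcomp Require Import all_boot all_order all_algebra.
From mathcomp Require Import all_classical all_reals all_analysis.
From mathcomp Require Import complex.
Import Order.TTheory GRing.Theory Num.Theory numFieldNormedType.Exports.

Set Implicit Arguments.
Unset Strict Implicit.
Unset Printing Implicit Defensive.

Local Open Scope ring_scope.
Local Open Scope classical_set_scope.
Local Open Scope complex_scope.

(* The complex plane, as a numFieldType (hence a normed/topological space). *)
Definition CC (R : realType) : numFieldType := R[i].

Section Defs.
Variable R : realType.
Local Notation C := (CC R).

Definition ifs_f (z : C) (x : C) : C := z * x.
Definition ifs_g (z : C) (x : C) : C := z * (x - 1) + 1.

Definition Dstar : set C := [set z | 0 < `|z| < 1].

Definition is_attractor (z : C) (L : set C) : Prop :=
  L !=set0 /\ compact L /\ L = (ifs_f z) @` L `|` (ifs_g z) @` L.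

(* Lam z = Lambda_z : the unique nonempty compact set with Lam = f Lam u g Lam
   (chosen by classical choice; for z in D^* it exists and is unique). *)
Definition Lam (z : C) : set C := xget set0 (is_attractor z).

Definition full (A : set C) : Prop := connected (~` A).

Definition Mset : set C := [set z | Dstar z /\ connected (Lam z)].
Definition M0set : set C := [set z | Dstar z /\ Lam z (2^-1)].
Definition M1set : set C :=
  [set z | Dstar z /\ connected (Lam z) /\ full (Lam z)].

Definition DstarM : set C := Dstar `\` Mset.
Definition small_disk : set C := [set z | 0 < `|z| < 2^-1].
Definition is_hole (H : set C) : Prop :=
  exists2 z, DstarM z &
    H = connected_component DstarM z /\ ~ (small_disk `<=` H).

Definition is_loop (gam : R -> C) : Prop :=
  {within `[0, 1]%classic, continuous gam} /\ gam 0 = gam 1.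
Definition loop_image (gam : R -> C) : set C := gam @` `[0, 1]%classic.

Definition encircles (gam : R -> C) (w : C) : Prop :=
  ~ loop_image gam w /\
  exists Mb : R, forall x, connected_component (~` loop_image gam) w x ->
    `|x| <= Mb%:C.

Definition omega_poly (w : C) : C :=
  1 - 2 * w + 2 * w ^+ 2 - 2 * w ^+ 5 + 2 * w ^+ 8.
Definition omega_approx : C :=
  ((371859%:R / (10 ^+ 6)%:R) +i* (519411%:R / (10 ^+ 6)%:R))%C.
End Defs.

Arguments Dstar {R}.
Arguments Mset {R}.
Arguments M0set {R}.
Arguments M1set {R}.
Arguments DstarM {R}.
Arguments small_disk {R}.
Arguments omega_approx {R}.

(* Main.v *)
(* In the coordinate e = (x - y) / (1 - z), differences of points of Lambda_z
   become sums of power series in z with coefficients in {-1, 0, 1}, and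
   Lambda_z is connected iff -1/z is such a sum, i.e. iff the expansion
   e -> (e - c) / z, c in {-1, 0, 1}, has a bounded orbit starting at -1/z. For z
   near omega, the first seven digits c of such an orbit are forced, and then
   digits 1 follow until the orbit moves away from the fixed point 1 / (1 - z).
   At z = omega these digits 1 go on forever: the orbit is unique, so f Lambda
   and g Lambda meet in a single point, and continuous arguments glue along it,
   which gives fullness.

   For z = omega + omega^(8+n) s / speed the orbit reaches 1 / (1 - z) + s, up to
   a small error, after 7 + n steps. So M near omega looks, at every scale
   omega^n, like the set of those s for which 1 / (1 - omega) + s has a bounded
   orbit. Finite computations with integer discs show that a polygon winding
   around s = 0 lies in the interior of this set and that some other point s
   lies outside it. The polygon yields the nested loops, the point yields points
   of the complement of M, and the loops enclose the components of these
   points. *)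

From Stdlib Require Import ZArith.
Require Import Defs.
From HB Require Import structures.
From mathcomp Require Import all_boot all_order all_algebra.
From mathcomp Require Import all_classical all_reals all_analysis.
From mathcomp Require Import complex.
From mathcomp Require Import ring lra ssrZ zify.
Import Order.TTheory GRing.Theory Num.Theory numFieldNormedType.Exports.

Set Implicit Arguments.
Unset Strict Implicit.
Unset Printing Implicit Defensive.

Local Open Scope ring_scope.
Local Open Scope classical_set_scope.
Local Open Scope complex_scope.

(** * The modulus as a real number; connected sets *)

(** Fullness and encirclement both concern components of the complement of a compact set K, and both
    rest on one criterion of Borsuk type in place of winding numbers and the Jordan curve theorem.
    If p - x has a continuous argument for p in K, then x lies in no bounded component: otherwise
    the argument, extended over that component, would yield a map of the plane to the unit circle
    that is the direction from x on a large circle. Such an argument also persists as x moves off K,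
    and it exists for x far away; so its absence traps the component of x in every disc that
    contains K. The polynomial encodes digits: it equals (1 - z)(1 + z c(z)) + z^8, where c(z) has
    the seven forced digits as coefficients, so its zeros with 0 < |z| < 1 are those z for which
    -1/z has these digits followed by 1 forever. Finitely many computations serve all scales because
    their discs leave a margin, which for all large n absorbs the difference between the true orbit
    and its limit. *)

Section Modulus.
Variable R : realType.
Local Notation C := (CC R).
Implicit Types (x y z : C) (r e : R).

(** The norm on [C] takes values in [C], where the order is only partial; a modulus in [R] makes
    [lra] and [nra] applicable. *)
Definition nm (x : C) : R := complex.Re `|x|.

Lemma normE x : `|x| = (nm x)%:C :> C.
Proof. by apply/esym; exact: (RRe_real (normr_real x)). Qed.

Lemma nm_sqrt x : nm x = Num.sqrt (complex.Re x ^+ 2 + complex.Im x ^+ 2).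
Proof. exact: (congr1 (@complex.Re R) (normc_def x)). Qed.

Lemma nm_ge0 x : 0 <= nm x. Proof. by rewrite nm_sqrt sqrtr_ge0. Qed.

Lemma nm_sqr x : nm x ^+ 2 = complex.Re x ^+ 2 + complex.Im x ^+ 2.
Proof. by rewrite nm_sqrt sqr_sqrtr // addr_ge0 ?sqr_ge0. Qed.

Lemma nmM x y : nm (x * y) = nm x * nm y.
Proof. by apply: complexI; rewrite rmorphM /= -!normE normrM. Qed.

Lemma nmV x : nm x^-1 = (nm x)^-1.
Proof. by apply: complexI; rewrite fmorphV /= -!normE normfV. Qed.

Lemma nmf x y : nm (x / y) = nm x / nm y.
Proof. by rewrite nmM nmV. Qed.

Lemma nmX x n : nm (x ^+ n) = nm x ^+ n.
Proof. by apply: complexI; rewrite rmorphXn /= -!normE normrX. Qed.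

Lemma nmN x : nm (- x) = nm x.
Proof. by apply: complexI; rewrite /= -!normE normrN. Qed.

Lemma nmB x y : nm (x - y) = nm (y - x).
Proof. by rewrite -nmN opprB. Qed.

Lemma nmD x y : nm (x + y) <= nm x + nm y.
Proof. by rewrite -lecR rmorphD /= -!normE ler_normD. Qed.

Lemma nm_tri y x z : nm (x - z) <= nm (x - y) + nm (y - z).
Proof. by rewrite -[x - z](subrKA y) nmD. Qed.

Lemma nm0 : nm 0 = 0. Proof. by rewrite /nm normr0. Qed.
Lemma nm1 : nm 1 = 1. Proof. by rewrite /nm normr1. Qed.

Lemma nm_eq0 x : (nm x == 0) = (x == 0).
Proof.
apply/eqP/eqP => [x0|->]; last exact: nm0.
by apply/eqP; rewrite -normr_eq0 normE x0.
Qed.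

Lemma nm_gt0 x : (0 < nm x) = (x != 0).
Proof. by rewrite lt_neqAle nm_ge0 andbT eq_sym nm_eq0. Qed.

Lemma nmR r : nm r%:C = `|r|.
Proof. by rewrite nm_sqrt /= expr0n addr0 sqrtr_sqr. Qed.

Lemma nm_Re x : `|complex.Re x| <= nm x.
Proof. by rewrite -sqrtr_sqr nm_sqrt ler_wsqrtr // lerDl sqr_ge0. Qed.

Lemma nm_Im x : `|complex.Im x| <= nm x.
Proof. by rewrite -sqrtr_sqr nm_sqrt ler_wsqrtr // lerDr sqr_ge0. Qed.

Lemma nm_le_ReIm x : nm x <= `|complex.Re x| + `|complex.Im x|.
Proof.
rewrite -(ler_pXn2r (n := 2)) ?nnegrE ?nm_ge0 ?addr_ge0 //.
rewrite nm_sqr sqrrD -[_ ^+ 2 in leLHS]real_normK ?num_real //.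
rewrite -[complex.Im x ^+ 2]real_normK ?num_real //.
by rewrite lerD2r lerDl mulrn_wge0 // mulr_ge0.
Qed.

Lemma nbhs_nmP x (A : set C) :
  nbhs x A <-> exists2 r, 0 < r & forall y, nm (y - x) < r -> A y.
Proof.
rewrite -nbhs_ballE; split.
  case=> e /= e0 eA; exists (complex.Re e).
    by move: e0; rewrite ltcE /= => /andP[_].
  move=> y yr; apply: eA; rewrite -ball_normE /= normE nmB.
  by move: e0; rewrite !ltcE /= => /andP[/eqP -> _]; rewrite eqxx.
case=> r r0 rA; exists r%:C; first by rewrite /= ltcR.
by move=> y; rewrite -ball_normE /= normE ltcR nmB => /rA.
Qed.

Lemma nbhs_nm x r : 0 < r -> nbhs x [set y | nm (y - x) < r].
Proof. by move=> r0; apply/nbhs_nmP; exists r. Qed.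

Lemma open_nmP (A : set C) :
  open A <-> forall x, A x -> exists2 r, 0 < r & forall y, nm (y - x) < r -> A y.
Proof.
rewrite openE; split=> [oA x Ax|oA x Ax].
  by apply/nbhs_nmP; exact: oA.
by apply/nbhs_nmP; exact: oA.
Qed.

Lemma closed_nmP (A : set C) :
  closed A <-> forall x, (forall e, 0 < e -> exists2 y, A y & nm (y - x) < e) -> A x.
Proof.
split=> [cA x xA|cA x clx].
  apply: cA => B /nbhs_nmP[r r0 rB]; have [y Ay yx] := xA r r0.
  by exists y; split => //; exact: rB.
apply: cA => e e0; have [y [Ay yB]] := clx _ (nbhs_nm x e0).
by exists y.
Qed.

Lemma cvg_nmP (T : topologicalType) (f : T -> C) (t : T) (F : set_system T) :
  Filter F ->
  (f @ F --> f t) <-> forall e, 0 < e -> \forall s \near F, nm (f s - f t) < e.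
Proof.
move=> FF; split=> [cf e e0|cf A /nbhs_nmP[r r0 rA]].
  exact: cf (nbhs_nm _ e0).
by apply: filterS (cf r r0) => s; exact: rA.
Qed.

Lemma continuous_nmP (f : C -> C) x :
  {for x, continuous f} <->
  forall e, 0 < e -> exists2 d, 0 < d & forall y, nm (y - x) < d -> nm (f y - f x) < e.
Proof.
split=> [cf e e0|cf]; first by apply/nbhs_nmP; exact: cf (nbhs_nm _ e0).
by apply/(@cvg_nmP _ _ _ _ (nbhs_filter x)) => e /cf /nbhs_nmP.
Qed.

Lemma lipschitz_continuous (f : C -> C) (k : R) :
  (forall x y, nm (f x - f y) <= k * nm (x - y)) -> continuous f.
Proof.
move=> fk x; apply/continuous_nmP => e e0.
have k1 : 0 < `|k| + 1 by rewrite ltr_wpDl.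
exists (e / (`|k| + 1)); first by rewrite divr_gt0.
move=> y; rewrite ltr_pdivlMr // => yx; apply: le_lt_trans yx.
apply: le_trans (fk _ _) _; rewrite mulrC ler_wpM2l ?nm_ge0 //.
by rewrite (le_trans (ler_norm _)) // lerDl.
Qed.

Lemma affine_continuous (a b : C) : continuous (fun x => a * x + b).
Proof.
apply: (@lipschitz_continuous _ (nm a)) => x y.
by rewrite opprD addrACA subrr addr0 -mulrBr nmM.
Qed.

Lemma continuousR_nmP (f : C -> R) x :
  {for x, continuous f} <->
  forall e, 0 < e -> exists2 d, 0 < d &
    forall y, nm (y - x) < d -> `|f y - f x| < e.
Proof.
split=> [/(@cvgrPdist_lt _ _ _ _ (nbhs_filter x)) cf e e0|cf].
  have /nbhs_nmP[d d0 df] := cf e e0.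
  by exists d => // y /df; rewrite distrC.
apply/(@cvgrPdist_lt _ _ _ _ (nbhs_filter x)) => e /cf[d d0 df].
by apply/nbhs_nmP; exists d => // y /df; rewrite distrC.
Qed.

Lemma lipschitzR_continuous (f : C -> R) :
  (forall x y, `|f x - f y| <= nm (x - y)) -> continuous f.
Proof.
move=> fl x; apply/continuousR_nmP => e e0; exists e => // y.
exact: le_lt_trans.
Qed.

Lemma continuous_Re : continuous (@complex.Re R : C -> R).
Proof.
by apply: lipschitzR_continuous => x y; rewrite -raddfB; exact: nm_Re.
Qed.

Lemma continuous_Im : continuous (@complex.Im R : C -> R).
Proof.
by apply: lipschitzR_continuous => x y; rewrite -raddfB; exact: nm_Im.
Qed.

Lemma cvg_complex (T : topologicalType) (f g : T -> R) t (F : set_system T) :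
  Filter F -> f @ F --> f t -> g @ F --> g t ->
  (fun s => (f s +i* g s : C)) @ F --> (f t +i* g t : C).
Proof.
move=> FF cf cg; apply/(@cvg_nmP _ (fun s => (f s +i* g s : C))) => e e0.
have e2 : 0 < e / 2 by rewrite divr_gt0.
move/cvgrPdist_lt/(_ _ e2) : cf => cf; move/cvgrPdist_lt/(_ _ e2) : cg => cg.
near=> s; apply: le_lt_trans (nm_le_ReIm _) _.
rewrite /= [ltRHS]splitr ltrD //.
  by rewrite distrC; near: s.
by rewrite distrC; near: s.
Unshelve. all: by end_near. Qed.

Definition of_pair (p : R * R) : C := (p.1 +i* p.2)%C.

Lemma of_pair_continuous : continuous of_pair.
Proof. by move=> p; apply: cvg_complex; [exact: cvg_fst|exact: cvg_snd]. Qed.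

Lemma nm_lip x y : `|nm x - nm y| <= nm (x - y).
Proof.
rewrite ler_norml; have := nm_tri y 0 x; have := nm_tri x 0 y.
by rewrite !sub0r !nmN (nmB x y) => h1 h2; apply/andP; split; lra.
Qed.

Lemma nm_continuous : continuous (nm : C -> R).
Proof. exact: lipschitzR_continuous nm_lip. Qed.

Lemma nmC_continuous : continuous (fun x => (nm x)%:C : C).
Proof.
apply: (@lipschitz_continuous _ 1) => x y.
by rewrite -rmorphB nmR mul1r nm_lip.
Qed.

Lemma closed_nm_le x r : closed [set y : C | nm (y - x) <= r].
Proof.
apply/closed_nmP => y H /=; rewrite leNgt; apply/negP => ry.
have [z /= zr] := H (nm (y - x) - r) ltac:(by rewrite subr_gt0).
by rewrite nmB; have := nm_tri z y x; lra.
Qed.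

Lemma compact_nm_le (r : R) : compact [set y : C | nm y <= r].
Proof.
have cK : compact (of_pair @` (`[- r, r] `*` `[- r, r])).
  apply: continuous_compact; last by apply: compact_setX; exact: segment_compact.
  exact/continuous_subspaceT/of_pair_continuous.
apply: subclosed_compact cK _.
  by have := @closed_nm_le 0 r; congr closed; apply/funext => y /=; rewrite subr0.
move=> y /= yr; exists (complex.Re y, complex.Im y); last by case: (y).
by split=> /=; rewrite in_itv /= -ler_norml (le_trans _ yr) ?nm_Re ?nm_Im.
Qed.

Lemma bounded_closed_compact_nm (A : set C) (r : R) :
  closed A -> (forall x, A x -> nm x <= r) -> compact A.
Proof. by move=> cA Ar; apply: subclosed_compact cA (compact_nm_le (r:=r)) _. Qed.

Lemma compact_closed_nm (A : set C) : compact A -> closed A.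
Proof. by apply: compact_closed; exact: norm_hausdorff. Qed.

Lemma compact_bounded_nm (A : set C) : compact A ->
  exists2 r : R, 0 < r & forall x, A x -> nm x <= r.
Proof.
move=> cA; have [->|/set0P A0] := eqVneq A set0; first by exists 1.
have [|x Ax xmax] := @compact_EVT_max _ _ nm A A0 cA.
  by apply: continuous_subspaceT; exact: nm_continuous.
by exists (nm x + 1); rewrite ?ltr_wpDl ?nm_ge0 // => y /mem_set /xmax; lra.
Qed.

(** Serves to propagate a property along A when both it and its negation are open conditions: one
    point with the property is then enough. *)
Lemma connected_open_split (T : topologicalType) (A U V : set T) :
  connected A -> open U -> open V -> A `<=` U `|` V ->
  (forall p, A p -> U p -> V p -> False) -> A `&` U !=set0 -> A `<=` U.
Proof.
move=> cA oU oV AUV UV AU.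
suff <- : A `&` U = A by [].
apply: cA => //; first by exists U.
exists (~` V); first exact: open_closedC.
apply/seteqP; split=> p [Ap]; first by move=> Up; split => // /(UV _ Ap Up).
by move=> nVp; split => //; case: (AUV _ Ap).
Qed.

Definition seg (x y : C) (t : R) : C := x + t%:C * (y - x).

Lemma seg0 x y : seg x y 0 = x. Proof. by rewrite /seg mul0r addr0. Qed.
Lemma seg1 x y : seg x y 1 = y. Proof. by rewrite /seg mul1r subrKC. Qed.

Lemma nm_segB x y s t : nm (seg x y s - seg x y t) = `|s - t| * nm (y - x).
Proof. by rewrite /seg opprD addrACA subrr add0r -mulrBl nmM -rmorphB nmR. Qed.

Lemma nm_seg x y a r t : 0 <= t <= 1 -> nm (x - a) < r -> nm (y - a) < r ->
  nm (seg x y t - a) < r.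
Proof.
move=> /andP[t0 t1] xr yr.
have -> : seg x y t - a = (1 - t)%:C * (x - a) + t%:C * (y - a).
  by rewrite /seg rmorphB rmorph1; ring.
apply: le_lt_trans (nmD _ _) _; rewrite !nmM !nmR !ger0_norm ?subr_ge0 //.
have [->|tn0] := eqVneq t 0; first by rewrite subr0 mul0r mul1r addr0.
have {tn0}t0 : 0 < t by rewrite lt_neqAle eq_sym tn0.
have -> : r = (1 - t) * r + t * r by ring.
by rewrite ler_ltD ?ltr_pM2l // ler_wpM2l ?subr_ge0 // ltW.
Qed.

Lemma seg_continuous x y : continuous (seg x y).
Proof.
move=> t A /nbhs_nmP[r r0 rA].
pose k := nm (y - x) + 1.
have k0 : 0 < k by rewrite ltr_wpDl ?nm_ge0.
have : \forall s \near t, `|t - s| < r / k.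
  by apply/nbhs_ballP; exists (r / k) => /=; rewrite ?divr_gt0.
apply: filterS => s; rewrite ltr_pdivlMr // => str; apply: rA.
rewrite nm_segB distrC; apply: le_lt_trans str.
by rewrite ler_wpM2l // lerDl.
Qed.

Lemma convex_connected (A : set C) :
  (forall x y t, A x -> A y -> 0 <= t <= 1 -> A (seg x y t)) -> connected A.
Proof.
move=> cA; have [->|/set0P[x Ax]] := eqVneq A set0; first exact: connected0.
have -> : A = \bigcup_(y in A) (seg x y @` `[0, 1]%classic).
  apply/seteqP; split=> [y Ay|y [z Az] [t /=]].
    exists y => //; exists 1; last exact: seg1.
    by rewrite /= in_itv /= ler01 lexx.
  by rewrite in_itv /= => t01 <-; exact: cA.
apply: bigcup_connected.
  exists x => y _; exists 0; last exact: seg0.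
  by rewrite /= in_itv /= ler01 lexx.
move=> y Ay; apply: connected_continuous_connected.
  exact: segment_connected.
by apply: continuous_subspaceT; exact: seg_continuous.
Qed.

Lemma ball_connected a r : connected [set y : C | nm (y - a) < r].
Proof. by apply: convex_connected => x y t /=; move=> *; exact: nm_seg. Qed.

(* The complement of a square is a union of four half-planes, consecutive
   ones meeting; this avoids polar coordinates. *)
Lemma outside_square_connected (r : R) : 0 <= r ->
  connected [set y : C | r < `|complex.Re y| \/ r < `|complex.Im y|].
Proof.
move=> r0.
have half (f : C -> R) : (forall x y t, f (seg x y t) = f x + t * (f y - f x)) ->
    connected [set y : C | r < f y].
  move=> fE; apply: convex_connected => x y t /= fx fy /andP[t0 t1].
  rewrite fE; have [->|tn0] := eqVneq t 0; first by rewrite mul0r addr0.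
  have {tn0}t0 : 0 < t by rewrite lt_neqAle eq_sym tn0.
  by nra.
have ReE x y t : complex.Re (seg x y t) =
    complex.Re x + t * (complex.Re y - complex.Re x).
  by case: x y => [a b] [c d] /=; rewrite mul0r subr0.
have ImE x y t : complex.Im (seg x y t) =
    complex.Im x + t * (complex.Im y - complex.Im x).
  by case: x y => [a b] [c d] /=; rewrite mul0r addr0.
have c1 := half _ ReE; have c3 := half _ ImE.
have c2 : connected [set y : C | r < - complex.Re y].
  by apply: half => x y t; rewrite ReE; ring.
have c4 : connected [set y : C | r < - complex.Im y].
  by apply: half => x y t; rewrite ImE; ring.
have -> : [set y : C | r < `|complex.Re y| \/ r < `|complex.Im y|] =
   (([set y : C | r < complex.Re y] `|` [set y : C | r < complex.Im y]) `|`
   [set y : C | r < - complex.Re y]) `|` [set y : C | r < - complex.Im y].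
  apply/seteqP; split=> y /=; rewrite !ltr_normr.
    by move=> [/orP[]|/orP[]]; tauto.
  by move=> [[[->|->]|->]|->]; rewrite ?orbT; auto.
have r1 : r < r + 1 by rewrite ltrDl.
apply: connectedU => //; last first.
  apply: connectedU => //; last apply: connectedU => //.
    by exists (- (r + 1) +i* (r + 1))%C; split; [right|] => /=; rewrite ?opprK.
  by exists ((r + 1) +i* (r + 1))%C; split.
by exists ((r + 1) +i* (- (r + 1)))%C; split; [left; left|] => /=; rewrite ?opprK.
Qed.
End Modulus.

(** * The attractor and its differences *)

Section IFS.
Variable R : realType.
Local Notation C := (CC R).
Implicit Types (x y z e : C).

Lemma expr_small (q D e : R) : 0 <= q -> q < 1 -> 0 <= D -> 0 < e ->
  exists n, q ^+ n * D < e.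
Proof.
move=> q0 q1 D0 e0; have D1 : 0 < D + 1 by rewrite ltr_wpDl.
have qn : `|q| < 1 by rewrite ger0_norm.
have /cvgrPdist_lt/(_ (e / (D + 1))) := cvg_expr qn.
rewrite divr_gt0 // => /(_ isT)[N _ /(_ N (leqnn N))].
rewrite /= sub0r normrN ger0_norm ?exprn_ge0 // ltr_pdivlMr // => qN.
exists N; apply: le_lt_trans qN; rewrite ler_wpM2l ?exprn_ge0 //.
by rewrite lerDl.
Qed.

Lemma Dstar_nm z : Dstar z <-> 0 < nm z < 1.
Proof. by rewrite /Dstar /= normE -[1]/(1%:C) !ltcR. Qed.

(** Expand a point of S n times inside S, replace the tail by [y0] and contract back along the same
    t: the result lies in L, at distance at most |z|^n (b + b') from the point, and L is closed.
    Used for [Lam z] and for its differences. *)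
Lemma expansion_sub_closed z (T S L : set C) (b b' : R) :
  nm z < 1 -> closed L -> L !=set0 ->
  (forall x, L x -> nm x <= b) -> (forall x, S x -> nm x <= b') ->
  (forall t x, T t -> L x -> L (z * x + t)) ->
  (forall x, S x -> exists2 y, S y & exists2 t, T t & x = z * y + t) ->
  S `<=` L.
Proof.
move=> z1 cL [y0 Ly0] Lb Sb TL TS.
have approx n x : S x -> exists2 y, L y & nm (x - y) <= nm z ^+ n * (b + b').
  elim: n x => [|n IHn] x Sx.
    exists y0 => //; rewrite expr0 mul1r; apply: le_trans (nmD _ _) _.
    by rewrite nmN addrC lerD ?Lb ?Sb.
  have [y Sy [t Tt ->]] := TS _ Sx; have [y' Ly' yy'] := IHn _ Sy.
  exists (z * y' + t); first exact: TL.
  have -> : z * y + t - (z * y' + t) = z * (y - y') by ring.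
  by rewrite nmM exprS -mulrA ler_wpM2l ?nm_ge0.
move=> x Sx; apply: (iffLR (closed_nmP _) cL) => e e0.
have bb : 0 <= b + b'.
  apply: addr_ge0.
    exact: le_trans (nm_ge0 y0) (Lb _ Ly0).
  exact: le_trans (nm_ge0 x) (Sb _ Sx).
have [n ne] := expr_small (nm_ge0 z) z1 bb e0.
have [y Ly xy] := approx n x Sx; exists y => //.
by rewrite nmB (le_lt_trans xy).
Qed.

Lemma ifs_fE z x : ifs_f z x = z * x + 0. Proof. by rewrite addr0. Qed.
Lemma ifs_gE z x : ifs_g z x = z * x + (1 - z).
Proof. by rewrite /ifs_g; ring. Qed.

Lemma affine_image_closed z t (A : set C) : z != 0 -> closed A ->
  closed ((fun x => z * x + t) @` A).
Proof.
move=> z0 /closed_nmP cA; apply/closed_nmP => x xA.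
exists (z^-1 * (x - t)); last by rewrite mulVKf // subrK.
apply: cA => e e0; have ez : 0 < nm z * e by rewrite mulr_gt0 ?nm_gt0.
have [_ [y Ay <-] yx] := xA _ ez; exists y => //.
rewrite -(ltr_pM2l (x := nm z)) ?nm_gt0 // -nmM mulrBr mulVKf //.
by rewrite opprB addrA.
Qed.

Definition Fifs z (A : set C) : set C := (ifs_f z) @` A `|` (ifs_g z) @` A.

Lemma FifsP z A x : Fifs z A x <->
  exists2 y, A y & exists2 t, [set 0; 1 - z]%classic t & x = z * y + t.
Proof.
split=> [[[y Ay <-]|[y Ay <-]]|[y Ay [t [->|->] ->]]].
- by exists y => //; exists 0; rewrite ?ifs_fE //; left.
- by exists y => //; exists (1 - z); rewrite ?ifs_gE //; right.
- by left; exists y; rewrite ?ifs_fE.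
- by right; exists y; rewrite ?ifs_gE.
Qed.

Lemma Fifs_mono z A B : A `<=` B -> Fifs z A `<=` Fifs z B.
Proof. by move=> AB; apply: setUSS; exact: image_subset. Qed.

Lemma Fifs_closed z A : z != 0 -> closed A -> closed (Fifs z A).
Proof.
move=> z0 cA; apply: closedU.
  under eq_imagel do rewrite ifs_fE; exact: affine_image_closed.
under eq_imagel do rewrite ifs_gE; exact: affine_image_closed.
Qed.

(** A greatest fixed point instead of a limit in the Hausdorff metric: L is the union of all S
    inside a disc K with S contained in [Fifs z S]. The closure of L is again such a set, so L is
    closed. *)
Lemma attractor_exists z : Dstar z -> exists L, is_attractor z L.
Proof.
move=> /Dstar_nm /andP[z0 z1].
have zn0 : z != 0 by rewrite -nm_gt0.
(* The solution of |z| r + (1 + |z|) = r, so that both maps send the disc of radius r into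
   itself. *)
pose r := (1 + nm z) / (1 - nm z).
have r0 : 0 <= r.
  apply: divr_ge0; first by rewrite addr_ge0 ?nm_ge0.
  by rewrite subr_ge0 ltW.
have rE : r * (1 - nm z) = 1 + nm z by rewrite divfK // subr_eq0 gt_eqF.
pose K := [set x : C | nm x <= r].
have FK : Fifs z K `<=` K.
  move=> x /FifsP[y /= yr [t tE ->]]; apply: le_trans (nmD _ _) _.
  rewrite nmM; have zy : nm z * nm y <= nm z * r by rewrite ler_wpM2l ?nm_ge0.
  have : nm t <= 1 + nm z.
    case: tE => ->; first by rewrite nm0 addr_ge0 ?nm_ge0.
    by apply: le_trans (nmD _ _) _; rewrite nmN nm1.
  by nra.
pose L := [set x | exists2 S : set C, S x & S `<=` K /\ S `<=` Fifs z S].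
have LK : L `<=` K by move=> x [S Sx [SK _]]; exact: SK.
have LF : L `<=` Fifs z L.
  move=> x [S Sx [SK SF]]; apply: Fifs_mono (SF _ Sx) => y Sy.
  by exists S.
have FL : Fifs z L `<=` L.
  move=> x FLx; exists (Fifs z L) => //; split; last exact: Fifs_mono.
  by apply: subset_trans FK; exact: Fifs_mono.
have cK : closed K.
  by have := @closed_nm_le R 0 r; congr closed; apply/funext => y /=; rewrite subr0.
have cL : closed L.
  move=> x clx; exists (closure L) => //; split.
    exact: subset_trans (closureS LK) cK.
  have := Fifs_closed zn0 (@closed_closure _ L) => /closure_id ->.
  apply: closureS; apply: subset_trans LF _; apply: Fifs_mono.
  exact: subset_closure.
exists L; split; last split.
- exists 0; exists [set 0] => //; split=> [_ ->|_ ->]; first by rewrite /K /= nm0.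
  by left; exists 0; rewrite ?ifs_fE // mulr0 addr0.
- by apply: (@bounded_closed_compact_nm _ _ r).
- by apply/seteqP; split.
Qed.

Section Attractor.
Variable z : C.
Hypothesis Dz : Dstar z.
Let z0 : 0 < nm z. Proof. by have /Dstar_nm/andP[] := Dz. Qed.
Let z1 : nm z < 1. Proof. by have /Dstar_nm/andP[] := Dz. Qed.
Let zn0 : z != 0. Proof. by rewrite -nm_gt0. Qed.

Lemma Lam_attractor : is_attractor z (Lam z).
Proof. exact: (@xgetPex _ set0 _ (attractor_exists Dz)). Qed.

Lemma Lam_neq0 : Lam z !=set0. Proof. by have [] := Lam_attractor. Qed.
Lemma Lam_compact : compact (Lam z). Proof. by have [_ []] := Lam_attractor. Qed.
Lemma Lam_closed : closed (Lam z).
Proof. exact: compact_closed_nm Lam_compact. Qed.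
Lemma LamE : Lam z = Fifs z (Lam z). Proof. by have [_ []] := Lam_attractor. Qed.

Lemma Lam_bounded : exists2 b : R, 0 < b & forall x, Lam z x -> nm x <= b.
Proof. exact: compact_bounded_nm Lam_compact. Qed.

Lemma Lam_f x : Lam z x -> Lam z (z * x).
Proof. by move=> Lx; rewrite LamE; left; exists x. Qed.

Lemma Lam_g x : Lam z x -> Lam z (z * x + (1 - z)).
Proof. by move=> Lx; rewrite LamE; right; exists x; rewrite ?ifs_gE. Qed.

Lemma Lam_split x : Lam z x ->
  exists2 y, Lam z y & x = z * y \/ x = z * y + (1 - z).
Proof.
rewrite {1}LamE => /FifsP[y Ly [t [->|->] ->]]; exists y => //.
  by left; rewrite addr0.
by right.
Qed.

(** Coinduction for [Lam z]: membership of a point is proved by exhibiting a bounded set of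
    addresses-to-be-continued around it. *)
Lemma sub_Lam (S : set C) (b : R) : (forall x, S x -> nm x <= b) ->
  S `<=` Fifs z S -> S `<=` Lam z.
Proof.
have [b' _ Lb'] := Lam_bounded => Sb SF.
apply: (@expansion_sub_closed z [set 0; 1 - z]%classic _ _ b' b) => //.
- exact: Lam_closed.
- exact: Lam_neq0.
- by move=> t x [->|->] Lx; rewrite ?addr0; [exact: Lam_f|exact: Lam_g].
- by move=> x /SF /FifsP.
Qed.

(** The half-turn x -> 1 - x conjugates f to g. *)
Lemma Lam_sym x : Lam z x -> Lam z (1 - x).
Proof.
have [b _ Lb] := Lam_bounded.
move=> Lx; apply: (@sub_Lam [set y | Lam z (1 - y)] (1 + b)).
- move=> y /= /Lb; have := nm_tri 1 y 0; rewrite !subr0 nm1 (nmB y 1).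
  by lra.
- move=> y /= /Lam_split[v Lv E]; case: E => E.
    right; exists (1 - v) => /=; first by rewrite subKr.
    by rewrite ifs_gE -[y](subKr 1) E; ring.
  left; exists (1 - v) => /=; first by rewrite subKr.
  by rewrite ifs_fE -[y](subKr 1) E; ring.
- by rewrite /= subKr.
Qed.

Lemma connected_Lam_meet : connected (Lam z) ->
  (ifs_f z) @` Lam z `&` (ifs_g z) @` Lam z !=set0.
Proof.
move=> cL; apply/set0P/negP => /eqP fg0.
have [x Lx] := Lam_neq0.
have clf : closed (ifs_f z @` Lam z).
  under eq_imagel do rewrite ifs_fE; exact/affine_image_closed/Lam_closed.
have clg : closed (ifs_g z @` Lam z).
  under eq_imagel do rewrite ifs_gE; exact/affine_image_closed/Lam_closed.
have fL : ifs_f z @` Lam z `<=` Lam z by move=> y fy; rewrite LamE; left.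
(* If the two closed images are disjoint, f(Lambda) is both open and closed in Lambda. *)
have E : ifs_f z @` Lam z = Lam z.
  apply: cL; first by exists (ifs_f z x); exists x.
    exists (~` (ifs_g z @` Lam z)); first exact: closed_openC.
    apply/seteqP; split=> y.
      move=> fy; split; first exact: fL.
      by move=> gy; have : set0 y by rewrite -fg0.
    by move=> []; rewrite {1}LamE => -[//|gy] /(_ gy).
  by exists (ifs_f z @` Lam z) => //; rewrite setIC; apply/esym/setIidPl.
have : set0 (ifs_g z x).
  rewrite -fg0; split; last by exists x.
  by rewrite E LamE; right; exists x.
by [].
Qed.

(* If f(Lam) meets g(Lam), a gap of size r in Lam is carried by f or by g
   from a gap of size r / |z|, so Lam has no gap at all. *)
Lemma meet_connected_Lam :
  (ifs_f z) @` Lam z `&` (ifs_g z) @` Lam z !=set0 -> connected (Lam z).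
Proof.
move=> [p [[x Lx xp] [y Ly yp]]]; have [b b0 Lb] := Lam_bounded.
have gap n (A B : set C) : A !=set0 -> B !=set0 -> Lam z = A `|` B ->
    exists2 u, A u & exists2 v, B v & nm (u - v) <= nm z ^+ n * (b + b).
  elim: n A B => [|n IHn] A B [u Au] [v Bv] LAB.
    exists u => //; exists v => //; rewrite expr0 mul1r.
    by apply: le_trans (nmD _ _) _; rewrite nmN lerD // Lb // LAB; [left|right].
  have step t : (forall s, Lam z s -> Lam z (z * s + t)) ->
      (exists2 s, Lam z s & A (z * s + t)) ->
      (exists2 s, Lam z s & B (z * s + t)) ->
      exists2 u, A u & exists2 v, B v & nm (u - v) <= nm z ^+ n.+1 * (b + b).
    move=> Lt [s Ls As] [s' Ls' Bs'].
    have [|||u' [Lu' Au'] [v' [Lv' Bv'] uv']] :=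
        IHn [set s | Lam z s /\ A (z * s + t)] [set s | Lam z s /\ B (z * s + t)].
    - by exists s.
    - by exists s'.
    - apply/seteqP; split=> [r Lr|r [[]|[]] //].
      by have := Lt _ Lr; rewrite {1}LAB => -[]; [left|right].
    exists (z * u' + t) => //; exists (z * v' + t) => //.
    have -> : z * u' + t - (z * v' + t) = z * (u' - v') by ring.
    by rewrite nmM exprS -mulrA ler_wpM2l ?nm_ge0.
  have Lf s : Lam z s -> Lam z (z * s + 0) by rewrite addr0; exact: Lam_f.
  have [fAB|nf] := pselect ((exists2 s, Lam z s & A (z * s + 0)) /\
                            (exists2 s, Lam z s & B (z * s + 0))).
    by case: fAB; exact: step.
  have [gAB|ng] := pselect ((exists2 s, Lam z s & A (z * s + (1 - z))) /\
                            (exists2 s, Lam z s & B (z * s + (1 - z)))).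
    by case: gAB; exact: (step _ Lam_g).
  (* Here each image of Lambda stays in one of the two parts, and the common point p puts both
     images in the same part, leaving the other part empty. *)
  exfalso.
  have Lp : Lam z p by rewrite -xp; exact: Lam_f.
  have fp : p = z * x + 0 by rewrite -ifs_fE.
  have gp : p = z * y + (1 - z) by rewrite -ifs_gE.
  have Lu : Lam z u by rewrite LAB; left.
  have Lv : Lam z v by rewrite LAB; right.
  have [u' Lu' uE] := Lam_split Lu; have [v' Lv' vE] := Lam_split Lv.
  move: Lp; rewrite LAB => -[Ap|Bp].
    case: vE => vE; first by
      apply: nf; split; [exists x; rewrite -?fp|exists v'; rewrite ?addr0 -?vE].
    by apply: ng; split; [exists y; rewrite -?gp|exists v'; rewrite -?vE].
  case: uE => uE; first by
    apply: nf; split; [exists u'; rewrite ?addr0 -?uE|exists x; rewrite -?fp].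
  by apply: ng; split; [exists u'; rewrite -?uE|exists y; rewrite -?gp].
apply/connectedP => E [E0 EU [sep1 sep2]].
have LE : Lam z = E false `|` E true by [].
have clE c : closed (E c).
  move=> q clq.
  have : Lam z q.
    by apply: Lam_closed; apply: closureS clq => s; rewrite LE; case: c; [right|left].
  rewrite LE => -[]; case: c clq => // clq Eq.
    by have : set0 q by rewrite -sep2; split.
  by have : set0 q by rewrite -sep1; split.
have cE c : compact (E c).
  apply: subclosed_compact (clE c) Lam_compact _ => s.
  by rewrite LE; case: c; [right|left].
have cEE : compact (E false `*` E true) by exact: compact_setX.
have E0' : E false `*` E true !=set0.
  by have [u Eu] := E0 false; have [v Ev] := E0 true; exists (u, v).
have [|m mE mmin] := @compact_EVT_min _ R
    (fun s : C * C => nm (s.1 - s.2)) _ E0' cEE.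
  apply: continuous_subspaceT => s.
  apply: (@continuous_comp _ _ _ (fun s : C * C => s.1 - s.2) (@nm R));
    last exact: nm_continuous.
  by apply: cvgB; [exact: cvg_fst|exact: cvg_snd].
move: mE; rewrite inE => -[/= m1 m2].
have m0 : 0 < nm (m.1 - m.2).
  rewrite nm_gt0 subr_eq0; apply/eqP => m12.
  have : set0 m.1; last by [].
  by rewrite -(separated_disjoint (conj sep1 sep2)); split => //; rewrite m12.
have [n nm] := expr_small (nm_ge0 z) z1 (ltW (addr_gt0 b0 b0)) m0.
have [u Eu [v Ev uv]] := gap n _ _ (E0 false) (E0 true) LE.
have := mmin (u, v); rewrite inE /= => /(_ (conj Eu Ev)).
by rewrite leNgt (le_lt_trans uv).
Qed.

End Attractor.

(** * Series with digits -1, 0, 1 and differences of points of Lambda *)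

Definition digit (c : C) : Prop := [\/ c = -1, c = 0 | c = 1].

(* [e] is a sum of a series [c_0 + c_1 z + c_2 z^2 + ...] with digits in
   {-1, 0, 1}; the points of [S] are the tails of such a series. *)
Definition viable z e : Prop := exists S : set C,
  [/\ S e, exists b : R, forall x, S x -> nm x <= b &
      forall x, S x -> exists2 c, digit c & S ((x - c) / z)].

Lemma viable_step z e : viable z e ->
  exists2 c, digit c & viable z ((e - c) / z).
Proof.
move=> [S [Se Sb Sz]]; have [c dc Sc] := Sz _ Se.
by exists c => //; exists S.
Qed.

Lemma viable_pred z e c : digit c -> viable z ((e - c) / z) -> viable z e.
Proof.
move=> dc [S [Se [b Sb] Sz]]; exists (e |` S); split.
- by left.
- exists (Num.max (nm e) b) => x [->|/Sb xb]; first by rewrite le_max lexx.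
  by rewrite le_max xb orbT.
- move=> x [->|/Sz[c' dc' Sc']]; first by exists c => //; right.
  by exists c' => //; right.
Qed.

(** The geometric series. The bound b supplied by [viable] is arbitrary, so it is applied to the
    tail after n digits, where |z|^n damps it. *)
Lemma viable_bound z e : nm z < 1 -> z != 0 -> viable z e ->
  nm e <= (1 - nm z)^-1.
Proof.
move=> z1 zn0 [S [Se [b Sb] Sz]].
have q0 : 0 < 1 - nm z by rewrite subr_gt0.
have bnd n x : S x -> nm x <= (1 - nm z)^-1 + nm z ^+ n * `|b|.
  elim: n x => [|n IHn] x Sx.
    rewrite expr0 mul1r (le_trans (Sb _ Sx)) // (le_trans (ler_norm b)) //.
    by rewrite lerDr invr_ge0 ltW.
  have [c dc /IHn Sc] := Sz _ Sx.
  have -> : x = z * ((x - c) / z) + c by rewrite mulrC divfK // subrK.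
  apply: le_trans (nmD _ _) _; rewrite nmM.
  have c1 : nm c <= 1 by case: dc => ->; rewrite ?nmN ?nm1 ?nm0.
  have := ler_wpM2l (nm_ge0 z) Sc; rewrite exprS.
  set u := (1 - nm z)^-1; have uE : u * (1 - nm z) = 1 by rewrite mulVf // gt_eqF.
  by set v := nm z ^+ n; nra.
rewrite leNgt; apply/negP => lt; rewrite -subr_gt0 in lt.
have [n nlt] := expr_small (nm_ge0 z) z1 (normr_ge0 b) lt.
by have := bnd n _ Se; lra.
Qed.

Section Differences.
Variable z : C.
Hypothesis Dz : Dstar z.
Let z0 : 0 < nm z. Proof. by have /Dstar_nm/andP[] := Dz. Qed.
Let z1 : nm z < 1. Proof. by have /Dstar_nm/andP[] := Dz. Qed.
Let zn0 : z != 0. Proof. by rewrite -nm_gt0. Qed.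
Let omz : 1 - z != 0.
Proof.
rewrite subr_eq0; apply/eqP => z_1.
by move: z1; rewrite -z_1 nm1 ltxx.
Qed.

Definition LamD : set C :=
  [set d | exists x y, [/\ Lam z x, Lam z y & d = (x - y) / (1 - z)]].

Lemma LamD_step (a b x y x' y' : C) :
  x = z * x' + a * (1 - z) -> y = z * y' + b * (1 - z) ->
  ((x - y) / (1 - z) - (a - b)) / z = (x' - y') / (1 - z).
Proof. by move=> -> ->; field; rewrite omz zn0. Qed.

Lemma LamD_split x y : Lam z x -> Lam z y ->
  exists a b x' y', [/\ (a = 0 \/ a = 1) /\ (b = 0 \/ b = 1), Lam z x', Lam z y',
    x = z * x' + a * (1 - z) & y = z * y' + b * (1 - z)].
Proof.
move=> /(Lam_split Dz)[x' Lx' xE] /(Lam_split Dz)[y' Ly' yE].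
have bit (v v' : C) : v = z * v' \/ v = z * v' + (1 - z) ->
    exists2 a : C, a = 0 \/ a = 1 & v = z * v' + a * (1 - z).
  by case=> ->; [exists 0|exists 1]; rewrite ?mul0r ?mul1r ?addr0; auto.
have [a a01 xE'] := bit _ _ xE; have [b b01 yE'] := bit _ _ yE.
by exists a, b, x', y'.
Qed.

Lemma digit_bits (a b : C) : (a = 0 \/ a = 1) -> (b = 0 \/ b = 1) -> digit (a - b).
Proof.
move=> [->|->] [->|->]; rewrite ?subrr ?sub0r ?subr0.
- by apply: Or32.
- by apply: Or31.
- by apply: Or33.
- by apply: Or32.
Qed.

Lemma LamD_viable e : LamD e -> viable z e.
Proof.
move=> De; have [b b0 Lb] := Lam_bounded Dz.
exists LamD; split=> //.
  exists ((b + b) / nm (1 - z)) => _ [x [y [Lx Ly ->]]].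
  rewrite nmf ler_pM2r ?invr_gt0 ?nm_gt0 //; apply: le_trans (nmD _ _) _.
  by rewrite nmN lerD // Lb.
move=> _ [x [y [Lx Ly ->]]].
have [a [b' [x' [y' [[a01 b01] Lx' Ly' xE yE]]]]] := LamD_split Lx Ly.
exists (a - b'); first exact: digit_bits.
by rewrite (LamD_step xE yE); exists x', y'.
Qed.

Lemma viable_LamD : viable z `<=` LamD.
Proof.
move=> e [S [Se [b' Sb] Sz]]; have [b b0 Lb] := Lam_bounded Dz.
have [p Lp] := Lam_neq0 Dz.
have cD : compact LamD.
  have -> : LamD = (fun s : C * C => (s.1 - s.2) / (1 - z)) @` (Lam z `*` Lam z).
    apply/seteqP; split=> [_ [x [y [Lx Ly ->]]]|_ [[x y] [Lx Ly] <-]].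
      by exists (x, y).
    by exists x, y.
  apply: continuous_compact; last by apply: compact_setX; exact: Lam_compact.
  apply: continuous_subspaceT => s; apply: cvgMl.
  by apply: cvgB; [exact: cvg_fst|exact: cvg_snd].
apply: (@expansion_sub_closed z digit S _ ((b + b) / nm (1 - z)) b') => //.
- exact: compact_closed_nm cD.
- by exists ((p - p) / (1 - z)), p, p.
- move=> _ [x [y [Lx Ly ->]]].
  rewrite nmf ler_pM2r ?invr_gt0 ?nm_gt0 //; apply: le_trans (nmD _ _) _.
  by rewrite nmN lerD // Lb.
- move=> c _ dc [x [y [Lx Ly ->]]].
  have Lf := Lam_f Dz; have Lg := Lam_g Dz; case: dc => ->.
  + exists (z * x), (z * y + (1 - z)); split; [exact: Lf|exact: Lg|].
    by field.
  + by exists (z * x), (z * y); split; [exact: Lf|exact: Lf|field].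
  + exists (z * x + (1 - z)), (z * y); split; [exact: Lg|exact: Lf|].
    by field.
- move=> x /Sz[c dc Sc]; exists ((x - c) / z) => //; exists c => //.
  by rewrite mulrC divfK // subrK.
Qed.

(** The equation f x = g y reads z (x - y) = 1 - z, that is (y - x) / (1 - z) = -1/z. *)
Lemma meet_viable : (ifs_f z) @` Lam z `&` (ifs_g z) @` Lam z !=set0 <->
  viable z (- z^-1).
Proof.
split=> [[p [[x Lx xp] [y Ly yp]]]|/viable_LamD[y [x [Ly Lx E]]]].
  apply: LamD_viable; exists y, x; split => //.
  have xy : z * x = z * y + (1 - z) by rewrite -ifs_gE yp -xp.
  have -> : y - x = (z * y - z * x) / z by field.
  by rewrite xy; field; rewrite omz zn0.
exists (z * x); split; first by exists x.
exists y => //; rewrite ifs_gE.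
have -> : z * x = z * y - z * (1 - z) * ((y - x) / (1 - z)).
  by field.
by rewrite -E; field.
Qed.

Lemma Mset_viable : Mset z <-> viable z (- z^-1).
Proof.
rewrite -meet_viable; split=> [[_ /(connected_Lam_meet Dz)] //|m].
by split => //; exact: meet_connected_Lam.
Qed.

(* Every orbit point of a rigid [e] has a unique viable digit, and it is a
   nonzero one, so both digits of a pair (x, y) with difference (1 - z) e
   are determined. *)
Definition rigid e : Prop := exists2 S : set C, S e &
  forall u, S u -> exists c, [/\ c = -1 \/ c = 1, S ((u - c) / z) &
    forall c', digit c' -> viable z ((u - c') / z) -> c' = c].

(** As a difference of bits, 1 is only 1 - 0 and -1 is only 0 - 1. So both pairs split with the same
    bits at every step, and x, x' agree up to |z|^n (b + b). *)
Lemma rigid_unique e x y x' y' : rigid e ->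
  Lam z x -> Lam z y -> Lam z x' -> Lam z y' ->
  (x - y) / (1 - z) = e -> (x' - y') / (1 - z) = e -> x = x'.
Proof.
move=> [S Se Srig] Lx Ly Lx' Ly' xy xy'.
have [b b0 Lb] := Lam_bounded Dz.
have close n : forall u v v1 v' v1', S u -> Lam z v -> Lam z v1 -> Lam z v' ->
    Lam z v1' -> (v - v1) / (1 - z) = u -> (v' - v1') / (1 - z) = u ->
    nm (v - v') <= nm z ^+ n * (b + b).
  elim: n => [|n IHn] u v v1 v' v1' Su Lv Lv1 Lv' Lv1' vu vu'.
    rewrite expr0 mul1r; apply: le_trans (nmD _ _) _.
    by rewrite nmN lerD // Lb.
  have [c [c1 Sc cu]] := Srig _ Su.
  have [a [a1 [s [s1 [[a01 a101] Ls Ls1 vE v1E]]]]] := LamD_split Lv Lv1.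
  have [a' [a1' [s' [s1' [[a01' a101'] Ls' Ls1' vE' v1E']]]]] := LamD_split Lv' Lv1'.
  have E := LamD_step vE v1E; have E' := LamD_step vE' v1E'.
  have ac : a - a1 = c.
    apply: cu; first exact: digit_bits.
    by rewrite -vu E; apply: LamD_viable; exists s, s1.
  have ac' : a' - a1' = c.
    apply: cu; first exact: digit_bits.
    by rewrite -vu' E'; apply: LamD_viable; exists s', s1'.
  have aa' : a = a'.
    have n1 : (0 : C) != 1 by rewrite eq_sym oner_neq0.
    have nN1 : (0 : C) != -1 by rewrite eq_sym oppr_eq0 oner_neq0.
    have n2 : (-1 : C) != 1 by rewrite eq_sym -subr_eq0 opprK -[1 + 1]/(2%:R) pnatr_eq0.
    move: c1 a01 a101 a01' a101' ac ac' => [->|->] [->|->] [->|->] [->|->] [->|->] //;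
      rewrite ?subrr ?sub0r ?subr0 => /eqP + /eqP;
      by rewrite ?(negPf n1) ?(negPf nN1) ?(negPf n2) ?[1 == -1]eq_sym ?(negPf n2).
  have -> : v - v' = z * (s - s') by rewrite vE vE' aa'; ring.
  rewrite nmM exprS -mulrA ler_wpM2l ?nm_ge0 //.
  apply: (IHn ((u - c) / z) s s1 s' s1') => //.
    by rewrite -E vu ac.
  by rewrite -E' vu' ac'.
apply/eqP; rewrite -subr_eq0 -nm_eq0 eq_le nm_ge0 andbT leNgt; apply/negP => lt.
have [n nlt] := expr_small (nm_ge0 z) z1 (ltW (addr_gt0 b0 b0)) lt.
by have := close n _ _ _ _ _ Se Lx Ly Lx' Ly' xy xy'; rewrite leNgt nlt.
Qed.

(** The symmetry x -> 1 - x exchanges the two images of Lambda, so it fixes their only common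
    point. *)
Lemma rigid_meet : rigid (- z^-1) -> viable z (- z^-1) ->
  (ifs_f z) @` Lam z `&` (ifs_g z) @` Lam z = [set 2^-1].
Proof.
move=> rig via.
have uniq p q : (ifs_f z @` Lam z) p -> (ifs_g z @` Lam z) p ->
    (ifs_f z @` Lam z) q -> (ifs_g z @` Lam z) q -> p = q.
  have diff (v v1 r : C) : ifs_f z v = r -> ifs_g z v1 = r -> (v1 - v) / (1 - z) = - z^-1.
    move=> <-; rewrite ifs_gE /ifs_f => vE.
    have -> : v1 - v = (z * v1 - z * v) / z by field.
    by rewrite -vE; field; rewrite omz zn0.
  move=> [x Lx xp] [y Ly yp] [x' Lx' xq] [y' Ly' yq]; rewrite -yp -yq; congr ifs_g.
  exact: (rigid_unique rig Ly Lx Ly' Lx' (diff _ _ _ xp yp) (diff _ _ _ xq yq)).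
have [p [fp gp]] := iffRL meet_viable via.
have pE : p = 2^-1.
  have fp' : (ifs_f z @` Lam z) (1 - p).
    have [y Ly <-] := gp; exists (1 - y); first exact: Lam_sym.
    by rewrite ifs_gE /ifs_f; ring.
  have gp' : (ifs_g z @` Lam z) (1 - p).
    have [x Lx <-] := fp; exists (1 - x); first exact: Lam_sym.
    by rewrite ifs_gE /ifs_f; ring.
  have pp := uniq _ _ fp gp fp' gp'.
  have n2 : (2 : C) != 0 by rewrite pnatr_eq0.
  apply: (mulIf n2); rewrite mulVf // mulr_natr mulr2n {1}pp; ring.
rewrite -pE; apply/seteqP; split=> [q [fq gq]|q ->]; last by split.
exact: uniq.
Qed.

End Differences.
End IFS.

(** * Continuous arguments and separation of the plane *)

Section Argument.
Variable R : realType.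
Local Notation C := (CC R).
Implicit Types (x y : C) (K L : set C).

Definition cis (t : R) : C := (cos t +i* sin t)%C.

Lemma cisD s t : cis (s + t) = cis s * cis t.
Proof. by rewrite /cis cosD sinD; congr (_ +i* _)%C; rewrite addrC. Qed.

Lemma nm_cis t : nm (cis t) = 1.
Proof. by rewrite nm_sqrt /= cos2Dsin2 sqrtr1. Qed.

Lemma cis_neq0 t : cis t != 0.
Proof. by rewrite -nm_gt0 nm_cis. Qed.

Lemma cis0 : cis 0 = 1.
Proof. by rewrite /cis cos0 sin0. Qed.

Lemma cis2pi : cis (pi *+ 2) = 1.
Proof. by rewrite /cis cos2pi sin2pi. Qed.

Lemma cis_continuous : continuous cis.
Proof.
by move=> t; apply: cvg_complex; [exact: continuous_cos|exact: continuous_sin].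
Qed.

(** An argument of u only in the right half-plane; arguments elsewhere are built from quotients that
    stay there. *)
Definition parg (u : C) : R := atan (complex.Im u / complex.Re u).

Lemma parg1 : parg 1 = 0.
Proof. by rewrite /parg /= mul0r atan0. Qed.

Lemma parg_gt0 (u : C) : 0 < complex.Re u -> 0 < complex.Im u -> 0 < parg u.
Proof. by move=> a b; rewrite /parg -{1}atan0 lt_atan // divr_gt0. Qed.

Lemma cis_parg (u : C) : 0 < complex.Re u -> u = (nm u)%:C * cis (parg u).
Proof.
case: u => a b /= a0; rewrite /cis /parg /=.
set t := b / a; set c := cos (atan t); set n := nm _.
have cn0 : c != 0 by rewrite /c cos_atan invr_eq0 sqrtr_eq0 -ltNge ltr_pwDl ?sqr_ge0.
have c0 : 0 <= c by rewrite /c cos_atan invr_ge0 sqrtr_ge0.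
have sE : sin (atan t) = t * c by rewrite -{2}(atanK t) /tan divfK.
have c2 : c ^+ 2 * (1 + t ^+ 2) = 1.
  rewrite /c cos_atan exprVn sqr_sqrtr ?mulVf //.
    by rewrite gt_eqF // ltr_pwDl ?sqr_ge0.
  by rewrite addr_ge0 ?sqr_ge0.
have an : a != 0 by rewrite gt_eqF.
have n2 : n ^+ 2 = a ^+ 2 * (1 + t ^+ 2).
  by rewrite nm_sqr /= /t; field.
have nc : n * c = a.
  apply/eqP; rewrite -(eqrXn2 (n := 2)) ?mulr_ge0 ?nm_ge0 ?(ltW a0) //.
  by rewrite exprMn n2 -mulrA [_ * c ^+ 2]mulrC c2 mulr1.
rewrite sE; congr (_ +i* _)%C; rewrite /= ?mul0r ?subr0 ?addr0 //.
by rewrite mulrCA nc /t divfK.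
Qed.

Lemma parg_continuous (u : C) : 0 < complex.Re u -> {for u, continuous parg}.
Proof.
move=> u0; apply: (@continuous_comp _ _ _ (fun v : C => complex.Im v / complex.Re v) (@atan R)).
  apply: (@continuousM _ _ (@complex.Im R : C -> R) (fun v : C => (complex.Re v)^-1)).
    exact: continuous_Im.
  by apply: continuousV; [rewrite gt_eqF|exact: continuous_Re].
exact: continuous_atan.
Qed.

Lemma Re_gt0_near1 (u : C) : nm (u - 1) < 1 -> 0 < complex.Re u.
Proof.
move=> u1; have := le_lt_trans (nm_Re _) u1; rewrite raddfB /= ltr_norml.
by move=> /andP[]; lra.
Qed.

Lemma within_continuous_comp (T U V : topologicalType) (A : set T)
    (f : T -> U) (g : U -> V) :
  {within A, continuous f} -> (forall p, A p -> {for f p, continuous g}) ->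
  {within A, continuous (g \o f)}.
Proof.
move=> cf cg; rewrite continuous_subspace_in => p /set_mem Ap.
apply: (@continuous_comp (subspace A) U V f g p); [exact: cf|exact: cg].
Qed.

Lemma within_eq_continuous (T U : topologicalType) (A : set T) (f g : T -> U) :
  (forall p, A p -> f p = g p) -> {within A, continuous f} ->
  {within A, continuous g}.
Proof.
move=> fg; apply: subspace_eq_continuous => p /set_mem Ap; exact: fg.
Qed.

Lemma cis_eq_cos (s t : R) : cis s = cis t -> cos (s - t) = 1.
Proof. by case=> cst sst; rewrite cosB cst sst -!expr2 cos2Dsin2. Qed.

(** If h b differed from h a, the intermediate value theorem would give a t at which |h t - h a|
    lies in ]0, pi], where the cosine is less than 1. *)
Lemma cis_const (h : R -> R) (a b : R) : a <= b ->
  {within `[a, b], continuous h} ->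
  (forall t, a <= t <= b -> cis (h t) = cis (h a)) -> h b = h a.
Proof.
move=> ab ch hc; apply/eqP; apply/negP => /negP hab.
have hit d : 0 < d -> d <= pi -> forall t, a <= t <= b ->
    `|h t - h a| = d -> False.
  move=> d0 dpi t tab hd; have := cis_eq_cos (hc t tab).
  have -> : cos (h t - h a) = cos d.
    by rewrite -hd; case: (ger0P (h t - h a)) => _; rewrite ?cosN.
  have : cos d < cos 0.
    by rewrite ltr_cos // in_itv /= ?dpi ?(ltW d0) ?lexx ?pi_ge0.
  by rewrite cos0 => /lt_eqF/eqP.
pose d := Num.min `|h b - h a| pi.
have d0 : 0 < d by rewrite lt_min pi_gt0 normr_gt0 subr_eq0 hab.
have dpi : d <= pi by rewrite ge_min lexx orbT.
have dh : d <= `|h b - h a| by rewrite ge_min lexx.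
have [ge|lt] := leP (h a) (h b).
  have [|c cab hE] := @IVT _ h a b (h a + d) ab ch.
    rewrite min_l // max_r //; apply/andP; split; first by rewrite lerDl ltW.
    by move: dh; rewrite ger0_norm ?subr_ge0 //; lra.
  apply: (hit d d0 dpi c); first by move: cab; rewrite in_itv.
  by rewrite hE addrAC subrr add0r ger0_norm // ltW.
have [|c cab hE] := @IVT _ h a b (h a - d) ab ch.
  rewrite min_r ?max_l ?(ltW lt) //; apply/andP; split; last by rewrite lerBlDr lerDl ltW.
  by move: dh; rewrite ltr0_norm ?subr_lt0 //; lra.
apply: (hit d d0 dpi c); first by move: cab; rewrite in_itv.
by rewrite hE addrAC subrr add0r normrN ger0_norm // ltW.
Qed.

(** * Degree of a map from the plane to the unit circle, on concentric circles *)

Section NoRetraction.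
Variables (F : C -> C) (x0 : C) (r : R).
Hypothesis cF : continuous F.
Hypothesis F1 : forall p, nm (F p) = 1.
Hypothesis r0 : 0 < r.
Hypothesis Fr : forall p, nm (p - x0) = r -> F p = (p - x0) / r%:C.

Let circ (t s : R) : C := x0 + t%:C * cis s.

(** States that F has degree 0 on the circle of radius t about [x0]. *)
Let periodic_arg (t : R) : Prop := exists (c : C) (h : R -> R),
  [/\ {within `[0, pi *+ 2], continuous h}, h (pi *+ 2) = h 0 &
      forall s, `[0, pi *+ 2]%classic s -> F (circ t s) = c * cis (h s)].

Let circ_continuous t : continuous (circ t).
Proof.
move=> s; apply: (@continuous_comp _ _ _ cis (fun p : C => x0 + t%:C * p)).
  exact: cis_continuous.
have -> : (fun p : C => x0 + t%:C * p) = (fun p => t%:C * p + x0).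
  by apply/funext => p; rewrite addrC.
exact: affine_continuous.
Qed.

(** Compactness of [0, 2 pi] makes the continuity in t uniform in s. *)
Let circ_near t0 : \forall t \near t0,
  forall s, `[0, pi *+ 2]%classic s -> nm (F (circ t s) - F (circ t0 s)) < 1.
Proof.
apply: (iffLR (compact_near_coveringP _) (@segment_compact R 0 (pi *+ 2))
  R (nbhs t0) (fun t s => nm (F (circ t s) - F (circ t0 s)) < 1)).
move=> s _.
have F2 : 0 < 1 / 2 :> R by rewrite divr_gt0.
have [d d0 Fd] := iffLR (continuous_nmP F (circ t0 s)) (@cF (circ t0 s)) _ F2.
have d2 : 0 < d / 2 by rewrite divr_gt0.
have near_s : \forall s' \near s, nm (circ t0 s' - circ t0 s) < d / 2.
  exact: (circ_continuous (nbhs_nm _ d2)).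
have near_t : \forall t \near t0, `|t - t0| < d / 2.
  by apply/nbhs_ballP; exists (d / 2) => //= t; rewrite /ball /= distrC.
exists ([set s' | nm (circ t0 s' - circ t0 s) < d / 2], [set t | `|t - t0| < d / 2]).
  by split.
move=> [s' t] [/= Hs Ht].
have H1 : nm (circ t s' - circ t0 s') < d / 2.
  by rewrite /circ opprD addrACA subrr add0r -mulrBl nmM nm_cis mulr1 -rmorphB nmR.
have H2 : nm (circ t s' - circ t0 s) < d.
  by have := nm_tri (circ t0 s') (circ t s') (circ t0 s); lra.
have H3 : nm (circ t0 s' - circ t0 s) < d by lra.
have := Fd _ H2; have := Fd _ H3.
have := nm_tri (F (circ t0 s)) (F (circ t s')) (F (circ t0 s')).
by rewrite (nmB (F (circ t0 s')) (F (circ t0 s))); lra.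
Qed.

Let circ_periodic t s : circ t (s + pi *+ 2) = circ t s.
Proof. by rewrite /circ cisD cis2pi mulr1. Qed.

Let pi2 : 0 <= pi *+ 2 :> R. Proof. by rewrite mulrn_wge0 ?pi_ge0. Qed.

(** The quotient of two unit numbers at distance less than 1 lies in the right half-plane; its
    principal argument is a continuous periodic correction of h. *)
Let periodic_arg_step t t' : periodic_arg t ->
  (forall s, `[0, pi *+ 2]%classic s -> nm (F (circ t' s) - F (circ t s)) < 1) ->
  periodic_arg t'.
Proof.
move=> [c [h [ch hp Fh]]] tt'.
have Fn0 p : F p != 0 by rewrite -nm_gt0 F1.
pose q s := F (circ t' s) / F (circ t s).
have Rq s : `[0, pi *+ 2]%classic s -> 0 < complex.Re (q s).
  move=> s2; apply: Re_gt0_near1.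
  have -> : q s - 1 = (F (circ t' s) - F (circ t s)) / F (circ t s).
    by rewrite mulrBl divff.
  by rewrite nmf F1 divr1; exact: tt'.
have cq : continuous q.
  move=> s; apply: cvgM.
    by apply: (@continuous_comp _ _ _ (circ t') F); [exact: circ_continuous|exact: cF].
  apply: cvgV; first exact: Fn0.
  by apply: (@continuous_comp _ _ _ (circ t) F); [exact: circ_continuous|exact: cF].
exists c, (fun s => h s + parg (q s)); split.
- move=> s; apply: cvgD; first exact: ch.
  apply: (@within_continuous_comp _ _ _ _ q parg).
    exact: continuous_subspaceT.
  by move=> p /Rq; exact: parg_continuous.
- by rewrite /q hp -[pi *+ 2]add0r !circ_periodic.
- move=> s s2; rewrite cisD mulrA -Fh //.
  have := cis_parg (Rq _ s2); rewrite /q nmf !F1 divr1 mul1r => <-.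
  by rewrite mulrC divfK.
Qed.

(** The degree is locally constant in t. It is 0 at t = 0, where F is constant on the circle, but at
    t = r the angle s itself would have to be periodic. *)
Lemma no_retraction : False.
Proof.
pose U := [set t | periodic_arg t].
have oU : open U.
  rewrite openE => t Ut; apply: filterS (circ_near t) => t' tt'.
  exact: periodic_arg_step Ut tt'.
have oV : open (~` U).
  rewrite openE => t nUt; apply: filterS (circ_near t) => t' tt' Ut'.
  apply: nUt; apply: periodic_arg_step Ut' _ => s s2.
  by rewrite nmB; exact: tt'.
have U0 : U 0.
  exists (F x0), (fun=> 0); split => //.
    by apply: continuous_subspaceT => s; exact: cvg_cst.
  by move=> s _; rewrite /circ mul0r addr0 cis0 mulr1.
have Ur : U r.
  apply: (connected_open_split (@segment_connected R 0 r) oU oV).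
  - by move=> t _; case: (pselect (U t)); [left|right].
  - by move=> t _.
  - by exists 0; split => //=; rewrite in_itv /= lexx ltW.
  - by rewrite /= in_itv /= lexx ltW.
have [c [h [ch hp Fh]]] := Ur.
have FE s : `[0, pi *+ 2]%classic s -> cis s = c * cis (h s).
  move=> s2; rewrite -Fh // Fr; last first.
    by rewrite /circ addrAC subrr add0r nmM nm_cis mulr1 nmR ger0_norm // ltW.
  rewrite /circ addrAC subrr add0r mulrAC divff ?mul1r //.
  by rewrite -nm_gt0 nmR normr_gt0 gt_eqF.
have D : (pi *+ 2 - h (pi *+ 2)) = (0 - h 0).
  apply: (@cis_const (fun s => s - h s) _ _ pi2).
    move=> s; apply: cvgB; last exact: ch.
    by apply: continuous_subspaceT => p; exact: cvg_id.
  have cE s : 0 <= s <= pi *+ 2 -> cis (s - h s) = c.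
    move=> s2; apply: (mulIf (cis_neq0 (h s))).
    by rewrite -cisD subrK FE //= in_itv.
  by move=> t t2; rewrite !cE ?lexx.
have : 0 < pi *+ 2 :> R by rewrite pmulrn_lgt0 ?pi_gt0.
by move: D; rewrite hp; lra.
Qed.

End NoRetraction.

(** * Continuous arguments on a compact set and components of its complement *)

Lemma cstR_continuous (a : R) : continuous (fun _ : C => a).
Proof. by apply: lipschitzR_continuous => x y; rewrite subrr normr0 nm_ge0. Qed.

Lemma within_nmP K (h : C -> R) : {within K, continuous h} <->
  forall x, K x -> forall e, 0 < e -> exists2 d, 0 < d &
    forall y, K y -> nm (y - x) < d -> `|h y - h x| < e.
Proof.
rewrite subspace_continuousP; split=> ch x Kx.
  move=> e e0.
  have /nbhs_nmP[d d0 dh] : within K (nbhs x) (h @^-1` [set t | `|t - h x| < e]).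
    apply: (ch x Kx); apply/nbhs_ballP; exists e => //= t.
    by rewrite /ball /= distrC.
  by exists d => // y Ky /dh; apply.
move=> A /nbhs_ballP[e /= e0 eA]; have [d d0 dh] := ch x Kx e e0.
apply/nbhs_nmP; exists d => // y yd Ky; apply: eA.
by rewrite /ball /= distrC; exact: dh.
Qed.

(** A continuous argument of p - x over K, up to the fixed rotation c; with c, no argument of a
    reference direction has to be chosen. *)
Definition arg_on K (x : C) := exists (c : C) (h : C -> R),
  [/\ nm c = 1, {within K, continuous h} &
      forall p, K p -> p - x = (nm (p - x))%:C * (c * cis (h p))].

Lemma arg_on_mul K x y (c : C) (q : C -> C) (h : C -> R) :
  nm c = 1 -> {within K, continuous h} ->
  {within K, continuous q} -> (forall p, K p -> 0 < complex.Re (q p)) ->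
  (forall p, K p -> exists2 a : R, 0 <= a & p - y = a%:C * (c * cis (h p)) * q p) ->
  arg_on K y.
Proof.
move=> c1 ch cq q0 pE; exists c, (fun p => h p + parg (q p)); split => //.
  move=> p; apply: cvgD; first exact: ch.
  apply: (@within_continuous_comp _ _ _ _ q parg cq).
  by move=> s /q0; exact: parg_continuous.
move=> p Kp; have [a a0 E] := pE p Kp.
rewrite E !nmM c1 nm_cis nmR ger0_norm // !mulr1 rmorphM /= cisD.
by rewrite {1}(cis_parg (q0 _ Kp)); ring.
Qed.

(** Divided by a - x, the vector p - x becomes 1 - (p - a) / (x - a), which is in the right
    half-plane. *)
Lemma arg_on_far K x (a : C) :
  (forall p, K p -> nm (p - a) < nm (x - a)) -> arg_on K x.
Proof.
move=> Kx; have [->|/set0P[p0 Kp0]] := eqVneq K set0.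
  by exists 1, (fun=> 0); split => //; [exact: nm1|exact: continuous_subspace0].
have n0 : 0 < nm (x - a) := le_lt_trans (nm_ge0 _) (Kx _ Kp0).
have xa0 : x - a != 0 by rewrite -nm_gt0.
have nC : ((nm (x - a))%:C : C) != 0 by rewrite -nm_gt0 nmR normr_gt0 gt_eqF.
apply: (@arg_on_mul K x x (- (x - a) / (nm (x - a))%:C)
  (fun p => (- (x - a)^-1) * p + (1 + a / (x - a))) (fun=> 0)).
- by rewrite nmf nmN nmR ger0_norm ?nm_ge0 // divff // gt_eqF.
- exact/continuous_subspaceT/cstR_continuous.
- by apply: continuous_subspaceT; exact: affine_continuous.
- move=> p Kp; apply: Re_gt0_near1.
  have -> : - (x - a)^-1 * p + (1 + a / (x - a)) - 1 = - ((p - a) / (x - a)).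
    by field.
  by rewrite nmN nmf ltr_pdivrMr // mul1r Kx.
- move=> p Kp; exists (nm (x - a)); first exact: nm_ge0.
  by rewrite cis0; field; rewrite xa0 nC.
Qed.

(** The quotient (p - y) / (p - x) = 1 + (x - y) / (p - x) is in the right half-plane, so its
    principal argument corrects the one for x. *)
Lemma arg_on_near K x y : arg_on K x ->
  (forall p, K p -> nm (x - y) < nm (p - x)) -> arg_on K y.
Proof.
move=> [c [h [c1 ch hE]]] xy.
have px0 p : K p -> p - x != 0.
  by move=> /xy pxy; rewrite -nm_gt0 (le_lt_trans (nm_ge0 _) pxy).
apply: (@arg_on_mul K x y c (fun p => 1 + (x - y) / (p - x)) h) => //.
- rewrite continuous_subspace_in => p /set_mem Kp.
  apply: cvgD; first exact: cvg_cst.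
  apply: cvgM; first exact: cvg_cst.
  apply: cvgV; first exact: px0.
  by apply: cvgB; [exact: (continuous_subspaceT (fun p => cvg_id))|exact: cvg_cst].
- move=> p Kp; apply: Re_gt0_near1; rewrite addrAC subrr add0r nmf.
  by rewrite ltr_pdivrMr ?nm_gt0 ?px0 // mul1r xy.
- move=> p Kp; exists (nm (p - x)); first exact: nm_ge0.
  by rewrite -hE //; field; exact: px0.
Qed.

(** As A and B share only q, shifting the argument on B by the constant that makes the two agree at
    q is enough. The condition q != x makes the directions at q comparable. *)
Lemma arg_on_glue A B (q x : C) : closed A -> closed B -> A q -> B q ->
  A `&` B `<=` [set q] -> q != x -> arg_on A x -> arg_on B x -> arg_on (A `|` B) x.
Proof.
move=> cA cB Aq Bq ABq qx [c [h [c1 ch hE]]] [c' [h' [c1' ch' hE']]].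
pose d := h q - h' q.
have c'E : c' = c * cis d.
  apply: (mulIf (cis_neq0 (h' q))); rewrite -mulrA -cisD subrK.
  have qn : ((nm (q - x))%:C : C) != 0.
    by rewrite -nm_gt0 nmR normr_gt0 nm_eq0 subr_eq0.
  by apply: (mulfI qn); rewrite -hE // -hE'.
pose k p := if pselect (A p) then h p else h' p + d.
have kA p : A p -> h p = k p by rewrite /k; case: pselect.
have kB p : B p -> h' p + d = k p.
  move=> Bp; rewrite /k; case: pselect => [Ap|] //=.
  by rewrite (ABq p (conj Ap Bp)) /d subrKC.
exists c, k; split => //.
  apply: withinU_continuous => //; first exact: within_eq_continuous kA ch.
  apply: (within_eq_continuous kB) => p; apply: cvgD; first exact: ch'.
  exact: cvg_cst.
move=> p [Ap|Bp]; first by rewrite -(kA p Ap); exact: hE.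
rewrite -(kB p Bp); have E := hE' p Bp.
by rewrite {1}E c'E addrC cisD; ring.
Qed.

Lemma arg_on_affine K x (a b : C) : a != 0 -> arg_on K x ->
  arg_on ((fun p => a * p + b) @` K) (a * x + b).
Proof.
move=> a0 [c [h [c1 ch hE]]].
have na : ((nm a)%:C : C) != 0 by rewrite -nm_gt0 nmR normr_gt0 nm_eq0.
exists (a / (nm a)%:C * c), (fun p => h (a^-1 * p + - (a^-1 * b))); split.
- by rewrite nmM c1 mulr1 nmf nmR ger0_norm ?nm_ge0 // divff // nm_eq0.
- move/within_nmP: ch => ch; apply/within_nmP => _ [u Ku <-] e e0.
  have uE v : a^-1 * (a * v + b) + - (a^-1 * b) = v by field.
  have [d d0 dh] := ch u Ku e e0; exists (nm a * d).
    by rewrite mulr_gt0 ?nm_gt0.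
  move=> _ [v Kv <-]; rewrite !uE.
  have -> : a * v + b - (a * u + b) = a * (v - u) by ring.
  by rewrite nmM ltr_pM2l ?nm_gt0 //; exact: dh.
- move=> _ [p Kp <-].
  have -> : a^-1 * (a * p + b) - a^-1 * b = p by field.
  have -> : a * p + b - (a * x + b) = a * (p - x) by ring.
  rewrite {1}hE // nmM rmorphM /=; field; exact: na.
Qed.

Definition to_pair (p : C) : R * R := (complex.Re p, complex.Im p).

Lemma to_pair_continuous : continuous to_pair.
Proof. by move=> p; exact: (cvg_pair (@continuous_Re R p) (@continuous_Im R p)). Qed.

Lemma to_pairK : cancel to_pair (@of_pair R). Proof. by case. Qed.
(** Transported to [R * R], whose metric is real-valued; compactness of K gives the bound on h that
    the bounded extension theorem asks for. *)
Lemma tietze_plane K (h : C -> R) : compact K -> {within K, continuous h} ->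
  exists2 g : C -> R, continuous g & forall p, K p -> h p = g p.
Proof.
move=> cK ch; have [K0|/set0P K0] := eqVneq K set0.
  by exists (fun=> 0); [exact: cstR_continuous|rewrite K0].
have [|b Kb bmax] := @compact_EVT_max _ R (fun p => `|h p|) K K0 cK.
  apply: (@within_continuous_comp _ _ _ K h Num.norm) => // p _.
  exact: norm_continuous.
pose K' := to_pair @` K.
have cK' : closed K'.
  apply: compact_closed; first exact: norm_hausdorff.
  by apply: continuous_compact => //; apply: continuous_subspaceT; exact: to_pair_continuous.
have ch' : {within K', continuous (h \o @of_pair R)}.
  apply/subspace_continuousP => q [p Kp <-] A /= hA.
  have /nbhs_nmP[d d0 dA] : within K (nbhs p) (h @^-1` A).
    have hA' : nbhs (h p) A by move: hA; rewrite /from_subspace /= to_pairK.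
    by move/subspace_continuousP : ch => /(_ p Kp); apply.
  have : nbhs (of_pair (to_pair p)) [set y | nm (y - p) < d].
    by rewrite to_pairK; exact: nbhs_nm.
  move/of_pair_continuous => /= H; have FN := nbhs_filter (to_pair p).
  apply: (@filterS _ _ FN _ _ _ H) => q' /= q'd [p' Kp' pE].
  by apply: dA q'd _; rewrite -pE to_pairK.
have M0 : 0 < `|h b| + 1 by rewrite ltr_wpDl.
have [|g [gE cg _]] := continuous_bounded_extension (@pseudometric_normal R _) cK' M0 ch'.
  by move=> _ [p Kp <-]; rewrite /= to_pairK (le_trans (bmax p _)) ?inE // lerDl.
exists (g \o to_pair).
  by move=> p; apply: continuous_comp; [exact: to_pair_continuous|exact: cg].
move=> p Kp; rewrite /= -gE; first by rewrite /= to_pairK.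
by rewrite inE; exists p.
Qed.

(** The boundary of U lies in K. Hence the direction from x outside U and the extended argument on U
    and K fit together into a map F of the plane to the unit circle, which [no_retraction]
    forbids. *)
Lemma no_bounded_piece K (U : set C) x (r : R) : compact K -> open U ->
  U `<=` ~` K -> closed (U `|` K) -> U x -> (forall p, U p -> nm p <= r) ->
  arg_on K x -> False.
Proof.
move=> cK oU UK cUK Ux Ur [c [h [c1 ch hE]]].
have [g cg gE] := tietze_plane cK ch.
have [r1 r10 Kr1] := compact_bounded_nm cK.
pose G p := (p - x) / (nm (p - x))%:C.
pose F p := if pselect ((U `|` K) p) then c * cis (g p) else G p.
have px0 p : ~ U p -> p - x != 0.
  by move=> nUp; rewrite subr_eq0; apply/eqP => px; apply: nUp; rewrite px.
have nC (p : C) : p != 0 -> ((nm p)%:C : C) != 0.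
  by move=> p0; rewrite -nm_gt0 nmR normr_gt0 nm_eq0.
have FU p : (U `|` K) p -> c * cis (g p) = F p by rewrite /F; case: pselect.
have FG p : (~` U) p -> G p = F p.
  move=> nUp; rewrite /F; case: pselect => //= -[//|Kp].
  by have E := hE p Kp; rewrite /G {1}E mulrC mulKf ?gE // nC // px0.
have cF : continuous F.
  apply/continuous_subspace_setT.
  have -> : setT = (U `|` K) `|` ~` U.
    by apply/esym/seteqP; split=> // p _; case: (pselect (U p)) => ?; [left; left|right].
  apply: withinU_continuous => //; first exact: open_closedC.
    apply: (within_eq_continuous FU); apply: continuous_subspaceT => p.
    apply: (@continuous_comp _ _ _ g (fun t => c * cis t)); first exact: cg.
    by apply: cvgM; [exact: cvg_cst|exact: cis_continuous].
  apply: (within_eq_continuous FG); apply/subspace_continuousP => p nUp.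
  have {}nUp := px0 _ nUp.
  have cG : {for p, continuous G}.
    have csub : continuous (fun s : C => s - x).
      by have := affine_continuous (a:=1) (b:=- x); under eq_fun do rewrite mul1r.
    apply: (@continuousM _ _ (fun s : C => s - x) (fun s : C => ((nm (s - x))%:C)^-1)).
      exact: csub.
    apply: continuousV; first exact: nC.
    apply: (@continuous_comp _ _ _ (fun s : C => s - x) (fun s : C => (nm s)%:C : C)).
      exact: csub.
    exact: nmC_continuous.
  by apply: cvg_trans cG; apply: cvg_app; exact: cvg_within.
have F1 p : nm (F p) = 1.
  rewrite /F; case: pselect => [_|nUK] /=; first by rewrite nmM c1 nm_cis mulr1.
  have p0 : p - x != 0 by apply: px0 => Up; apply: nUK; left.
  by rewrite /G nmf nmR ger0_norm ?nm_ge0 // divff // nm_eq0.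
(* A circle about x of this radius lies outside the disc that contains U, so F is the plain
   direction there. *)
have rx0 : 0 < `|r| + r1 + nm x + 1.
  by rewrite ltr_wpDl // !addr_ge0 ?nm_ge0 // ltW.
apply: (@no_retraction F x _ cF F1 rx0) => p pr.
rewrite -pr -FG // => Up.
have := nm_tri 0 p x; rewrite subr0 sub0r nmN pr.
by have := Ur p Up; have := ler_norm r; lra.
Qed.

(** The outside of a large square is connected, so of a clopen part of the complement of K and the
    rest one misses it; that one is bounded and falls to [no_bounded_piece] unless it is empty. *)
Lemma arg_connected_setC K : compact K -> (forall x, ~ K x -> arg_on K x) ->
  connected (~` K).
Proof.
move=> cK Karg B B0 [V oV BV] [D cD BD].
have oKc : open (~` K) by apply: closed_openC; exact: compact_closed_nm.
have [r r0 Kr] := compact_bounded_nm cK.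
pose O := [set y : C | r < `|complex.Re y| \/ r < `|complex.Im y|].
have OK : O `<=` ~` K.
  by move=> p [] pr /Kr pK; move: pr; rewrite ltNge => /negP; apply;
    apply: le_trans pK; [exact: nm_Re|exact: nm_Im].
have Obound p : ~ O p -> nm p <= r + r.
  move=> /not_orP[/negP + /negP]; rewrite -!leNgt => p1 p2.
  by apply: le_trans (nm_le_ReIm _) _; exact: lerD.
have cO : connected O by apply: outside_square_connected; exact: ltW.
have inKV p : ~ K p -> V p -> D p.
  by move=> Kp Vp; have : B p by [rewrite BV]; rewrite BD => -[].
have inKD p : ~ K p -> D p -> V p.
  by move=> Kp Dp; have : B p by [rewrite BD]; rewrite BV => -[].
have [OB|OB] := pselect (O `&` V !=set0); last first.
  exfalso; have [x Bx] := B0.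
  have Bx' : (~` K `&` V) x by rewrite -BV.
  apply: (@no_bounded_piece K (~` K `&` V) x (r + r)) => //.
  - exact: openI.
  - have -> : (~` K `&` V) `|` K = D `|` K.
      apply/seteqP; split=> p [].
      + by move=> [Kp Vp]; left; exact: inKV.
      + by right.
      + by move=> Dp; case: (pselect (K p)) => Kp; [right|left; split => //; exact: inKD].
      + by right.
    by apply: closedU => //; exact: compact_closed_nm.
  - by move=> p [_ Vp]; apply: Obound => Op; apply: OB; exists p.
  - by apply: Karg; case: Bx'.
have OV : O `<=` V.
  apply: (connected_open_split cO oV (closed_openC cD)) => //.
    move=> p /OK Kp; case: (pselect (V p)) => Vp; [by left|right => Dp].
    by apply: Vp; exact: inKD.
  by move=> p /OK Kp Vp; apply; exact: inKV.
apply/seteqP; split; first by rewrite BV => p [].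
move=> x nKx; rewrite BV; split=> //; apply: contrapT => nVx.
apply: (@no_bounded_piece K (~` K `&` ~` D) x (r + r)) => //.
- by apply: openI => //; exact: closed_openC.
- have -> : (~` K `&` ~` D) `|` K = ~` V `|` K.
    apply/seteqP; split=> p [].
    + by move=> [Kp Dp]; left => Vp; apply: Dp; exact: inKV.
    + by right.
    + move=> Vp; case: (pselect (K p)) => Kp; [by right|left; split => // Dp].
      by apply: Vp; exact: inKD.
    + by right.
  by apply: closedU; [exact: open_closedC|exact: compact_closed_nm].
- by split=> // Dx; apply: nVx; exact: inKD.
- by move=> p [Kp Dp]; apply: Obound => /OV /(inKV _ Kp).
- exact: Karg.
Qed.

(** By [arg_on_near], having an argument is locally constant off K, so it fails on the whole
    component of w; by [arg_on_far], it holds outside the disc. *)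
Lemma bad_component K w (a : C) (r : R) : closed K -> ~ K w -> ~ arg_on K w ->
  (forall p, K p -> nm (p - a) < r) ->
  connected_component (~` K) w `<=` [set p | nm (p - a) < r].
Proof.
move=> cK Kw nw Kr.
have near_good x : ~ K x -> exists2 d, 0 < d & forall y, nm (y - x) < d ->
    (arg_on K x -> arg_on K y) /\ (arg_on K y -> arg_on K x).
  move=> nKx; have /open_nmP/(_ x nKx)[d d0 dK] := closed_openC cK.
  (* With half the distance, [arg_on_near] applies both from x to y and from y to x. *)
  have d2 : 0 < d / 2 by rewrite divr_gt0.
  exists (d / 2) => // y yx; split=> /arg_on_near; apply=> p Kp;
    (have dp : d <= nm (p - x) by rewrite leNgt; apply/negP => /dK).
    by rewrite nmB; lra.
  by have := nm_tri y p x; lra.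
have oG : open (~` K `&` arg_on K).
  apply/open_nmP => x [nKx gx]; have [d d0 dg] := near_good x nKx.
  have /open_nmP/(_ x nKx)[d' d'0 dK] := closed_openC cK.
  exists (Num.min d d'); first by rewrite lt_min d0.
  by move=> y; rewrite lt_min => /andP[/dg[H _] /dK]; split => //; exact: H.
have oB : open (~` K `&` ~` arg_on K).
  apply/open_nmP => x [nKx gx]; have [d d0 dg] := near_good x nKx.
  have /open_nmP/(_ x nKx)[d' d'0 dK] := closed_openC cK.
  exists (Num.min d d'); first by rewrite lt_min d0.
  move=> y; rewrite lt_min => /andP[/dg[_ H] /dK]; split => //.
  by move=> /H.
have sub := @connected_component_sub _ (~` K) w.
have : connected_component (~` K) w `<=` ~` K `&` ~` arg_on K.
  apply: (connected_open_split (@component_connected _ (~` K) w) oB oG).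
  - by move=> p /sub nKp; case: (pselect (arg_on K p)); [right|left].
  - by move=> p _ [_ H] [_ /H].
  - exists w; split=> //; exact: connected_component_refl.
move=> H p /H[_ np] /=; rewrite ltNge; apply/negP => rp.
by apply: np; apply: arg_on_far => q /Kr qr; exact: lt_le_trans rp.
Qed.

(* Along a loop that keeps turning left around [w], a continuous argument of
   [p - w] would strictly increase. *)
Lemma turning_not_arg_on (gam : R -> C) w (m : nat) (tau : nat -> R) :
  {within `[0, 1], continuous gam} -> gam 0 = gam 1 ->
  (0 < m)%N -> tau 0%N = 0 -> tau m = 1 -> (forall i, tau i <= tau i.+1) ->
  (forall i t, (i < m)%N -> tau i <= t <= tau i.+1 ->
     0 < complex.Re ((gam t - w) / (gam (tau i) - w))) ->
  (forall i, (i < m)%N -> 0 < complex.Im ((gam (tau i.+1) - w) / (gam (tau i) - w))) ->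
  ~ arg_on (gam @` `[0, 1]%classic) w.
Proof.
move=> cgam g01 m0 tau0 taum taumono tRe tIm [c [h [c1 ch hE]]].
have tau_le i j : (i <= j)%N -> tau i <= tau j.
  by move/subnK <-; elim: (j - i)%N => // k IHk; rewrite addSn (le_trans IHk).
have tau01 i : (i <= m)%N -> 0 <= tau i <= 1.
  by move=> im; rewrite -tau0 -taum !tau_le.
have sub01 i t : (i < m)%N -> tau i <= t <= tau i.+1 -> 0 <= t <= 1.
  move=> im /andP[t1 t2]; have /andP[a1 a2] := tau01 i (ltnW im).
  by have /andP[b1 b2] := tau01 i.+1 im; rewrite (le_trans a1 t1) (le_trans t2 b2).
pose H := h \o gam.
have img t : 0 <= t <= 1 -> (gam @` `[0, 1]%classic) (gam t).
  by move=> t01; exists t => //=; rewrite in_itv.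
have cH : {within `[0, 1], continuous H}.
  apply/subspace_continuousP => t /= t01 A hA.
  have /nbhs_nmP[d d0 dA] : within (gam @` `[0, 1]%classic) (nbhs (gam t)) (h @^-1` A).
    by move/subspace_continuousP : ch; apply=> //; exists t.
  move/subspace_continuousP: cgam => /(_ t t01 _ (nbhs_nm (gam t) d0)) N.
  have FN := nbhs_filter t.
  apply: (@filterS _ _ FN _ _ _ N) => s /= sd s01.
  by apply: dA; [exact: sd|exists s].
have incr i : (i < m)%N -> H (tau i) < H (tau i.+1).
  move=> im; pose q t := (gam t - w) / (gam (tau i) - w).
  have tii : tau i <= tau i <= tau i.+1 by rewrite lexx taumono.
  have gn0 : gam (tau i) - w != 0.
    apply/eqP => g0; have := tRe i _ im tii.
    by rewrite g0 mul0r /= ltxx.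
  have cq : {within `[tau i, tau i.+1], continuous q}.
    have sub : `[tau i, tau i.+1]%classic `<=` `[0, 1]%classic.
      by move=> t /=; rewrite !in_itv /= => /(sub01 _ _ im).
    move=> t; apply: cvgMl; apply: cvgB; last exact: cvg_cst.
    exact: (continuous_subspaceW sub cgam).
  (* On one piece, H and the principal argument of q both measure the direction from w, so they
     differ by a constant; the growth of H is thus the principal argument at the end of the
     piece. *)
  have D : H (tau i.+1) - parg (q (tau i.+1)) = H (tau i) - parg (q (tau i)).
    apply: (@cis_const (fun t => H t - parg (q t)) _ _ (taumono i)).
      have sub : `[tau i, tau i.+1]%classic `<=` `[0, 1]%classic.
        by move=> t /=; rewrite !in_itv /= => /(sub01 _ _ im).
      move=> t; apply: cvgB; first exact: (continuous_subspaceW sub cH).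
      apply: (@within_continuous_comp _ _ _ _ q parg cq).
      by move=> s /=; rewrite in_itv /= => /(tRe _ _ im); exact: parg_continuous.
    have const t : tau i <= t <= tau i.+1 -> cis (H t - parg (q t)) =
        (gam (tau i) - w) / ((nm (gam (tau i) - w))%:C * c).
      move=> tt; have qt := tRe i t im tt.
      have E1 := hE _ (img t (sub01 _ _ im tt)).
      have E2 := cis_parg qt.
      have g0 : gam t - w != 0.
        by apply/eqP => g0; move: qt; rewrite g0 mul0r /= ltxx.
      have n1 : ((nm (gam t - w))%:C : C) != 0 by rewrite -nm_gt0 nmR normr_gt0 nm_eq0.
      have n2 : ((nm (gam (tau i) - w))%:C : C) != 0 by rewrite -nm_gt0 nmR normr_gt0 nm_eq0.
      have c0 : c != 0 by rewrite -nm_gt0 c1.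
      apply: (mulIf (cis_neq0 (parg (q t)))); rewrite -cisD subrK.
      apply: (mulfI n1); apply: (mulfI c0).
      have -> : c * ((nm (gam t - w))%:C * cis (H t)) = gam t - w.
        by rewrite [RHS]E1 /H /=; ring.
      have E3 : (nm (q t))%:C * cis (parg (q t)) = q t by rewrite -E2.
      have E4 : (nm (q t))%:C = (nm (gam t - w))%:C / (nm (gam (tau i) - w))%:C :> C.
        by rewrite /q nmf fmorph_div.
      rewrite [LHS](_ : _ = q t * (gam (tau i) - w)); last by rewrite /q divfK.
      rewrite -[X in X * _ = _]E3 E4; field; rewrite n2 c0 //.
    by move=> t tt; rewrite !const.
  have q1 : q (tau i) = 1 by rewrite /q divff.
  move: D; rewrite q1 parg1.
  have := parg_gt0 (tRe i (tau i.+1) im _) (tIm i im).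
  rewrite lexx taumono => /(_ isT); rewrite -/(q _); lra.
have Hpos i : (i < m)%N -> H (tau 0%N) < H (tau i.+1).
  elim: i => [|i IHi] im; first exact: incr.
  by apply: lt_trans (IHi (ltnW im)) (incr _ im).
case: m m0 taum {tRe tIm tau01 sub01 incr} Hpos => // m _ taum /(_ m (ltnSn m)).
by rewrite tau0 taum /H /= g01 ltxx.
Qed.

End Argument.

(** * Computations with integer discs *)

(* Center and radius, in units of 1 / scale. *)
Definition disc : Type := (Z * Z * Z)%type.

Section DiscArithmetic.
Local Open Scope Z_scope.

Definition scale : Z := 100000000.
(* Approximations of 1 / omega and of 1 / (1 - omega), the fixed point of
   e |-> (e - 1) / omega; the modulus of a sum of a series in z with digits in
   {-1, 0, 1} is at most max_nm / scale. *)
Definition inv_re : Z := 91126969.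
Definition inv_im : Z := -127285746.
Definition inv_err : Z := 300.
Definition inv_nm : Z := 156543600.
Definition tip_re : Z := 94549866.
Definition tip_im : Z := 78183466.
Definition max_nm : Z := 276860000.

(* The image of a disc under e |-> (e - c) / z, for z near omega and with
   1 / z replaced by a rational approximation: the last two terms of the new
   radius bound the error of 1 / z and the rounding. *)
Definition step (c : Z) (d : disc) : disc :=
  let: (x, y, r) := d in
  let u := x - c * scale in
  ((u * inv_re - y * inv_im) / scale, (u * inv_im + y * inv_re) / scale,
   r * inv_nm / scale + (Z.abs u + Z.abs y) * inv_err / scale + 4).

(** Squares avoid a root; the test on r keeps [max_nm + r] nonnegative, so that comparing squares
    compares moduli. *)
Definition escaped (d : disc) : bool :=
  let: (x, y, r) := d in (0 <=? r) && ((max_nm + r) * (max_nm + r) <? x * x + y * y).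

(* Conjunctions are written with [if] so that call-by-value evaluation does not
   explore the whole tree. *)
Fixpoint escapes (k : nat) (d : disc) : bool :=
  if escaped d then true else
  if k is S k' then
    if escapes k' (step (-1) d) then
      if escapes k' (step 0 d) then escapes k' (step 1 d) else false
    else false
  else false.

(* By rect_check, every point of this rectangle has a bounded orbit in it. *)
Definition rect_re : Z := 125000000.
Definition rect_im : Z := 50000000.

Definition in_rect (d : disc) : bool :=
  let: (x, y, r) := d in (Z.abs x + r <=? rect_re) && (Z.abs y + r <=? rect_im).

(* The bounds only prune the search. *)
Definition promising (d : disc) : bool :=
  let: (x, y, r) := d in
  [&& Z.abs x <? 140000000, Z.abs y <? 100000000 & r <? 40000000].

(** The rectangle is tested only after a step, so the word found is nonempty; this turns
    [rect_check] into a recurrence. *)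
Fixpoint reaches (k : nat) (d : disc) : bool :=
  if k is S k' then
    let try c := let d' := step c d in
      if promising d' then if in_rect d' then true else reaches k' d'
      else false in
    if try 0 then true else if try 1 then true else try (-1)
  else false.

(** Tries the disc around the box with half-sides sx and sy, then bisects the longer side. Halves
    are rounded up so that they still cover the box, and the radius is checked afterwards. *)
Fixpoint box_reaches (k n : nat) (x y sx sy : Z) : bool :=
  let r := Z.sqrt (sx * sx + sy * sy) + 1 in
  if (if sx * sx + sy * sy <=? r * r then reaches k (x, y, r) else false)
  then true
  else if n is S n' then
    if sy <? sx then
      let t := (sx + 1) / 2 in
      if box_reaches k n' (x - t) y t sy then box_reaches k n' (x + t) y t sy
      else false
    else
      let t := (sy + 1) / 2 in
      if box_reaches k n' x (y - t) sx t then box_reaches k n' x (y + t) sx t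
      else false
  else false.

Fixpoint word_reaches (c : seq Z) (d : disc) : bool :=
  if c is a :: c' then [&& -1 <=? a, a <=? 1 & word_reaches c' (step a d)]
  else in_rect d.

Definition tip_prefix : seq Z := [:: -1; 1; 1; 1; -1; -1; -1].

(** For a = 1 or a = -1, the competing digits are exactly 0 and -a. *)
Fixpoint forced (k : nat) (c : seq Z) (d : disc) : bool :=
  if c is a :: c' then
    [&& (a == -1) || (a == 1), escapes k (step 0 d), escapes k (step (- a) d)
      & forced k c' (step a d)]
  else true.

Lemma rect_check :
  box_reaches 8 18 0 0 rect_re rect_im.
Proof. by vm_compute. Qed.

Lemma prefix_check : forced 20 tip_prefix (- inv_re, - inv_im, 300).
Proof. by vm_compute. Qed.

(** The radius is 0.1, the range of [tip_forced], plus the error 400 of the tip. *)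
Lemma tip_check : let d := (tip_re, tip_im, 10000400) in
  escapes 20 (step 0 d) && escapes 20 (step (-1) d).
Proof. by vm_compute. Qed.

(** The offset s = -0.112 - 0.08 i is [hole_pt]; the radius covers the error 4000 of the rescaling
    and the error 400 of the tip. *)
Lemma hole_check : escapes 25 (tip_re - 11200000, tip_im - 8000000, 50000).
Proof. by vm_compute. Qed.

(* Centers (relative to the tip) and radii of discs in units of 1/2000, each with
   a word of digits that carries the disc into the rectangle; the polygon through
   the centers is star-shaped about the tip. The discs were found by search. *)
Definition necklace : seq ((Z * Z * Z) * seq Z) := [::
  ((400, 90, 120), [:: 1; 1]);
  ((280, 160, 80), [:: 1; 1]);
  ((290, 310, 120), [:: 1; 1; 1]);
  ((170, 350, 120), [:: 1; 1; 1]);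
  ((40, 260, 80), [:: 1; 1; 1]);
  ((-50, 340, 120), [:: 1; 1; 1; 1]);
  ((-190, 420, 60), [:: 1; 1; 1; 1; 1; -1]);
  ((-240, 500, 40), [:: 1; 1; 1; 1; 1; -1; -1]);
  ((-310, 480, 40), [:: 1; 1; 1; 1; 1; -1; -1]);
  ((-370, 470, 28), [:: 1; 1; 1; 1; 1; -1; -1]);
  ((-400, 480, 10), [:: 1; 1; 1; 1; 1; -1; -1; -1; 0; 1]);
  ((-410, 490, 5), [:: 0; 1; 1; -1; -1; -1; 1; 1; 1; -1]);
  ((-420, 500, 10), [:: 0; 1; 1; -1; -1; -1; 1; 1; 1]);
  ((-430, 510, 10), [:: 0; 1; 1; -1; -1; -1; 1; 1; 1]);
  ((-450, 500, 20), [:: 0; 1; 1; -1; -1; -1; 1; 1]);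
  ((-490, 460, 40), [:: 0; 1; 1; -1; -1; -1; 1]);
  ((-560, 480, 40), [:: 0; 1; 1; -1; -1; -1]);
  ((-660, 420, 80), [:: 0; 1; 1; -1; -1]);
  ((-770, 260, 120), [:: 0; 1; 1; -1]);
  ((-890, 60, 120), [:: 0; 1; 1; -1]);
  ((-890, -110, 60), [:: 0; 1; 0; 0; -1; -1]);
  ((-860, -240, 80), [:: 0; 1; 0; 0; -1]);
  ((-820, -360, 60), [:: 0; 1; 0; 0; -1; 0]);
  ((-730, -510, 120), [:: 0; 1; 0]);
  ((-510, -590, 120), [:: 1; 0; 1]);
  ((-280, -630, 120), [:: 1; 0; 1]);
  ((-80, -670, 120), [:: 1; 0; 1]);
  ((30, -540, 60), [:: 1; 0; 1; 0]);
  ((200, -540, 120), [:: 1; 1; 0; 1]);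
  ((330, -430, 120), [:: 1]);
  ((480, -340, 120), [:: 1]);
  ((580, -190, 120), [:: 1]);
  ((600, -10, 120), [:: 1; 1])].

Definition bead_unit : Z := 50000.

(** The added 5000 covers the same two errors, 4000 and 400. *)
Definition bead_reaches (b : (Z * Z * Z) * seq Z) : bool :=
  let: ((x, y, r), c) := b in
  word_reaches c (tip_re + x * bead_unit, tip_im + y * bead_unit,
                  r * bead_unit + 5000).

Lemma necklace_check : all bead_reaches necklace.
Proof. by vm_compute. Qed.

(** The discs overlap, so they cover the segment between their centers. Positive dot and cross
    products say that, seen from 0, this segment turns left by less than a right angle. *)
Definition linked (b b' : (Z * Z * Z) * seq Z) : bool :=
  let: ((x, y, r), _) := b in let: ((x', y', r'), _) := b' in
  [&& (x' - x) * (x' - x) + (y' - y) * (y' - y) <? (r + r') * (r + r'),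
      0 <? x * x' + y * y' & 0 <? x * y' - y * x'].

Lemma necklace_linked : cycle linked necklace.
Proof. by vm_compute. Qed.

Definition bead_small (b : (Z * Z * Z) * seq Z) : bool :=
  let: ((x, y, r), _) := b in (0 <? r) && (x * x + y * y <? 1000 * 1000).

Lemma necklace_small : all bead_small necklace.
Proof. by vm_compute. Qed.

End DiscArithmetic.

Delimit Scope Z_scope with ZZ.

(** * Soundness of the disc computations near omega *)

Section Soundness.
Variable R : realType.
Local Notation C := (CC R).
Implicit Types (e z : C).

(* Locked, as the unfolding of a large value would be unary. *)
Definition zr : Z -> R := locked (fun a => (int_of_Z a)%:~R).

Lemma zrE a : zr a = (int_of_Z a)%:~R.
Proof. by rewrite /zr -lock. Qed.

Definition zc (x y : Z) : C := (zr x +i* zr y)%C.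

Lemma zrD a b : zr (Z.add a b) = zr a + zr b.
Proof. by rewrite !zrE -rmorphD /=; congr (_%:~R); lia. Qed.
Lemma zrN a : zr (Z.opp a) = - zr a.
Proof. by rewrite !zrE -rmorphN /=; congr (_%:~R); lia. Qed.
Lemma zrB a b : zr (Z.sub a b) = zr a - zr b.
Proof. by rewrite -Z.add_opp_r zrD zrN. Qed.
Lemma zrM a b : zr (Z.mul a b) = zr a * zr b.
Proof. by rewrite !zrE -rmorphM /=; congr (_%:~R); lia. Qed.
Lemma zr_le a b : (zr a <= zr b) = Z.leb a b.
Proof. by rewrite !zrE ler_int; lia. Qed.
Lemma zr_lt a b : (zr a < zr b) = Z.ltb a b.
Proof. by rewrite !zrE ltr_int; lia. Qed.
Lemma zr0 : zr Z0 = 0. Proof. by rewrite zrE. Qed.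
Lemma zr1 : zr (Zpos xH) = 1. Proof. by rewrite zrE. Qed.
Lemma zrN1 : zr (Zneg xH) = -1. Proof. by rewrite zrE. Qed.
Lemma zr_abs a : zr (Z.abs a) = `|zr a|.
Proof. by rewrite !zrE -intr_norm; congr (_%:~R); lia. Qed.
Lemma zr_ge0 a : Z.leb Z0 a -> 0 <= zr a. Proof. by rewrite -zr0 zr_le. Qed.
Lemma zr_gt0 a : Z.ltb Z0 a -> 0 < zr a. Proof. by rewrite -zr0 zr_lt. Qed.

Lemma zr_div a b : Z.ltb Z0 b ->
  zr a / zr b - 1 <= zr (Z.div a b) <= zr a / zr b.
Proof.
move=> b0; have b0' := zr_gt0 b0.
rewrite lerBlDr ler_pdivrMr // ler_pdivlMr // -zr1 -zrD -!zrM !zr_le.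
have bz : (0 < b)%ZZ by apply/Z.ltb_lt.
have := Z.mul_div_le a b bz; have := Z.mul_succ_div_gt a b bz.
by move=> h1 h2; apply/andP; split; apply/Z.leb_le; lia.
Qed.

Lemma zcM a b c d :
  zc a b * zc c d = zc (Z.sub (Z.mul a c) (Z.mul b d)) (Z.add (Z.mul a d) (Z.mul b c)).
Proof. by rewrite /zc zrB zrD !zrM. Qed.
Lemma zcD a b c d : zc a b + zc c d = zc (Z.add a c) (Z.add b d).
Proof. by rewrite /zc !zrD. Qed.
Lemma zcB a b c d : zc a b - zc c d = zc (Z.sub a c) (Z.sub b d).
Proof. by rewrite /zc !zrB. Qed.
Lemma zc_real a : (zr a)%:C = zc a Z0. Proof. by rewrite /zc zr0. Qed.

Lemma nm_zc_sqr x y : nm (zc x y) ^+ 2 = zr (Z.add (Z.mul x x) (Z.mul y y)).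
Proof. by rewrite nm_sqr /= zrD !zrM !expr2. Qed.

Definition sq x y := Z.add (Z.mul x x) (Z.mul y y).

Lemma nm_zc_le x y m : Z.leb Z0 m -> Z.leb (sq x y) (Z.mul m m) -> nm (zc x y) <= zr m.
Proof.
move=> m0 h; rewrite -(ler_pXn2r (n := 2)) ?nnegrE ?nm_ge0 ?zr_ge0 //.
by rewrite nm_zc_sqr expr2 -zrM zr_le.
Qed.

Lemma nm_zc_lt x y m : Z.leb Z0 m -> Z.ltb (sq x y) (Z.mul m m) -> nm (zc x y) < zr m.
Proof.
move=> m0 h; rewrite -(ltr_pXn2r (n := 2)) ?nnegrE ?nm_ge0 ?zr_ge0 //.
by rewrite nm_zc_sqr expr2 -zrM zr_lt.
Qed.

Lemma nm_zc_gt x y m : Z.leb Z0 m -> Z.ltb (Z.mul m m) (sq x y) -> zr m < nm (zc x y).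
Proof.
move=> m0 h; rewrite -(ltr_pXn2r (n := 2)) ?nnegrE ?nm_ge0 ?zr_ge0 //.
by rewrite nm_zc_sqr expr2 -zrM zr_lt.
Qed.

Lemma nm_zc_l1 x y : nm (zc x y) <= zr (Z.add (Z.abs x) (Z.abs y)).
Proof. by apply: le_trans (nm_le_ReIm _) _; rewrite zrD !zr_abs. Qed.

Lemma zc_neq0 a : Z.ltb Z0 a -> zc a Z0 != 0.
Proof. by move=> /zr_gt0 a0; rewrite -zc_real -nm_gt0 nmR normr_gt0 gt_eqF. Qed.

Lemma nm_zc_pos a : Z.ltb Z0 a -> nm (zc a Z0) = zr a.
Proof. by move=> /zr_gt0 a0; rewrite -zc_real nmR gtr0_norm. Qed.

Definition scale7 : Z := 10000000%ZZ.
Definition omega7_re : Z := 3718590%ZZ.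
Definition omega7_im : Z := 5194110%ZZ.
Let omega7 : C := zc omega7_re omega7_im.
Let S7 : C := zc scale7 Z0.
Let S8 : C := zc scale Z0.
Let invC : C := zc inv_re inv_im.
Let tipC : C := zc tip_re tip_im.
Let S7n : nm S7 = zr scale7. Proof. exact: nm_zc_pos. Qed.
Let S8n : nm S8 = zr scale. Proof. exact: nm_zc_pos. Qed.
Let S7n0 : S7 != 0. Proof. exact: zc_neq0. Qed.
Let S8n0 : S8 != 0. Proof. exact: zc_neq0. Qed.
Let S7p : 0 < zr scale7. Proof. exact: zr_gt0. Qed.
Let S8p : 0 < zr scale. Proof. exact: zr_gt0. Qed.
(** In units of 10^-7: 10 for the distance from omega to its decimal approximation and 1 for the
    distance from z to omega. *)
Definition near_omega z : Prop :=
  nm (zc scale7 Z0 * z - zc omega7_re omega7_im) <= zr 11%ZZ.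

Definition in_disc e (d : disc) : Prop :=
  let: (x, y, r) := d in nm (zc scale Z0 * e - zc x y) <= zr r.

Section Near.
Variable z : C.
Hypothesis nz : near_omega z.

Lemma near_nm : zr 6388000%ZZ <= zr scale7 * nm z <= zr 6388023%ZZ.
Proof.
have -> : zr scale7 * nm z = nm (S7 * z) by rewrite nmM S7n.
have h1 : nm omega7 <= zr 6388012%ZZ by exact: nm_zc_le.
have h2 : zr 6388011%ZZ < nm omega7 by exact: nm_zc_gt.
have h3 := nm_tri omega7 (S7 * z) 0; have h4 := nm_tri (S7 * z) omega7 0.
move: h3 h4; rewrite !subr0 (nmB omega7) => h3 h4.
have h5 : nm (S7 * z - omega7) <= zr 11%ZZ := nz.
rewrite (_ : zr 6388000%ZZ = zr 6388011%ZZ - zr 11%ZZ); last by rewrite -zrB.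
rewrite (_ : zr 6388023%ZZ = zr 6388012%ZZ + zr 11%ZZ); last by rewrite -zrD.
by apply/andP; split; lra.
Qed.

Lemma near_Dstar : Dstar z.
Proof.
apply/Dstar_nm; have /andP[h1 h2] := near_nm; apply/andP; split.
  by rewrite -(pmulr_rgt0 _ S7p); apply: lt_le_trans h1; exact: zr_gt0.
by rewrite -(ltr_pM2l S7p) mulr1; apply: le_lt_trans h2 _; rewrite zr_lt.
Qed.

Lemma near_neq0 : z != 0.
Proof. by have /Dstar_nm/andP[z0 _] := near_Dstar; rewrite -nm_gt0. Qed.

Lemma near_one_sub : 1 - z != 0.
Proof.
rewrite subr_eq0; apply/eqP => z1; have /Dstar_nm/andP[_] := near_Dstar.
by rewrite -z1 nm1 ltxx.
Qed.

Lemma near_inv : nm (S8 / z - invC) <= zr inv_err.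
Proof.
have z0 := near_neq0.
have -> : S8 / z - invC = (S7 * S8 - invC * (S7 * z)) / (S7 * z).
  by field; rewrite z0 S7n0.
rewrite nmf [nm (S7 * z)]nmM S7n; have /andP[h1 _] := near_nm.
have p0 : 0 < zr scale7 * nm z by apply: lt_le_trans h1; exact: zr_gt0.
rewrite ler_pdivrMr //.
apply: (@le_trans _ _ (zr inv_err * zr 6388000%ZZ)); last first.
  by rewrite ler_wpM2l // zr_ge0.
(* The first term is a fixed integer point, bounded by computation; the second carries the
   uncertainty about z. *)
have -> : S7 * S8 - invC * (S7 * z) =
    (S7 * S8 - invC * omega7) - invC * (S7 * z - omega7) by ring.
apply: le_trans (nmD _ _) _; rewrite nmN nmM /S7 /S8 /invC /omega7 !zcM zcB.
have h2 : nm (zc inv_re inv_im) <= zr 156543240%ZZ by exact: nm_zc_le.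
have h3 : nm (zc inv_re inv_im) * nm (S7 * z - omega7) <=
    zr 156543240%ZZ * zr 11%ZZ by apply: ler_pM; rewrite ?nm_ge0.
apply: (@le_trans _ _ (zr 2208367%ZZ + zr 156543240%ZZ * zr 11%ZZ)).
  by apply: lerD => //; exact: nm_zc_le.
by rewrite -!zrM -zrD zr_le.
Qed.

Lemma near_inv_nm : zr scale / nm z <= zr inv_nm.
Proof.
rewrite -S8n -nmf; have h2 : nm invC <= zr 156543240%ZZ by exact: nm_zc_le.
have := nm_tri invC (S8 / z) 0; rewrite !subr0 => h3.
apply: le_trans h3 (le_trans (lerD near_inv h2) _).
by rewrite -zrD zr_le.
Qed.

Lemma near_bound : zr scale / (1 - nm z) <= zr max_nm.
Proof.
have /Dstar_nm/andP[_ z1] := near_Dstar.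
rewrite ler_pdivrMr ?subr_gt0 // -(ler_pM2l S7p).
have /andP[_ h2] := near_nm.
apply: (@le_trans _ _ (zr max_nm * (zr scale7 - zr 6388023%ZZ))).
  by rewrite -zrB -!zrM zr_le.
have -> : zr scale7 * (zr max_nm * (1 - nm z)) =
    zr max_nm * (zr scale7 - zr scale7 * nm z) by ring.
by rewrite ler_wpM2l ?lerB // zr_ge0.
Qed.

Lemma near_tip : in_disc ((1 - z)^-1) (tip_re, tip_im, 400%ZZ).
Proof.
rewrite /in_disc -/S8 -/tipC; have z1 := near_one_sub.
set u := S7 * (1 - z); pose v := S7 - omega7.
have -> : S8 * (1 - z)^-1 - tipC = (S7 * S8 - tipC * u) / u.
  by rewrite /u; field; rewrite z1 S7n0.
have uv : nm (u - v) <= zr 11%ZZ.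
  have -> : u - v = - (S7 * z - omega7) by rewrite /u /v; ring.
  by rewrite nmN.
have u0 : zr 8150000%ZZ <= nm u.
  have h1 : zr 8150700%ZZ < nm v by rewrite /v /S7 /omega7 zcB; exact: nm_zc_gt.
  have := nm_tri u v 0; rewrite !subr0 nmB => h3.
  apply: (@le_trans _ _ (zr 8150700%ZZ - zr 11%ZZ)); first by rewrite -zrB zr_le.
  by lra.
have p0 : 0 < nm u by apply: lt_le_trans u0; exact: zr_gt0.
rewrite nmf ler_pdivrMr //.
apply: (@le_trans _ _ (zr 400%ZZ * zr 8150000%ZZ)); last first.
  by rewrite ler_wpM2l // zr_ge0.
have -> : S7 * S8 - tipC * u = (S7 * S8 - tipC * v) - tipC * (u - v) by ring.
have h2 : nm tipC <= zr 122687944%ZZ by exact: nm_zc_le.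
have h3 : nm tipC * nm (u - v) <= zr 122687944%ZZ * zr 11%ZZ.
  by apply: ler_pM; rewrite ?nm_ge0.
apply: le_trans (nmD _ _) _; rewrite nmN nmM.
apply: (@le_trans _ _ (zr 3686526%ZZ + zr 122687944%ZZ * zr 11%ZZ)).
  apply: lerD => //; rewrite /v /S7 /S8 /tipC /omega7 zcB !zcM zcB.
  exact: nm_zc_le.
by rewrite -!zrM -zrD zr_le.
Qed.

(** The three errors are the expanded old radius, the error of 1/z and the rounding of the center.
    The 4 in [step] is one unit for each of the two floors in the radius and two for the
    coordinates. *)
Lemma step_sound (c : Z) e d : in_disc e d ->
  in_disc ((e - (zr c)%:C) / z) (step c d).
Proof.
case: d => [[x y] r] ed.
pose u := Z.sub x (Z.mul c scale).
pose a := Z.sub (Z.mul u inv_re) (Z.mul y inv_im).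
pose b := Z.add (Z.mul u inv_im) (Z.mul y inv_re).
pose m := Z.add (Z.abs u) (Z.abs y).
rewrite /step /in_disc -/u -/a -/b -/m -/S8.
have z0 := near_neq0.
have xE : zc x y = zc u y + (zr c)%:C * S8.
  by rewrite zc_real /S8 zcM zcD; congr (_ +i* _)%C; congr zr; rewrite /u; lia.
have -> : S8 * ((e - (zr c)%:C) / z) - zc (Z.div a scale) (Z.div b scale) =
  (S8 * e - zc x y) / z + (zc u y * (S8 / z - invC) / S8 +
   (zc u y * invC / S8 - zc (Z.div a scale) (Z.div b scale))).
  by rewrite xE; field; rewrite z0 S8n0.
apply: le_trans (nmD _ _) _.
have t1 : nm ((S8 * e - zc x y) / z) <= zr (Z.div (Z.mul r inv_nm) scale) + 1.
  have /andP[+ _] := @zr_div (Z.mul r inv_nm) scale isT; rewrite lerBlDr.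
  apply: le_trans; rewrite zrM nmf.
  have h : (nm z)^-1 <= zr inv_nm / zr scale.
    by rewrite ler_pdivlMr // mulrC; exact: near_inv_nm.
  by rewrite -mulrA; apply: ler_pM; rewrite ?nm_ge0 ?invr_ge0 ?nm_ge0.
have t2 : nm (zc u y * (S8 / z - invC) / S8) <=
    zr (Z.div (Z.mul m inv_err) scale) + 1.
  have /andP[+ _] := @zr_div (Z.mul m inv_err) scale isT.
  rewrite lerBlDr; apply: le_trans; rewrite zrM nmf S8n.
  rewrite ler_pM2r ?invr_gt0 // nmM; apply: ler_pM; rewrite ?nm_ge0 ?nm_zc_l1 //.
  exact: near_inv.
have t3 : nm (zc u y * invC / S8 - zc (Z.div a scale) (Z.div b scale)) <= 2.
  have -> : zc u y * invC / S8 = (zr a / zr scale +i* (zr b / zr scale))%C.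
    apply: (mulIf S8n0); rewrite divfK // /invC zcM -/a -/b /S8 /zc zr0.
    apply/eqP; rewrite eq_complex /= !mulr0 subr0 add0r.
    have sn : zr scale != 0 by rewrite gt_eqF.
    by rewrite !(divfK sn) !eqxx.
  apply: le_trans (nm_le_ReIm _) _ => /=.
  have /andP[a1 a2] := @zr_div a scale isT.
  have /andP[b1 b2] := @zr_div b scale isT.
  by rewrite !ger0_norm ?subr_ge0 //; lra.
apply: le_trans (lerD t1 (le_trans (nmD _ _) (lerD t2 t3))) _.
rewrite !zrD (_ : zr 4%ZZ = 4); last by rewrite zrE.
by lra.
Qed.

Lemma escaped_sound e d : escaped d -> in_disc e d -> ~ viable z e.
Proof.
case: d => [[x y] r] /andP[r0 h] ed /viable_bound ve.
have /Dstar_nm/andP[_ z1] := near_Dstar.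
have {}ve := ve z1 near_neq0.
have m0 : Z.leb Z0 (Z.add max_nm r) by move: r0; rewrite /max_nm; lia.
have := nm_zc_gt m0 h; apply/negP; rewrite -leNgt.
have := nm_tri (S8 * e) (zc x y) 0; rewrite !subr0 nmB => t.
apply: le_trans t _; rewrite zrD addrC; apply: lerD => //.
by apply: le_trans near_bound; rewrite nmM S8n ler_pM2l.
Qed.

Lemma escapes_sound k e d : escapes k d -> in_disc e d -> ~ viable z e.
Proof.
elim: k e d => [|k IHk] e d /=.
  by case: ifP => // esc _; exact: escaped_sound.
case: ifP => [esc _|_]; first exact: escaped_sound.
case: ifP => // e1; case: ifP => // e2 e3 ed /viable_step[c dc vc].
case: dc vc => ->.
- by have := IHk _ _ e1 (@step_sound (-1)%ZZ _ _ ed); rewrite zrN1 rmorphN rmorph1.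
- by have := IHk _ _ e2 (@step_sound 0%ZZ _ _ ed); rewrite zr0 rmorph0.
- by have := IHk _ _ e3 (@step_sound 1%ZZ _ _ ed); rewrite zr1 rmorph1.
Qed.

Definition rect e : Prop := let E := S8 * e in
  `|complex.Re E| <= zr rect_re /\ `|complex.Im E| <= zr rect_im.

Lemma disc_Re e x y r : in_disc e (x, y, r) ->
  `|complex.Re (S8 * e) - zr x| <= zr r.
Proof.
by move=> ed; apply: le_trans ed; have := nm_Re (S8 * e - zc x y); rewrite raddfB.
Qed.

Lemma disc_Im e x y r : in_disc e (x, y, r) ->
  `|complex.Im (S8 * e) - zr y| <= zr r.
Proof.
by move=> ed; apply: le_trans ed; have := nm_Im (S8 * e - zc x y); rewrite raddfB.
Qed.

Lemma abs_shift (t : R) (x r m : Z) : `|t - zr x| <= zr r ->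
  Z.leb (Z.add (Z.abs x) r) m -> `|t| <= zr m.
Proof.
rewrite -zr_le zrD zr_abs => h; apply: le_trans.
rewrite addrC -lerBlDr; apply: le_trans h.
by have := lerB_dist t (zr x).
Qed.

Lemma in_rect_sound e d : in_rect d -> in_disc e d -> rect e.
Proof.
case: d => [[x y] r] /andP[hx hy] ed; split.
  exact: abs_shift (disc_Re ed) hx.
exact: abs_shift (disc_Im ed) hy.
Qed.

Let near e : Prop := nm (S8 * e) <= zr 320000000%ZZ.

(** Intermediate points are required to stay near 0 because [viable] needs bounded tails. *)
Fixpoint hits (n : nat) e : Prop :=
  if n is m.+1 then exists2 c, digit c & near ((e - c) / z) /\ hits m ((e - c) / z)
  else rect e.

Lemma promising_near e d : promising d -> in_disc e d -> near e.
Proof.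
case: d => [[x y] r] /and3P[hx hy hr] ed; apply: le_trans (nm_le_ReIm _) _.
(* In each coordinate, the bounds of [promising] on center and radius: 1.4 + 0.4 and 1 + 0.4. *)
apply: (@le_trans _ _ (zr 180000000%ZZ + zr 140000000%ZZ)); last by rewrite -zrD zr_le.
apply: lerD.
  by apply: abs_shift (disc_Re ed) _; lia.
by apply: abs_shift (disc_Im ed) _; lia.
Qed.

Lemma rect_near e : rect e -> near e.
Proof.
move=> [h1 h2]; apply: le_trans (nm_le_ReIm _) _; apply: le_trans (lerD h1 h2) _.
by rewrite -zrD zr_le.
Qed.

Lemma digitZ (a : Z) : Z.leb (Zneg xH) a -> Z.leb a (Zpos xH) -> digit ((zr a)%:C : C).
Proof.
move=> a1 a2; have : [\/ a = Zneg xH, a = Z0 | a = Zpos xH].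
  by case: a a1 a2 => [|p|p] a1 a2; [apply: Or32|apply: Or33|apply: Or31]; lia.
case=> ->; rewrite ?zr0 ?zr1 ?zrN1.
- by apply: Or31; rewrite rmorphN rmorph1.
- exact: Or32.
- exact: Or33.
Qed.

Lemma reaches_sound k e d : reaches k d -> in_disc e d -> exists n, hits n.+1 e.
Proof.
elim: k e d => [//|k IHk] e d /=.
have try_sound c : Z.leb (Zneg xH) c -> Z.leb c (Zpos xH) ->
    (if promising (step c d) then
       if in_rect (step c d) then true else reaches k (step c d)
     else false) -> in_disc e d -> exists n, hits n.+1 e.
  move=> c1 c2; case: ifP => // pr H ed; have ed' := step_sound c ed.
  have nd := promising_near pr ed'; have dc := digitZ c1 c2.
  move: H; case: ifP => [ir _|_ /IHk/(_ ed')[n hn]].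
    by exists 0%N, (zr c)%:C => //; split => //; exact: in_rect_sound ir ed'.
  by exists n.+1, (zr c)%:C.
case: ifP => [h0 _|_]; first exact: (try_sound Z0).
case: ifP => [h1 _|_]; first exact: (try_sound (Zpos xH)).
exact: (try_sound (Zneg xH)).
Qed.

Lemma half_up (a : Z) : let t := Z.div (Z.add a 1%ZZ) 2%ZZ in Z.leb a (Z.add t t).
Proof.
apply/Z.leb_le; have := Z.div_mod (Z.add a 1%ZZ) 2%ZZ.
have := Z.mod_pos_bound (Z.add a 1%ZZ) 2%ZZ.
by lia.
Qed.

Lemma box_reaches_sound k n x y sx sy e : box_reaches k n x y sx sy ->
  `|complex.Re (S8 * e) - zr x| <= zr sx ->
  `|complex.Im (S8 * e) - zr y| <= zr sy -> exists n, hits n.+1 e.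
Proof.
elim: n x y sx sy => [|n IHn] x y sx sy; rewrite /= -/(sq sx sy);
  set r := Z.add (Z.sqrt _) _.
all: have disc_case : Z.leb (sq sx sy) (Z.mul r r) -> reaches k (x, y, r) ->
      `|complex.Re (S8 * e) - zr x| <= zr sx ->
      `|complex.Im (S8 * e) - zr y| <= zr sy -> exists n, hits n.+1 e.
1,3: move=> hr rc h1 h2; apply: (reaches_sound rc);
  have r0 : 0 <= zr r by
    [apply: zr_ge0; have := Z.sqrt_nonneg (sq sx sy); rewrite /r; lia];
  rewrite /in_disc -/S8 -(ler_pXn2r (n := 2)) ?nnegrE ?nm_ge0 // nm_sqr !raddfB /=;
  rewrite -[X in X + _]real_normK ?num_real // -[X in _ + X]real_normK ?num_real //;
  apply: (@le_trans _ _ (zr sx ^+ 2 + zr sy ^+ 2));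
  [by apply: lerD; rewrite lerXn2r ?nnegrE //; apply: le_trans (normr_ge0 _) _; eassumption
  |by rewrite !expr2 -!zrM -zrD zr_le].
  by case: ifP => //; case: ifP => // hr rc _; exact: disc_case.
case: ifP.
  by move=> + _; case: ifP => // hr rc; exact: disc_case.
move=> _; case: ifP => _; set t := Z.div _ _.
  have t2 : zr sx <= zr t + zr t by rewrite -zrD zr_le; exact: half_up.
  case: ifP => // h1 h2; rewrite ler_norml => /andP[a1 a2] b.
  have [le|lt] := leP (complex.Re (S8 * e)) (zr x).
    by apply: (IHn _ _ _ _ h1) => //; rewrite zrB ler_norml; apply/andP; split; lra.
  by apply: (IHn _ _ _ _ h2) => //; rewrite zrD ler_norml; apply/andP; split; lra.
have t2 : zr sy <= zr t + zr t by rewrite -zrD zr_le; exact: half_up.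
case: ifP => // h1 h2 b; rewrite ler_norml => /andP[a1 a2].
have [le|lt] := leP (complex.Im (S8 * e)) (zr y).
  by apply: (IHn _ _ _ _ h1) => //; rewrite zrB ler_norml; apply/andP; split; lra.
by apply: (IHn _ _ _ _ h2) => //; rewrite zrD ler_norml; apply/andP; split; lra.
Qed.

(** The tails are the points on their way back to the rectangle; each time one arrives, [rect_check]
    supplies a new nonempty word. *)
Lemma rect_viable e : rect e -> viable z e.
Proof.
move=> re; exists [set x | near x /\ exists n, hits n x]; split.
- by split; [exact: rect_near|exists 0%N].
- exists (zr 320000000%ZZ / zr scale) => x [nx _].
  by rewrite ler_pdivlMr // mulrC -S8n -nmM.
- move=> x [_ [n hn]].
  have [m [c dc [nc hc]]] : exists m, hits m.+1 x.
    case: n hn => [[h1 h2]|n hn]; last by exists n.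
    by apply: (box_reaches_sound rect_check); rewrite zr0 subr0.
  by exists c => //; split => //; exists m.
Qed.

Lemma word_reaches_sound c e d : word_reaches c d -> in_disc e d -> viable z e.
Proof.
elim: c e d => [|a c IHc] e d /=.
  by move=> ir ed; apply: rect_viable; exact: in_rect_sound ir ed.
move=> /and3P[a1 a2 /IHc wc] ed.
exact: viable_pred (digitZ a1 a2) (wc _ (step_sound a ed)).
Qed.

(** * The orbit of -1/z near omega *)

Definition orbit (c : seq Z) e : C := foldl (fun e a => (e - (zr a)%:C) / z) e c.

Lemma bitN1 (a : Z) : (a == Zneg xH) || (a == Zpos xH) ->
  (zr a)%:C = -1 :> C \/ (zr a)%:C = 1 :> C.
Proof.
case/orP => /eqP ->; rewrite ?zr1 ?zrN1; [left|by right].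
by rewrite rmorphN rmorph1.
Qed.

Lemma forced_digit k a e d : (a == Zneg xH) || (a == Zpos xH) ->
  escapes k (step Z0 d) -> escapes k (step (Z.opp a) d) -> in_disc e d ->
  forall c, digit c -> viable z ((e - c) / z) -> c = (zr a)%:C.
Proof.
move=> a1 e0 e1 ed c dc vc.
have n0 : c != 0.
  apply/eqP => c0; apply: (escapes_sound e0 (step_sound Z0 ed)).
  by rewrite zr0 rmorph0 -c0.
have n1 : c != - (zr a)%:C.
  apply/eqP => c0; apply: (escapes_sound e1 (step_sound _ ed)).
  by rewrite zrN rmorphN -c0.
by have [b1|b1] := bitN1 a1; rewrite b1 in n1 *; case: dc n0 n1 => ->;
  rewrite ?opprK ?eqxx.
Qed.

Lemma forced_viable k c e d : forced k c d -> in_disc e d ->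
  viable z e -> viable z (orbit c e).
Proof.
elim: c e d => [|a c IHc] e d //= /and4P[a1 e0 e1 /IHc fc] ed ve.
apply: fc (step_sound a ed) _; have [b db vb] := viable_step ve.
by rewrite -(forced_digit a1 e0 e1 ed db vb).
Qed.

Lemma forced_rigid k c e d : forced k c d -> in_disc e d ->
  rigid z (orbit c e) -> rigid z e.
Proof.
elim: c e d => [|a c IHc] e d //= /and4P[a1 e0 e1 /IHc fc] ed ro.
have [S Se Srig] := fc _ (step_sound a ed) ro.
exists (e |` S); first by left.
move=> u [->|Su].
  exists (zr a)%:C; split; [exact: bitN1|by right|].
  exact: (forced_digit a1 e0 e1 ed).
by have [b [b1 Sb ub]] := Srig u Su; exists b; split => //; right.
Qed.

Lemma orbit_viable c e : all (fun a => Z.leb (Zneg xH) a && Z.leb a (Zpos xH)) c ->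
  viable z (orbit c e) -> viable z e.
Proof.
elim: c e => [|a c IHc] e //= /andP[/andP[a1 a2] /IHc h] /h.
exact: viable_pred (digitZ a1 a2).
Qed.

(* The orbit point of -1/z after the digits [tip_prefix] and [n] digits 1. *)
Definition tail (n : nat) : C := (1 - omega_poly z / z ^+ (8 + n)) / (1 - z).

Lemma orbit_prefix : orbit tip_prefix (- z^-1) = tail 0.
Proof.
rewrite /orbit /tip_prefix /= zr1 zrN1 rmorphN rmorph1 /tail /omega_poly addn0.
by field; rewrite near_one_sub near_neq0.
Qed.

(** As 1 / (1 - z) is fixed by e -> (e - 1) / z, each digit 1 divides the offset from it by z. *)
Lemma tailS n : (tail n - 1) / z = tail n.+1.
Proof.
rewrite /tail addnS exprS.
have zn : z ^+ (8 + n) != 0 by rewrite expf_neq0 // near_neq0.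
by field; rewrite near_one_sub near_neq0 zn.
Qed.

Lemma in_disc_start : in_disc (- z^-1) (Z.opp inv_re, Z.opp inv_im, 300%ZZ).
Proof.
rewrite /in_disc -/S8.
have -> : zc (Z.opp inv_re) (Z.opp inv_im) = - invC by rewrite /invC /zc !zrN.
have -> : S8 * (- z^-1) - - invC = - (S8 / z - invC) by ring.
by rewrite nmN; exact: near_inv.
Qed.

Lemma in_disc_tip (e s : C) x y (r t : Z) :
  nm (S8 * s - zc x y) <= 0 -> nm (S8 * (e - (1 - z)^-1 - s)) <= zr t ->
  Z.leb (Z.add t 400%ZZ) r ->
  in_disc e (Z.add tip_re x, Z.add tip_im y, r).
Proof.
move=> sx es tr; rewrite /in_disc -/S8 -zcD -/tipC.
have -> : S8 * e - (tipC + zc x y) = S8 * (e - (1 - z)^-1 - s) +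
   ((S8 * (1 - z)^-1 - tipC) + (S8 * s - zc x y)) by ring.
apply: le_trans (nmD _ _) _; apply: (@le_trans _ _ (zr t + (zr 400%ZZ + 0))).
  apply: lerD => //; apply: le_trans (nmD _ _) _; apply: lerD => //.
  exact: near_tip.
by rewrite addr0 -zrD zr_le.
Qed.

Lemma tip_forced e : nm (S8 * (e - (1 - z)^-1)) <= zr 10000000%ZZ ->
  forall c, digit c -> viable z ((e - c) / z) -> c = 1.
Proof.
move=> h; have ed : in_disc e (tip_re, tip_im, 10000400%ZZ).
  have := @in_disc_tip e 0 Z0 Z0 10000400%ZZ 10000000%ZZ; rewrite !Z.add_0_r.
  by apply; rewrite ?subr0 // mulr0 /zc zr0 subr0 nm0.
have /andP[e0 e1] := tip_check.
have := @forced_digit 20 (Zpos xH) e _ isT e0 e1 ed.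
by rewrite zr1 rmorph1.
Qed.

Lemma tail_viable_Mset n : viable z (tail n) -> Mset z.
Proof.
move=> vn; apply/(Mset_viable near_Dstar).
apply: (@orbit_viable tip_prefix) => //; rewrite orbit_prefix.
elim: n vn => // n IHn; rewrite -tailS => /viable_pred v; apply: IHn.
by apply: v; exact: Or33.
Qed.

(** The converse of [tail_viable_Mset] needs the digits to be forced: the first seven are by
    [prefix_check], the following digits 1 as long as the orbit is within 0.1 of the tip. *)
Lemma Mset_tail_viable n : Mset z ->
  (forall k, (k < n)%N -> nm (S8 * (tail k - (1 - z)^-1)) <= zr 10000000%ZZ) ->
  viable z (tail n).
Proof.
move=> /(Mset_viable near_Dstar) v; elim: n => [|n IHn] h.
  by rewrite -orbit_prefix; exact: (forced_viable prefix_check in_disc_start).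
have vn : viable z (tail n) by apply: IHn => k kn; exact/h/ltnW.
have [c dc vc] := viable_step vn.
by rewrite -tailS -(tip_forced (h n (ltnSn n)) dc vc).
Qed.

Lemma rigid_root : omega_poly z = 0 -> rigid z (- z^-1) /\ viable z (- z^-1).
Proof.
move=> z_root; have tE n : tail n = (1 - z)^-1.
  by rewrite /tail z_root mul0r subr0 div1r.
have tS : ((1 - z)^-1 - 1) / z = (1 - z)^-1 by rewrite -{1}(tE 0%N) tailS tE.
split.
  apply: (forced_rigid prefix_check in_disc_start); rewrite orbit_prefix tE.
  exists [set (1 - z)^-1] => // u ->; exists 1; split; [by right|exact: tS|].
  by apply: tip_forced; rewrite subrr mulr0 nm0 zr_ge0.
apply: (@orbit_viable tip_prefix) => //; rewrite orbit_prefix tE.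
exists [set (1 - z)^-1]; split => //; first by exists (nm (1 - z)^-1) => _ ->.
by move=> _ ->; exists 1 => //; exact: Or33.
Qed.

Definition bead_disc (b : (Z * Z * Z) * seq Z) (s : C) : Prop :=
  let: ((x, y, r), _) := b in
  nm (S8 * s - zc (Z.mul x bead_unit) (Z.mul y bead_unit)) < zr (Z.mul r bead_unit).

Lemma bead_viable n b s : b \in necklace -> bead_disc b s ->
  nm (S8 * (tail n - (1 - z)^-1 - s)) <= zr 4000%ZZ -> viable z (tail n).
Proof.
move: b => [[[x y] r] c] bN bs tn.
have wc := allP necklace_check _ bN; rewrite /bead_reaches in wc.
apply: (word_reaches_sound wc); rewrite /in_disc -/S8 -zcD -/tipC.
set q := zc (Z.mul x bead_unit) (Z.mul y bead_unit).
have -> : S8 * tail n - (tipC + q) = S8 * (tail n - (1 - z)^-1 - s) +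
   ((S8 * (1 - z)^-1 - tipC) + (S8 * s - q)) by ring.
apply: le_trans (nmD _ _) _.
apply: (@le_trans _ _ (zr 4000%ZZ + (zr 400%ZZ + zr (Z.mul r bead_unit)))).
  apply: lerD => //; apply: le_trans (nmD _ _) _; apply: lerD; first exact: near_tip.
  exact: ltW.
by rewrite -!zrD zr_le; lia.
Qed.

Definition hole_pt : C := zc (-11200000)%ZZ (-8000000)%ZZ / S8.

Lemma hole_not_viable n :
  nm (S8 * (tail n - (1 - z)^-1 - hole_pt)) <= zr 4000%ZZ -> ~ viable z (tail n).
Proof.
move=> tn; apply: (escapes_sound hole_check).
have := @in_disc_tip (tail n) hole_pt (-11200000)%ZZ (-8000000)%ZZ 50000%ZZ 4000%ZZ.
rewrite -!Z.add_opp_r; apply => //.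
by rewrite /hole_pt mulrC divfK // subrr nm0.
Qed.

End Near.
End Soundness.

(** * Rescaling at omega *)

Section Asymptotics.
Variable R : realType.
Local Notation C := (CC R).
Implicit Types (z s : C).

Lemma pow_near1 (y : C) (N : nat) : N%:R * nm y <= 1 / 2 ->
  nm ((1 + y) ^+ N - 1) <= 2 * N%:R * nm y.
Proof.
elim: N => [|N IHN] h; first by rewrite expr0 subrr nm0 mulr0 mul0r.
have y0 := nm_ge0 y; have N0 : 0 <= N%:R :> R by [].
have h' : N%:R * nm y <= 1 / 2 by move: h; rewrite -natr1; nra.
have {}IHN := IHN h'.
have -> : (1 + y) ^+ N.+1 - 1 = ((1 + y) ^+ N - 1) + y * (((1 + y) ^+ N - 1) + 1).
  by rewrite exprS; ring.
apply: le_trans (nmD _ _) _; rewrite nmM.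
have := nmD ((1 + y) ^+ N - 1) 1; rewrite nm1 => h2.
by move: h; rewrite -natr1; nra.
Qed.

Lemma Re_affine (a b c : Z) (v : C) :
  complex.Re (zc R a Z0 * v - zc R b c) = zr R a * complex.Re v - zr R b.
Proof. by case: v => p q; rewrite /zc /= zr0 mul0r subr0. Qed.

Lemma Im_affine (a b c : Z) (v : C) :
  complex.Im (zc R a Z0 * v - zc R b c) = zr R a * complex.Im v - zr R c.
Proof. by case: v => p q; rewrite /zc /= zr0 mul0r addr0. Qed.

(** The bound 16/25 for |omega| is the square of 4/5: one factor keeps n (4/5)^n below 5, the other
    tends to 0. *)
Lemma nexp_small (e : R) : 0 < e -> exists n0 : nat, forall n, (n0 <= n)%N ->
  n%:R * (16 / 25) ^+ n < e.
Proof.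
move=> e0; pose p : R := 4 / 5.
have p0 : 0 <= p by rewrite /p; lra.
have p1 : p <= 1 by rewrite /p; lra.
have np n : n%:R * p ^+ n <= 5 * (1 - p ^+ n).
  elim: n => [|n IHn]; first by rewrite expr0 mul0r subrr mulr0.
  have : 0 <= p ^+ n <= 1 by rewrite exprn_ge0 // exprn_ile1.
  move: IHn; rewrite exprS -natr1 /p; set u := (4 / 5) ^+ n.
  by move=> h /andP[u0 u1]; lra.
have [n0 n0e] := expr_small p0 (ltac:(rewrite /p; lra) : p < 1) (ltac:(lra) : 0 <= (5 : R)) e0.
exists n0 => n n0n.
have pn : 0 <= p ^+ n by rewrite exprn_ge0.
have -> : (16 / 25 : R) = p * p by rewrite /p; field.
rewrite exprMn mulrA; apply: le_lt_trans n0e.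
apply: (@le_trans _ _ (5 * p ^+ n)).
  by rewrite ler_wpM2r //; have := np n; lra.
by rewrite mulrC ler_wpM2r // ler_wiXn2l.
Qed.

Variable w : C.
Hypothesis w_root : omega_poly w = 0.
Hypothesis w_approx : nm (zc R scale7 Z0 * w - zc R omega7_re omega7_im) <= zr R 10%ZZ.

Let S70 : 0 < zr R scale7. Proof. exact: zr_gt0. Qed.
Let S7n : nm (zc R scale7 Z0) = zr R scale7. Proof. exact: nm_zc_pos. Qed.

Lemma near_omega_ball z : zr R scale7 * nm (z - w) <= 1 -> near_omega z.
Proof.
move=> zw; rewrite /near_omega.
have -> : zc R scale7 Z0 * z - zc R omega7_re omega7_im =
  zc R scale7 Z0 * (z - w) + (zc R scale7 Z0 * w - zc R omega7_re omega7_im) by ring.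
apply: le_trans (nmD _ _) _; rewrite nmM S7n.
apply: le_trans (lerD zw w_approx) _.
by rewrite -zr1 -zrD zr_le.
Qed.

Lemma near_w : near_omega w.
Proof. by apply: near_omega_ball; rewrite subrr nm0 mulr0. Qed.

Lemma nm_w : nm w <= 16 / 25.
Proof.
have /andP[_ h] := near_nm near_w.
rewrite -(ler_pM2l S70) mulrA ler_pdivlMr //; apply: (@le_trans _ _ (zr R 6388023%ZZ * 25)).
  by rewrite ler_wpM2r.
have -> : (25 : R) = zr R 25%ZZ by rewrite zrE.
have -> : (16 : R) = zr R 16%ZZ by rewrite zrE.
by rewrite -!zrM zr_le.
Qed.

Lemma Re_w : complex.Re w < 3 / 8.
Proof.
have := le_trans (nm_Re _) w_approx.
rewrite Re_affine ler_norml => /andP[_ h].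
rewrite -(ltr_pM2l S70); apply: (@le_lt_trans _ _ (zr R 3718600%ZZ)).
  by have -> : zr R 3718600%ZZ = zr R omega7_re + zr R 10%ZZ by [rewrite -zrD]; lra.
rewrite mulrA ltr_pdivlMr //.
have -> : (8 : R) = zr R 8%ZZ by rewrite zrE.
have -> : (3 : R) = zr R 3%ZZ by rewrite zrE.
by rewrite -!zrM zr_lt.
Qed.

Lemma Im_w : 1 / 2 < complex.Im w.
Proof.
have := le_trans (nm_Im _) w_approx.
rewrite Im_affine ler_norml => /andP[h _].
rewrite -(ltr_pM2l S70); apply: (@lt_le_trans _ _ (zr R 5194100%ZZ)); last first.
  by have -> : zr R 5194100%ZZ = zr R omega7_im - zr R 10%ZZ by [rewrite -zrB]; lra.
rewrite mulrA mulr1 ltr_pdivrMr //.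
have -> : (2 : R) = zr R 2%ZZ by rewrite zrE.
by rewrite -!zrM zr_lt.
Qed.

Lemma w0 : w != 0. Proof. exact: near_neq0 near_w. Qed.

(** The difference quotient of [omega_poly] at its root w, as a polynomial; its value at w is the
    derivative. *)
Definition quot z : C := - 2 + 2 * (z + w)
  - 2 * (z ^+ 4 + z ^+ 3 * w + z ^+ 2 * w ^+ 2 + z * w ^+ 3 + w ^+ 4)
  + 2 * (z ^+ 7 + z ^+ 6 * w + z ^+ 5 * w ^+ 2 + z ^+ 4 * w ^+ 3
         + z ^+ 3 * w ^+ 4 + z ^+ 2 * w ^+ 5 + z * w ^+ 6 + w ^+ 7).

Lemma quotE z : omega_poly z = (z - w) * quot z.
Proof. by rewrite -[LHS]subr0 -w_root /quot /omega_poly; ring. Qed.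

(* Modulo omega_poly, [w * omega_poly'(w)] is of degree 5 in [w]. *)
Lemma quot_w_neq0 : quot w != 0.
Proof.
apply/eqP => q0.
have E : - 8 + 14 * w - 12 * w ^+ 2 = - (6 * w ^+ 5).
  apply/eqP; rewrite -subr_eq0 opprK; apply/eqP.
  have <- : w * quot w - 8 * omega_poly w = - 8 + 14 * w - 12 * w ^+ 2 + 6 * w ^+ 5.
    by rewrite /quot /omega_poly; ring.
  by rewrite q0 w_root !mulr0 subr0.
(* By [Re_w] and [Im_w] this exceeds 5/2, whereas |6 w^5| is at most 6 (16/25)^5 < 1. *)
have h1 : complex.Im (- 8 + 14 * w - 12 * w ^+ 2) =
    complex.Im w * (14 - 24 * complex.Re w).
  have rE (k : R) (v : C) : k%:C * v = ((k * complex.Re v) +i* (k * complex.Im v))%C.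
    by case: v => a b; apply/eqP; rewrite eq_complex /= !mul0r subr0 addr0 !eqxx.
  have -> : - 8 + 14 * w - 12 * w ^+ 2 = (- 8)%:C + 14%:C * w - 12%:C * w ^+ 2.
    by rewrite !rmorphN !rmorph_nat.
  rewrite !rE expr2; case: (w) => a b /=; ring.
have h2 : nm (6 * w ^+ 5) <= 6 * (16 / 25) ^+ 5.
  have -> : (6 : C) = 6%:C by rewrite rmorph_nat.
  rewrite nmM nmR nmX ger0_norm // ler_wpM2l //.
  by rewrite lerXn2r ?nnegrE ?nm_ge0 ?nm_w //; lra.
have := nm_Im (- 8 + 14 * w - 12 * w ^+ 2); rewrite h1 E nmN => h3.
have h4 := le_trans (ler_norm _) (le_trans h3 h2).
have := Im_w; have := Re_w; move: h4; rewrite !exprS expr0.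
by set a := complex.Re w; set b := complex.Im w; nra.
Qed.

(** To first order in z - w, the offset of [tail z n] from 1 / (1 - z) is [speed] times (z - w) /
    w^(8+n). *)
Definition speed : C := - quot w / (1 - w).

Lemma speed_neq0 : speed != 0.
Proof.
by rewrite mulf_neq0 ?oppr_eq0 ?quot_w_neq0 // invr_eq0 (near_one_sub near_w).
Qed.

(* [speed] makes [tail (blowup n s) n] tend to [1 / (1 - w) + s]. *)
Definition blowup (n : nat) (s : C) : C := w + w ^+ (8 + n) * (s / speed).

Lemma continuous_cstC (a : C) : continuous (fun _ : C => a).
Proof.
by apply: (@lipschitz_continuous _ _ 0) => x y; rewrite subrr nm0 mul0r.
Qed.

Lemma continuous_idC : continuous (fun z : C => z).
Proof. by apply: (@lipschitz_continuous _ _ 1) => x y; rewrite mul1r. Qed.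

Lemma horner_seq_continuous (c : seq C) :
  continuous (fun z : C => foldr (fun a v => a + z * v) 0 c).
Proof.
elim: c => [|a c IHc].
  have -> : (fun z : C => foldr (fun a v => a + z * v) 0 [::]) = (fun=> 0 : C) by [].
  exact: continuous_cstC.
pose f (z : C) : C := foldr (fun a v => a + z * v) 0 c.
have -> : (fun z : C => foldr (fun a v => a + z * v) 0 (a :: c)) =
  (fun z : C => a + z * f z) by [].
move=> z; apply: (@continuousD _ _ _ (fun=> a) (fun z => z * f z)).
  exact: continuous_cstC.
by apply: (@continuousM _ _ (fun z => z) f); [exact: continuous_idC|exact: IHc].
Qed.

Lemma quot_continuous : continuous quot.
Proof.
have -> : quot = (fun z : C => foldr (fun a v => a + z * v) 0
  [:: - 2 + 2 * w - 2 * w ^+ 4 + 2 * w ^+ 7; 2 - 2 * w ^+ 3 + 2 * w ^+ 6;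
      - 2 * w ^+ 2 + 2 * w ^+ 5; - 2 * w + 2 * w ^+ 4; - 2 + 2 * w ^+ 3;
      2 * w ^+ 2; 2 * w; 2]).
  by apply/funext => z; rewrite /quot /=; ring.
exact: horner_seq_continuous.
Qed.

Lemma ratio_near (e : R) : 0 < e -> exists2 d, 0 < d & forall z, nm (z - w) < d ->
  nm (- quot z / (1 - z) / speed - 1) < e.
Proof.
move=> e0; pose f (z : C) := - quot z / (1 - z) / speed.
have fw : f w = 1 by rewrite /f divff // speed_neq0.
have cf : {for w, continuous f}.
  have c1 : {for w, continuous (fun z => (1 - z)^-1)}.
    apply: (@continuousV _ _ (fun z : C => 1 - z)); first exact: near_one_sub near_w.
    apply: (@lipschitz_continuous _ _ 1) => x y.
    by have -> : 1 - x - (1 - y) = y - x by [ring]; rewrite mul1r nmB.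
  apply: (@continuousM _ _ (fun z => - quot z / (1 - z)) (fun=> speed^-1));
    last exact: continuous_cstC.
  apply: (@continuousM _ _ (fun z => - quot z) (fun z => (1 - z)^-1)); last exact: c1.
  by apply: (@continuousN _ _ _ quot); exact: quot_continuous.
have [d d0 df] := iffLR (continuous_nmP f w) cf e e0.
by exists d => // z /df; rewrite fw.
Qed.

Lemma tailE z n s : z != 0 -> 1 - z != 0 -> z = blowup n s ->
  tail z n - (1 - z)^-1 = s * ((- quot z / (1 - z) / speed) * (w / z) ^+ (8 + n)).
Proof.
move=> z0 z1 zE; rewrite /tail quotE.
have zw : z - w = w ^+ (8 + n) * (s / speed) by rewrite zE /blowup addrC addKr.
rewrite zw expr_div_n.
have zn : z ^+ (8 + n) != 0 by rewrite expf_neq0.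
by field; rewrite z1 speed_neq0 zn.
Qed.

Lemma blowup_nm n s : nm (blowup n s - w) = nm w ^+ (8 + n) * (nm s / nm speed).
Proof. by rewrite /blowup addrAC subrr add0r nmM nmX nmf. Qed.

(** By [tailE] the offset is s times two factors close to 1. The delicate one is (w/z)^(8+n), whose
    exponent grows; but |w/z - 1| is of order |w|^(7+n), and n |w|^n tends to 0. *)
Lemma tail_blowup (rho : R) : 0 < rho -> exists n0, forall n, (n0 <= n)%N ->
  forall s, nm s <= rho -> near_omega (blowup n s) /\
    nm (zc R scale Z0 * (tail (blowup n s) n - (1 - blowup n s)^-1 - s)) <= zr R 4000%ZZ.
Proof.
move=> rho0; pose k := nm speed.
have k0 : 0 < k by rewrite nm_gt0 speed_neq0.
have wp : 0 < nm w by rewrite nm_gt0 w0.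
have S80 : 0 < zr R scale by exact: zr_gt0.
have S8n : nm (zc R scale Z0) = zr R scale by exact: nm_zc_pos.
have e40 : 0 < zr R 4000%ZZ by exact: zr_gt0.
pose e := zr R 4000%ZZ / (zr R scale * rho).
have e0 : 0 < e by rewrite divr_gt0 // mulr_gt0.
have e4 : 0 < Num.min 1 (e / 4) by rewrite lt_min ltr01 divr_gt0.
have [d d0 dP] := ratio_near e4.
(* In turn: for [ratio_near], for [near_omega], for the hypothesis of [pow_near1], and to bring the
   power within 4 m <= e / 4 of 1. *)
pose m := Num.min (Num.min d (zr R scale7)^-1) (Num.min (1 / 8) (e / 16)).
have m0 : 0 < m.
  by rewrite !lt_min d0 invr_gt0 S70 (divr_gt0 e0) // divr_gt0.
pose x0 := m * k / rho.
have x00 : 0 < x0 by rewrite divr_gt0 // mulr_gt0.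
have x20 : 0 < x0 / 2 by rewrite divr_gt0.
have [n0 n0P] := nexp_small x20.
exists n0 => n n0n s srho; set z := blowup n s.
set N := (8 + n)%N.
pose x := nm w ^+ (7 + n) * (nm s / k).
have sk0 : 0 <= nm s / k by rewrite divr_ge0 ?nm_ge0 // ltW.
have x_ge0 : 0 <= x by rewrite mulr_ge0 ?exprn_ge0 ?nm_ge0.
have N1 : 1 <= N%:R :> R by rewrite (ler_nat R 1).
have Nx : N%:R * x < m.
  have h := n0P (7 + n)%N (leq_trans n0n (leq_addl _ _)).
  have hw : nm w ^+ (7 + n) <= (16 / 25) ^+ (7 + n).
    by rewrite lerXn2r ?nnegrE ?nm_ge0 ?nm_w //; lra.
  have hN : N%:R <= 2 * (7 + n)%:R :> R.
    by rewrite -(natrM R 2) ler_nat mulnDr leq_add // leq_pmull.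
  have hx : N%:R * nm w ^+ (7 + n) < x0.
    apply: (@le_lt_trans _ _ (2 * (7 + n)%:R * (16 / 25) ^+ (7 + n))).
      by apply: ler_pM => //; rewrite exprn_ge0 ?nm_ge0.
    by move: h; rewrite -mulrA; lra.
  rewrite /x mulrA; apply: (@le_lt_trans _ _ (N%:R * nm w ^+ (7 + n) * (rho / k))).
    apply: ler_wpM2l; first by rewrite mulr_ge0 ?exprn_ge0 ?nm_ge0.
    by apply: ler_wpM2r => //; rewrite invr_ge0 ltW.
  have -> : m = x0 * (rho / k) by rewrite /x0; field; rewrite !gt_eqF.
  by rewrite ltr_pM2r // divr_gt0.
have xm : x < m by apply: le_lt_trans Nx; rewrite ler_peMl.
have w1 : nm w <= 1 by have := nm_w; lra.
have zwE : nm (z - w) = nm w * x by rewrite blowup_nm exprS -mulrA.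
have zwx : nm (z - w) <= x by rewrite zwE -[leRHS]mul1r; apply: ler_wpM2r.
have [md ms m8 me] : [/\ m <= d, m <= (zr R scale7)^-1, m <= 1 / 8 & m <= e / 16].
  by split; rewrite !ge_min lexx ?orbT.
have nz : near_omega z.
  apply: near_omega_ball; rewrite -ler_pdivlMl // mulr1.
  by apply: le_trans zwx (le_trans (ltW xm) ms).
split => //.
have z0 := near_neq0 nz; have z1 := near_one_sub nz.
pose y := (w - z) / z.
have wzE : w / z = 1 + y by rewrite /y mulrBl divff // addrC subrK.
have yx : nm y <= 2 * x.
  have zp : 0 < nm z by rewrite nm_gt0.
  rewrite /y nmf nmB ler_pdivrMr // zwE.
  have := nm_tri z w 0; rewrite !subr0 (nmB w z) zwE => h.
  have : nm w <= 2 * nm z by move: (nm_ge0 w) x_ge0; nra.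
  by move=> hz; rewrite mulrAC; apply: ler_wpM2r.
have Ny : N%:R * nm y <= 2 * m.
  apply: (@le_trans _ _ (N%:R * (2 * x))); first by rewrite ler_wpM2l.
  by rewrite mulrCA ler_pM2l // ltW.
have b1 : nm ((w / z) ^+ N - 1) <= 4 * m.
  rewrite wzE; apply: le_trans (pow_near1 _) _; first by lra.
  by rewrite -mulrA; lra.
have a1 : nm (- quot z / (1 - z) / speed - 1) < Num.min 1 (e / 4).
  by apply: dP; apply: le_lt_trans zwx (lt_le_trans xm md).
rewrite (@tailE z n s z0 z1 erefl) -/N.
move: a1 b1; set a := - quot z / _ / _; set b := (w / z) ^+ N.
rewrite lt_min => /andP[a1 ae] b1.
have -> : zc R scale Z0 * (s * (a * b) - s) =
   zc R scale Z0 * s * ((a - 1) * (b - 1) + (a - 1) + (b - 1)) by ring.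
rewrite !nmM S8n.
have ab : nm ((a - 1) * (b - 1) + (a - 1) + (b - 1)) <= e.
  apply: le_trans (nmD _ _) _; have := nmD ((a - 1) * (b - 1)) (a - 1).
  rewrite nmM; have := nm_ge0 (a - 1); have := nm_ge0 (b - 1).
  by set u := nm (a - 1) in a1 ae *; set v := nm (b - 1) in b1 *; nra.
apply: (@le_trans _ _ (zr R scale * rho * e)).
  apply: ler_pM; rewrite ?nm_ge0 ?mulr_ge0 ?nm_ge0 ?(ltW S80) //.
  by rewrite ler_wpM2l // ltW.
by rewrite /e mulrC divfK // mulf_neq0 ?gt_eqF.
Qed.

End Asymptotics.

(** * Loops and holes *)

Section Polygon.
Variable R : realType.
Local Notation C := (CC R).

Definition clamp (x : R) : R := Num.max 0 (Num.min 1 x).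

Lemma clamp0 x : x <= 0 -> clamp x = 0.
Proof. by move=> x0; rewrite /clamp max_l // ge_min x0 orbT. Qed.

Lemma clamp1 x : 1 <= x -> clamp x = 1.
Proof. by move=> x1; rewrite /clamp (min_l x1) max_r. Qed.

Lemma clamp_id x : 0 <= x <= 1 -> clamp x = x.
Proof. by move=> /andP[x0 x1]; rewrite /clamp (min_r x1) max_r. Qed.

Lemma clamp_lip x y : `|clamp x - clamp y| <= `|x - y|.
Proof.
wlog xy : x y / x <= y.
  by move=> h; case: (leP x y) => [|/ltW] /h //; rewrite distrC [leRHS]distrC.
rewrite distrC [leRHS]distrC (ger0_norm (_ : 0 <= y - x)) ?subr_ge0 //.
have [xlt0|x0] := ltP x 0.
  rewrite (clamp0 (ltW xlt0)) subr0; have [ylt0|y0] := ltP y 0.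
    by rewrite (clamp0 (ltW ylt0)) normr0 subr_ge0.
  have [y1|/ltW y1] := leP y 1.
    by rewrite clamp_id ?y0 // ger0_norm //; lra.
  by rewrite clamp1 // normr1; lra.
have [x1|/ltW x1] := leP x 1; last first.
  by rewrite !clamp1 ?(le_trans x1) // subrr normr0 subr_ge0.
rewrite (@clamp_id x) ?x0 //; have [y1|/ltW y1] := leP y 1.
  by rewrite clamp_id ?(le_trans x0) // ger0_norm ?subr_ge0.
by rewrite clamp1 // ger0_norm ?subr_ge0 // lerD2r.
Qed.

(** Vertex j is reached at x = j. As a sum of clamped increments the path is Lipschitz at once,
    without gluing of pieces. *)
Fixpoint polyline (v : nat -> C) (k : nat) (x : R) : C :=
  if k is j.+1 then polyline v j x + (clamp (x - j%:R))%:C * (v j.+1 - v j) else v 0%N.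

Lemma polyline_end v k x : k%:R <= x -> polyline v k x = v k.
Proof.
elim: k => //= k IHk kx; rewrite IHk; last by apply: le_trans kx; rewrite ler_nat.
by rewrite clamp1 ?mul1r ?subrKC // lerBrDr addrC natr1.
Qed.

Lemma polyline_seg v m i x : (i < m)%N -> i%:R <= x <= i.+1%:R ->
  polyline v m x = seg (v i) (v i.+1) (x - i%:R).
Proof.
move=> im /andP[ix xi]; elim: m im => // m IHm; rewrite ltnS leq_eqVlt => /orP[/eqP <-|im] /=.
  rewrite polyline_end // clamp_id // subr_ge0 ix.
  by rewrite lerBlDr addrC natr1.
rewrite (IHm im) clamp0 ?mul0r ?addr0 // subr_le0.
by apply: le_trans xi _; rewrite ler_nat.
Qed.

Lemma polyline_lip v m : exists k, forall x y,
  nm (polyline v m x - polyline v m y) <= k * `|x - y|.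
Proof.
elim: m => [|m [k kP]] /=; first by exists 0 => x y; rewrite subrr nm0 mul0r.
exists (k + nm (v m.+1 - v m)) => x y.
rewrite opprD addrACA -mulrBl -rmorphB mulrDl.
apply: le_trans (nmD _ _) _; rewrite lerD // nmM nmR mulrC ler_wpM2l ?nm_ge0 //.
by apply: le_trans (clamp_lip _ _) _; rewrite opprB addrA subrK.
Qed.

Lemma lipschitz_curve_continuous (f : R -> C) (k : R) :
  (forall x y, nm (f x - f y) <= k * `|x - y|) -> continuous f.
Proof.
move=> fk t A /nbhs_nmP[r r0 rA].
pose k' := `|k| + 1.
have k0 : 0 < k' by rewrite ltr_wpDl.
have : \forall s \near t, `|t - s| < r / k'.
  by apply/nbhs_ballP; exists (r / k') => /=; rewrite ?divr_gt0.
apply: filterS => s; rewrite ltr_pdivlMr // => str; apply: rA.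
apply: le_lt_trans (fk s t) (le_lt_trans _ str); rewrite distrC mulrC.
by rewrite ler_wpM2l // (le_trans (ler_norm k)) // lerDl.
Qed.

Lemma zc_div a b c d : (0 < sq a b)%ZZ -> zc R c d / zc R a b =
  ((zr R (sq a b))^-1)%:C * zc R (Z.add (Z.mul a c) (Z.mul b d)) (Z.sub (Z.mul a d) (Z.mul b c)).
Proof.
move=> n0; have u0 : zc R a b * zc R a (Z.opp b) = zc R (sq a b) Z0.
  by rewrite zcM /sq; congr (zc R _ _); lia.
have s0 : zc R (sq a b) Z0 != 0 by apply: zc_neq0; lia.
have z0 : zc R a b != 0 by apply: contra_neq s0 => z0; rewrite -u0 z0 mul0r.
have -> : ((zr R (sq a b))^-1)%:C = (zc R (sq a b) Z0)^-1.
  by rewrite -zc_real; exact: fmorphV.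
apply: (mulIf z0); rewrite divfK // -mulrA zcM.
apply: (mulfI s0); rewrite mulVKf // zcM.
by congr (zc R _ _); rewrite /sq; ring.
Qed.

Lemma Re_div_zc a b c d : (0 < Z.add (Z.mul a c) (Z.mul b d))%ZZ ->
  0 < complex.Re (zc R c d / zc R a b).
Proof.
move=> h; have n0 : (0 < sq a b)%ZZ.
  by rewrite /sq; case: (Z.eq_dec a 0); case: (Z.eq_dec b 0) => *; subst; nia.
rewrite zc_div //= mul0r subr0 mulr_gt0 ?invr_gt0 // zr_gt0 //; lia.
Qed.

Lemma Im_div_zc a b c d : (0 < Z.sub (Z.mul a d) (Z.mul b c))%ZZ ->
  0 < complex.Im (zc R c d / zc R a b).
Proof.
move=> h; have n0 : (0 < sq a b)%ZZ.
  by rewrite /sq; case: (Z.eq_dec a 0); case: (Z.eq_dec b 0) => *; subst; nia.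
rewrite zc_div //= mul0r addr0 mulr_gt0 ?invr_gt0 // zr_gt0 //; lia.
Qed.

Definition bead_side : R := zr R bead_unit / zr R scale.

Lemma bead_side_gt0 : 0 < bead_side.
Proof. by rewrite divr_gt0 ?zr_gt0. Qed.

Lemma bead_side_small : bead_side * zr R 1000%ZZ = 1 / 2.
Proof.
have S0 : 0 < zr R scale by rewrite zr_gt0.
have E : zr R scale = 2 * (zr R bead_unit * zr R 1000%ZZ).
  have -> : (2 : R) = zr R 2%ZZ by rewrite zrE.
  by rewrite -!zrM.
rewrite /bead_side mulrAC; apply: (@mulIf _ (zr R scale)); first by rewrite gt_eqF.
by rewrite divfK ?gt_eqF // E; set x := _ * zr R 1000%ZZ; lra.
Qed.

Definition bead_vertex (b : (Z * Z * Z) * seq Z) : C :=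
  let: ((x, y, _), _) := b in bead_side%:C * zc R x y.

Definition bead_radius (b : (Z * Z * Z) * seq Z) : R :=
  let: ((_, _, r), _) := b in bead_side * zr R r.

Lemma bead_discP b s : bead_disc b s <-> nm (s - bead_vertex b) < bead_radius b.
Proof.
case: b => [[[x y] r] c]; rewrite /bead_disc /bead_vertex /bead_radius /bead_side.
have S0 : 0 < zr R scale by rewrite zr_gt0.
have SE : (zr R scale)%:C != 0 :> C by rewrite -nm_gt0 nmR gtr0_norm.
have -> : zc R scale Z0 * s - zc R (Z.mul x bead_unit) (Z.mul y bead_unit) =
    (zr R scale)%:C * (s - (zr R bead_unit / zr R scale)%:C * zc R x y).
  have -> : zc R (Z.mul x bead_unit) (Z.mul y bead_unit) = (zr R bead_unit)%:C * zc R x y.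
    by rewrite zc_real zcM; congr (zc R _ _); lia.
  by rewrite zc_real rmorphM /= fmorphV -!zc_real; field.
rewrite nmM nmR gtr0_norm // zrM.
have -> : zr R r * zr R bead_unit = zr R scale * (zr R bead_unit / zr R scale * zr R r).
  by field; rewrite gt_eqF.
by rewrite ltr_pM2l.
Qed.

Lemma bead_vertex_small b : bead_small b -> nm (bead_vertex b) < 1 / 2.
Proof.
case: b => [[[x y] r] c] /= /andP[_ xy].
rewrite nmM nmR (gtr0_norm bead_side_gt0) -bead_side_small.
by rewrite ltr_pM2l ?bead_side_gt0 // nm_zc_lt.
Qed.

Lemma linked_turn b b' : linked b b' -> bead_small b -> bead_small b' ->
  [/\ 0 < complex.Re (bead_vertex b' / bead_vertex b),
      0 < complex.Im (bead_vertex b' / bead_vertex b) &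
      nm (bead_vertex b' - bead_vertex b) < bead_radius b + bead_radius b'].
Proof.
case: b b' => [[[x y] r] c] [[[x' y'] r'] c'].
rewrite /linked /bead_small => /and3P[d p q] /andP[r0 _] /andP[r0' _].
rewrite /bead_vertex /bead_radius.
have k0 : bead_side%:C != 0 :> C by rewrite -nm_gt0 nmR gtr0_norm bead_side_gt0.
have -> : bead_side%:C * zc R x' y' / (bead_side%:C * zc R x y) = zc R x' y' / zc R x y.
  by rewrite -mulf_div divff // mul1r.
split; [by apply: Re_div_zc; lia|by apply: Im_div_zc; lia|].
rewrite -mulrBr zcB nmM nmR (gtr0_norm bead_side_gt0) -mulrDr -zrD.
rewrite ltr_pM2l ?bead_side_gt0 //; by apply: nm_zc_lt; rewrite /sq; lia.
Qed.

Lemma seg_bead b b' t : linked b b' -> bead_small b -> bead_small b' -> 0 <= t <= 1 ->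
  bead_disc b (seg (bead_vertex b) (bead_vertex b') t) \/
  bead_disc b' (seg (bead_vertex b) (bead_vertex b') t).
Proof.
move=> bb sb sb'; have [_ _ d] := linked_turn bb sb sb'; move=> /andP[t0 t1]; rewrite !bead_discP.
have -> : seg (bead_vertex b) (bead_vertex b') t - bead_vertex b =
    t%:C * (bead_vertex b' - bead_vertex b).
  by rewrite /seg addrAC subrr add0r.
have -> : seg (bead_vertex b) (bead_vertex b') t - bead_vertex b' =
    (t - 1)%:C * (bead_vertex b' - bead_vertex b).
  by rewrite /seg rmorphB rmorph1; ring.
rewrite !nmM !nmR (ger0_norm t0) (ler0_norm (_ : t - 1 <= 0)) ?subr_le0 //.
set D := nm _ in d *; have D0 : 0 <= D by apply: nm_ge0.
by case: (ltP (t * D) (bead_radius b)) => h; [left|right; lra].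
Qed.

Lemma bead_polygon (s : seq ((Z * Z * Z) * seq Z)) :
  s != [::] -> cycle linked s -> all bead_small s ->
  exists q : R -> C, exists m : nat, exists tau : nat -> R,
  [/\ exists k, forall x y, nm (q x - q y) <= k * `|x - y|,
      q 0 = q 1,
      (forall t, 0 <= t <= 1 -> nm (q t) < 1 / 2 /\ exists2 b, b \in s & bead_disc b (q t)),
      (forall t, 0 <= t <= 1 -> q t != 0) &
  [/\ (0 < m)%N, tau 0%N = 0, tau m = 1, (forall i, tau i <= tau i.+1) &
      (forall i t, (i < m)%N -> tau i <= t <= tau i.+1 -> 0 < complex.Re (q t / q (tau i)))
      /\ (forall i, (i < m)%N -> 0 < complex.Im (q (tau i.+1) / q (tau i)))]].
Proof.
case: s => // b0 p _ cs ss.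
(* The first bead is repeated at the end, so that side m - 1 closes the polygon. *)
pose full := b0 :: rcons p b0; pose m := (size p).+1.
pose b i := nth b0 full i; pose v i := bead_vertex (b i).
have lk i : (i < m)%N -> linked (b i) (b i.+1).
  by move=> im; move/pathP: cs => /(_ b0 i); rewrite size_rcons; apply.
have bs i : (i <= m)%N -> b i \in b0 :: p.
  move=> im; have : b i \in full by rewrite mem_nth //= size_rcons ltnS.
  by rewrite !inE mem_rcons !inE orbA orbb.
have m0 : 0 < m%:R :> R by rewrite ltr0n.
have bm : b m = b0 by rewrite /b /full /m /= nth_rcons ltnn eqxx.
pose q t := polyline v m (m%:R * t); pose tau i : R := i%:R / m%:R.
have tauS i t : tau i <= t <= tau i.+1 -> i%:R <= m%:R * t <= i.+1%:R.
  by rewrite /tau ler_pdivrMr // ler_pdivlMr // mulrC.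
have qE i t : (i < m)%N -> tau i <= t <= tau i.+1 ->
    q t = seg (v i) (v i.+1) (m%:R * t - i%:R).
  by move=> im /tauS; exact: polyline_seg.
have in01 i t : tau i <= t <= tau i.+1 -> 0 <= m%:R * t - i%:R <= 1.
  by move=> /tauS/andP[h1 h2]; rewrite subr_ge0 h1 lerBlDr addrC natr1.
have tau_le i : tau i <= tau i.+1.
  by rewrite ler_pM2r ?invr_gt0 // ler_nat.
have qtau i : (i <= m)%N -> q (tau i) = v i.
  rewrite leq_eqVlt => /orP[/eqP ->|im].
    by rewrite /q /tau divff ?gt_eqF // mulr1 polyline_end.
  by rewrite (@qE i) ?lexx ?tau_le // mulrC divfK ?gt_eqF // subrr seg0.
have cov t : 0 <= t <= 1 -> exists2 i, (i < m)%N & tau i <= t <= tau i.+1.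
  move=> /andP[t0 t1].
  have [n nm1 tn] : exists2 n, (n <= m)%N & t <= tau n.
    by exists m; rewrite ?leqnn // /tau divff ?gt_eqF.
  elim: n nm1 tn => [|n IHn] nm1 tn.
    exists 0%N => //; move: tn; rewrite /tau mul0r => tn.
    by rewrite t0 (le_trans tn) // divr_ge0.
  case: (leP t (tau n)) => [h|/ltW h]; first by apply: IHn h; exact: ltnW.
  by exists n; rewrite ?h.
have sm i : (i <= m)%N -> bead_small (b i) by move=> im; exact: (allP ss _ (bs i im)).
have turn i t : (i < m)%N -> tau i <= t <= tau i.+1 ->
    0 < complex.Re (q t / q (tau i)).
  move=> im ti; have [dp _ _] := linked_turn (lk i im) (sm i (ltnW im)) (sm i.+1 im).
  rewrite (qE i t im ti) (qtau i (ltnW im)).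
  have v0 : v i != 0.
    by apply/eqP => vi0; move: dp; rewrite -/(v i) vi0 invr0 mulr0 ltxx.
  move: (m%:R * t - i%:R) (in01 i t ti) => x /andP[x0 x1].
  (* A convex combination of 1 and the quotient of the vertices, both of positive real part. *)
  have -> : seg (v i) (v i.+1) x / v i = (1 - x)%:C + x%:C * (v i.+1 / v i).
    by rewrite /seg (rmorphB (real_complex R)) (rmorph1 (real_complex R)); field.
  have -> : complex.Re ((1 - x)%:C + x%:C * (v i.+1 / v i)) =
    (1 - x) + x * complex.Re (v i.+1 / v i).
    by case: (v i.+1 / v i) => a c /=; rewrite mul0r subr0.
  move: dp; rewrite -/(v i) -/(v i.+1); set u := complex.Re _ => u0.
  by move: x0; rewrite le_eqVlt => /orP[/eqP <-|]; nra.
exists q, m, tau; split.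
- have [k kP] := polyline_lip v m; exists (k * m%:R) => x y.
  by apply: le_trans (kP _ _) _; rewrite -mulrBr normrM (ger0_norm (ltW m0)) mulrA.
- have := qtau 0%N (leq0n m); have := qtau m (leqnn m).
  by rewrite /tau mul0r divff ?gt_eqF // => -> ->; rewrite /v bm.
- move=> t /cov[i im ti]; rewrite (qE i t im ti); split.
    rewrite -[X in nm X]subr0; apply: nm_seg; first exact: in01.
      by rewrite subr0 bead_vertex_small // sm // ltnW.
    by rewrite subr0 bead_vertex_small // sm.
  have [h|h] := seg_bead (lk i im) (sm i (ltnW im)) (sm i.+1 im) (in01 i t ti).
    by exists (b i) => //; apply: bs; exact: ltnW.
  by exists (b i.+1) => //; apply: bs.
- by move=> t /cov[i im ti]; have := turn i t im ti; apply: contraTneq => ->;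
    rewrite mul0r ltxx.
- split=> //; [by rewrite /tau mul0r|by rewrite /tau divff ?gt_eqF|].
  split=> // i im; rewrite !qtau // 1?ltnW //.
  by have [] := linked_turn (lk i im) (sm i (ltnW im)) (sm i.+1 im).
Qed.
End Polygon.

(** * The decimal approximation of omega *)

Section Literals.
Variable R : realType.
(** Large numerals are unfolded bit by bit, which keeps the resulting field expressions small. *)
Lemma zr_xO p : zr R (Zpos (xO p)) = 2 * zr R (Zpos p).
Proof. by rewrite Pos2Z.inj_xO zrM (_ : zr R 2%ZZ = 2) // zrE. Qed.
Lemma zr_xI p : zr R (Zpos (xI p)) = 2 * zr R (Zpos p) + 1.
Proof. by rewrite Pos2Z.inj_xI zrD zrM zr1 (_ : zr R 2%ZZ = 2) // zrE. Qed.

Lemma natr_10X6 (K : numFieldType) : (10 ^+ 6)%:R = 10 ^+ 6 :> K.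
Proof. by rewrite natrXE natrX natn. Qed.

Lemma scale7_omega_approx :
  zc R scale7 Z0 * omega_approx = zc R omega7_re omega7_im.
Proof.
have scale_re_im (k a b : R) : k%:C * (a +i* b)%C = ((k * a) +i* (k * b))%C :> CC R.
  by apply/eqP; rewrite eq_complex /= !mul0r subr0 addr0 !eqxx.
have scaled (a d : R) (b : Z) : d = 10 ^+ 6 -> a = zr R b ->
    zr R scale7 * (a / d) = zr R (Z.mul 10%ZZ b).
  by move=> -> ->; rewrite zrM /scale7 !(zr_xI, zr_xO) zr1; field.
rewrite -zc_real /omega_approx scale_re_im.
congr (_ +i* _)%C.
  apply: (scaled _ _ 371859%ZZ); first exact: natr_10X6.
  by rewrite !(zr_xI, zr_xO) zr1; ring.
apply: (scaled _ _ 519411%ZZ); first exact: natr_10X6.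
by rewrite !(zr_xI, zr_xO) zr1; ring.
Qed.

Lemma approx_close (w : CC R) : `|w - omega_approx| < (10 ^+ 6)%:R^-1 ->
  nm (zc R scale7 Z0 * w - zc R omega7_re omega7_im) <= zr R 10%ZZ.
Proof.
rewrite natr_10X6 -scale7_omega_approx -mulrBr nmM nm_zc_pos //.
move: (w - _) => v.
have -> : (10 ^+ 6)^-1 = ((10 ^+ 6)^-1)%:C :> CC R.
  by rewrite fmorphV rmorphXn /= rmorph_nat.
rewrite normE ltcR => /ltW vs.
have S0 : 0 < zr R scale7 by rewrite zr_gt0.
apply: le_trans (ler_wpM2l (ltW S0) vs) _.
rewrite ler_pdivrMr ?exprn_gt0 // /scale7 !(zr_xI, zr_xO) zr1; lra.
Qed.
End Literals.

(** * Fullness from a single common point *)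

Section Fullness.
Variable R : realType.
Local Notation C := (CC R).

(* A point of the complement seen around [Lam z] would have a preimage with
   the same property further away, since the two halves of [Lam z] share a
   single point. *)
Lemma single_meet_full (z q : C) : Dstar z ->
  (ifs_f z) @` Lam z `&` (ifs_g z) @` Lam z = [set q] -> full (Lam z).
Proof.
move=> Dz meet; have /andP[z0 z1] := iffLR (Dstar_nm z) Dz.
have zn0 : z != 0 by rewrite -nm_gt0.
apply: arg_connected_setC; first exact: Lam_compact.
move=> x nLx; apply: contrapT => bad.
have fE : ifs_f z @` Lam z = (fun p => z * p + 0) @` Lam z.
  by apply: eq_imagel => p _; rewrite ifs_fE.
have gE : ifs_g z @` Lam z = (fun p => z * p + (1 - z)) @` Lam z.
  by apply: eq_imagel => p _; rewrite ifs_gE.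
have step y : ~ Lam z y -> ~ arg_on (Lam z) y ->
    exists t, (t = 0 \/ t = 1 - z) /\ ~ arg_on (Lam z) ((y - t) / z).
  move=> nLy bady; apply: contrapT => nt.
  have good t : t = 0 \/ t = 1 - z -> arg_on ((fun p => z * p + t) @` Lam z) y.
    move=> ht; have -> : y = z * ((y - t) / z) + t.
      by rewrite mulrC divfK // subrK.
    apply: arg_on_affine => //; apply: contrapT => h; apply: nt.
    by exists t.
  have [fq gq] : (ifs_f z @` Lam z `&` ifs_g z @` Lam z) q by rewrite meet.
  apply: bady; rewrite LamE // /Fifs.
  apply: (@arg_on_glue _ _ _ q) => //.
  - by rewrite fE; apply: affine_image_closed => //; exact: Lam_closed.
  - by rewrite gE; apply: affine_image_closed => //; exact: Lam_closed.
  - by rewrite meet.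
  - by apply/eqP => qy; apply: nLy; rewrite LamE // -qy; left.
  - by rewrite fE; apply: good; left.
  - by rewrite gE; apply: good; right.
have [d d0 dP] : exists2 d : R, 0 < d & forall p, Lam z p -> d <= nm (p - x).
  have /closed_openC/open_nmP/(_ x nLx)[d d0 dP] := Lam_closed Dz.
  by exists d => // p Lp; rewrite leNgt; apply/negP => /dP.
have far n : exists y, ~ arg_on (Lam z) y /\
    forall p, Lam z p -> d <= nm z ^+ n * nm (p - y).
  elim: n => [|n [y [bady yP]]].
    by exists x; split=> // p Lp; rewrite expr0 mul1r dP.
  have nLy : ~ Lam z y.
    by move=> /yP; rewrite subrr nm0 mulr0 leNgt d0.
  have [t [ht badt]] := step y nLy bady.
  exists ((y - t) / z); split=> // p Lp.
  have Lzp : Lam z (z * p + t).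
    by case: ht => ->; [rewrite addr0; exact: Lam_f|exact: Lam_g].
  rewrite exprSr -mulrA -nmM; apply: le_trans (yP _ Lzp) _.
  by rewrite mulrBr [z * (_ / z)]mulrC divfK // opprB addrA.
(* For large n, y is farther from [p0] than any point of Lambda, and then [arg_on_far] provides the
   argument denied to y. *)
have [p0 Lp0] := Lam_neq0 Dz; have [b b0 bP] := Lam_bounded Dz.
have [n nP] := expr_small (ltW z0) z1 (ltW (addr_gt0 b0 b0)) d0.
have [y [bady yP]] := far n; apply: bady.
apply: (@arg_on_far _ _ _ p0) => p Lp.
apply: (@le_lt_trans _ _ (b + b)).
  by apply: le_trans (nmD _ _) _; rewrite nmN lerD ?bP.
have := lt_le_trans nP (yP _ Lp0); rewrite (nmB p0) ltr_pM2l // exprn_gt0 //.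
Qed.

End Fullness.

(** * Properties of omega itself and the nested loops *)

Section Loops.
Variables (R : realType) (w : CC R).
Local Notation C := (CC R).
Hypothesis w_root : omega_poly w = 0.
Hypothesis w_approx : nm (zc R scale7 Z0 * w - zc R omega7_re omega7_im) <= zr R 10%ZZ.

Let nw : near_omega w := near_w w_approx.
Let Dw : Dstar w := near_Dstar nw.
Let w0 : 0 < nm w. Proof. by have /andP[] := iffLR (Dstar_nm w) Dw. Qed.
Let w1 : nm w < 1. Proof. by have /andP[] := iffLR (Dstar_nm w) Dw. Qed.
Let k0 : 0 < nm (speed w). Proof. by rewrite nm_gt0 (speed_neq0 w_root w_approx). Qed.

Lemma omega_meet : ifs_f w @` Lam w `&` ifs_g w @` Lam w = [set 2^-1].
Proof. by have [rw vw] := rigid_root nw w_root; exact: rigid_meet. Qed.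

Lemma omega_Mset : Mset w.
Proof. by have [_ vw] := rigid_root nw w_root; apply/(Mset_viable Dw). Qed.

Lemma omega_M0set : M0set w.
Proof.
split=> //; have [fw _] : (ifs_f w @` Lam w `&` ifs_g w @` Lam w) 2^-1.
  by rewrite omega_meet.
by rewrite LamE //; left.
Qed.

Lemma omega_M1set : M1set w.
Proof.
by split=> //; split; [case: omega_Mset|apply: single_meet_full omega_meet].
Qed.

Lemma hole_pt_small : nm (zc R scale Z0 * hole_pt R) <= zr R 13800000%ZZ.
Proof.
rewrite /hole_pt mulrC divfK; last by apply: zc_neq0.
by apply: nm_zc_le.
Qed.

(** The point [hole_pt] has modulus about 0.138, beyond the range 0.1 of forced digits, but all
    earlier offsets are smaller by a factor of at most 16/25, hence below 0.1. *)
Lemma hole_pt_not_Mset n : near_omega (blowup w n (hole_pt R)) ->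
  nm (zc R scale Z0 * (tail (blowup w n (hole_pt R)) n -
      (1 - blowup w n (hole_pt R))^-1 - hole_pt R)) <= zr R 4000%ZZ ->
  ~ Mset (blowup w n (hole_pt R)).
Proof.
set z := blowup w n _ => nz tz /(Mset_tail_viable nz) h.
apply: (hole_not_viable nz tz); apply: h => k kn.
have z0 := near_neq0 nz; have z1 := near_one_sub nz.
have -> : tail z k - (1 - z)^-1 = z ^+ (n - k) * (tail z n - (1 - z)^-1).
  rewrite /tail; have -> : z ^+ (8 + n) = z ^+ (8 + k) * z ^+ (n - k).
    by rewrite -exprD -addnA subnKC // ltnW.
  have a0 : z ^+ (8 + k) != 0 by rewrite expf_neq0.
  have b0 : z ^+ (n - k) != 0 by rewrite expf_neq0.
  by field; rewrite z1 a0 b0.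
rewrite mulrCA nmM nmX.
have nzz : nm z <= 16 / 25.
  have S70 : 0 < zr R scale7 by rewrite zr_gt0.
  have /andP[_ hz] := near_nm nz; rewrite -(ler_pM2l S70); apply: le_trans hz _.
  rewrite mulrA ler_pdivlMr //.
  have -> : (25 : R) = zr R 25%ZZ by rewrite zrE.
  have -> : (16 : R) = zr R 16%ZZ by rewrite zrE.
  by rewrite -!zrM zr_le.
have zp : nm z ^+ (n - k) <= 16 / 25.
  have : (0 < n - k)%N by rewrite subn_gt0.
  case: (n - k)%N => // j _; rewrite exprS.
  have := nm_ge0 z; have : nm z ^+ j <= 1 by rewrite exprn_ile1 ?nm_ge0 //; lra.
  by have := exprn_ge0 j (nm_ge0 z); nra.
have tn : nm (zc R scale Z0 * (tail z n - (1 - z)^-1)) <= zr R 13804000%ZZ.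
  rewrite -(subrK (hole_pt R) (tail z n - _)) mulrDr; apply: le_trans (nmD _ _) _.
  rewrite (_ : zr R _ = zr R 4000%ZZ + zr R 13800000%ZZ) ?lerD ?hole_pt_small //.
  by rewrite -zrD.
apply: (@le_trans _ _ (16 / 25 * zr R 13804000%ZZ)).
  by apply: ler_pM; rewrite ?exprn_ge0 ?nm_ge0.
rewrite mulrAC ler_pdivrMr //.
have -> : (25 : R) = zr R 25%ZZ by rewrite zrE.
have -> : (16 : R) = zr R 16%ZZ by rewrite zrE.
by rewrite -!zrM zr_le.
Qed.

Lemma non_Mset_near : exists n0, forall n, (n0 <= n)%N ->
  DstarM (blowup w n (hole_pt R)).
Proof.
have S0 : 0 < zr R scale by rewrite zr_gt0.
have rho : 0 < nm (hole_pt R) + 1 by rewrite ltr_wpDl ?nm_ge0.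
have [n0 n0P] := tail_blowup w_root w_approx rho.
exists n0 => n /n0P/(_ (hole_pt R))[|nz tz]; first by rewrite lerDl.
by split; [exact: near_Dstar|exact: hole_pt_not_Mset].
Qed.

(** [blowup w n] is an affine bijection and the beads are open, so every point close to
    [blowup w n s] is the image of a point of the same bead, with the same n. *)
Lemma bead_interior : exists n0, forall n, (n0 <= n)%N -> forall b s,
  b \in necklace -> bead_disc b s -> nm s < 1 / 2 -> (@Mset R)° (blowup w n s).
Proof.
have [n0 n0P] := tail_blowup w_root w_approx (@ltr01 R).
exists n0 => n /n0P nP b s bN /bead_discP bs s2.
pose c : C := w ^+ (8 + n) / speed w.
have wn0 : w != 0 by rewrite -nm_gt0.
have sn0 : speed w != 0 by rewrite -nm_gt0.
have cn0 : c != 0 by rewrite mulf_neq0 ?expf_neq0 ?invr_eq0.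
have c0 : 0 < nm c by rewrite nm_gt0.
(* The 1/2 keeps |s'| at most 1, the range for which [n0] was chosen. *)
pose e := Num.min (bead_radius R b - nm (s - bead_vertex R b)) (1 / 2).
have e0 : 0 < e by rewrite lt_min subr_gt0 bs; lra.
apply/nbhs_nmP; exists (e * nm c); first exact: mulr_gt0.
move=> y; pose s' := (y - w) / c.
have yE : y = blowup w n s'.
  by rewrite /blowup /s' /c; field; rewrite sn0 expf_neq0.
have -> : y - blowup w n s = (s' - s) * c.
  by rewrite {1}yE /blowup /c; field.
rewrite nmM ltr_pM2r // lt_min => /andP[h1 h2].
have s1 : nm s' <= 1.
  have := nmD (s' - s) s; rewrite subrK => h; lra.
have [nz tz] := nP s' s1; rewrite yE; apply: (tail_viable_Mset nz).
apply: (bead_viable nz bN _ tz); apply/bead_discP.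
by apply: le_lt_trans (nm_tri s _ _) _; lra.
Qed.

Lemma blowup_curve_continuous n (q : R -> C) k :
  (forall x y, nm (q x - q y) <= k * `|x - y|) ->
  continuous (fun t => blowup w n (q t)).
Proof.
move=> qk; apply: (@lipschitz_curve_continuous _ _ (nm (w ^+ (8 + n) / speed w) * k)).
move=> x y; have -> : blowup w n (q x) - blowup w n (q y) =
    w ^+ (8 + n) / speed w * (q x - q y) by rewrite /blowup; ring.
by rewrite nmM -mulrA; apply: ler_wpM2l => //; exact: nm_ge0.
Qed.

Lemma curve_away_from_0 (q : R -> C) k : (forall x y, nm (q x - q y) <= k * `|x - y|) ->
  (forall t, 0 <= t <= 1 -> q t != 0) ->
  exists2 d, 0 < d & forall t, 0 <= t <= 1 -> d <= nm (q t).
Proof.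
move=> qk q0; have cK : compact (q @` `[0, 1]%classic).
  apply: continuous_compact; last exact: segment_compact.
  by apply: continuous_subspaceT; exact: lipschitz_curve_continuous qk.
have /closed_openC/open_nmP/(_ 0)[|d d0 dP] := compact_closed_nm cK.
  by move=> [t /= t01 qt]; have := q0 t; rewrite qt eqxx => /(_ t01).
exists d => // t t01; rewrite leNgt; apply/negP => qd.
have := dP (q t); rewrite subr0 => /(_ qd); apply; exists t => //=.
Qed.

(** All loops are copies of one polygon, scaled by [unit n]. The polygon lies between the circles of
    radii d and 1/2 about 0, so loop n misses the disc of radius [unit n * d] about w. *)
Lemma nested_loops : exists (gam : nat -> R -> C) (rho : nat -> R), forall n,
  [/\ is_loop (gam n) /\ loop_image (gam n) `<=` (@Mset R)°,
      ~ arg_on (loop_image (gam n)) w /\ closed (loop_image (gam n)),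
      0 < rho n /\ (forall p, nm (p - w) < rho n -> ~ loop_image (gam n) p),
      (forall t, 0 <= t <= 1 -> nm (gam n.+1 t - w) < rho n) &
      (forall t, 0 <= t <= 1 -> nm (gam n t - w) < (n.+1%:R)^-1)].
Proof.
have [q [m [tau [[k qk] q01 qP q0 [m0 t0 t1 tS [qRe qIm]]]]]] :=
  @bead_polygon R necklace isT necklace_linked necklace_small.
have [d d0 dP] := curve_away_from_0 qk q0.
have d2 : d < 1 / 2.
  have h01 : 0 <= (0 : R) <= 1 by rewrite lexx ler01.
  by apply: le_lt_trans (dP 0 h01) _; have [] := qP 0 h01.
(* Raising the level by L shrinks the polygon by |w|^L < d, so the next loop fits into the disc
   missed by the present one. [N2] makes the first scale at most 1. *)
have [L LP] := expr_small (ltW w0) w1 (@ler01 R) d0; rewrite mulr1 in LP.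
have [N1 N1P] := bead_interior.
have i0 : 0 <= (nm (speed w))^-1 by rewrite invr_ge0 ltW.
have [N2 N2P] := expr_small (ltW w0) w1 i0 (@ltr01 R).
pose N n := (N1 + N2 + L * n)%N.
pose unit n := nm w ^+ (8 + N n) / nm (speed w).
have u0 n : 0 < unit n by rewrite divr_gt0 ?exprn_gt0.
have uS n : unit n.+1 < unit n * d.
  have -> : unit n.+1 = unit n * nm w ^+ L.
    rewrite /unit (_ : 8 + N n.+1 = 8 + N n + L)%N; first by rewrite exprD mulrAC.
    by rewrite /N mulnS -!addnA [(_ + L)%N]addnC.
  by rewrite ltr_pM2l.
have un n : unit n <= (1 / 2) ^+ n.
  elim: n => [|n IHn].
    rewrite expr0 /unit /N muln0 addn0 addnA exprD -mulrA.
    apply: mulr_ile1; rewrite ?exprn_ge0 ?mulr_ge0 ?exprn_ge0 ?(ltW w0) ?(ltW N2P) //.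
    by rewrite exprn_ile1 // ltW.
  apply: le_trans (ltW (uS n)) _; rewrite exprSr.
  by apply: ler_pM; rewrite ?(ltW d0) ?(ltW d2) ?(ltW (u0 n)).
have gE n s : nm (blowup w n s - w) = nm w ^+ (8 + n) / nm (speed w) * nm s.
  by rewrite blowup_nm mulrA mulrAC.
exists (fun n t => blowup w (N n) (q t)), (fun n => unit n * d) => n.
pose g t := blowup w (N n) (q t); rewrite -/g.
have cg : continuous g by exact: (@blowup_curve_continuous (N n) _ _ qk).
have cgs : {within `[0, 1]%classic, continuous g} by apply: continuous_subspaceT.
have imP p : loop_image g p -> exists2 t, 0 <= t <= 1 & p = blowup w (N n) (q t).
  by move=> [t /= t01 <-]; exists t => //; rewrite -in_itv.
split.
- split; first by split=> //; rewrite /g q01.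
  move=> p /imP[t t01 ->]; have [q2 [b bN bq]] := qP t t01.
  by apply: (N1P _ _ b) => //; rewrite /N -addnA leq_addr.
- split.
    have ratio s t : (g s - w) / (g t - w) = q s / q t.
      have bE u : g u - w = w ^+ (8 + N n) / speed w * q u.
        by rewrite /g /blowup addrAC subrr add0r mulrA mulrAC.
      rewrite !bE -mulf_div divff ?mul1r // mulf_neq0 ?invr_eq0 ?expf_neq0 //.
        by rewrite -nm_gt0.
      by rewrite -nm_gt0.
    apply: (@turning_not_arg_on _ g w m tau) => //; first by rewrite /g q01.
      by move=> i t im ti; rewrite ratio qRe.
    by move=> i im; rewrite ratio qIm.
  apply: compact_closed_nm; apply: continuous_compact => //; exact: segment_compact.
- split; first by rewrite mulr_gt0.
  move=> p pd /imP[t t01 pE]; move: pd; rewrite pE gE -/(unit n) ltr_pM2l //.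
  by rewrite ltNge dP.
- move=> t t01; rewrite gE -/(unit n.+1); have [q2 _] := qP t t01.
  apply: lt_trans (uS n); rewrite -[ltRHS]mulr1 ltr_pM2l //.
  by apply: lt_trans q2 _; lra.
- move=> t t01; rewrite gE -/(unit n); have [q2 _] := qP t t01.
  apply: (@lt_le_trans _ _ (unit n * (1 / 2))); first by rewrite ltr_pM2l.
  apply: (@le_trans _ _ ((1 / 2) ^+ n.+1)).
    by rewrite exprSr ler_wpM2r //; lra.
  rewrite expr_div_n expr1n div1r lef_pV2 ?posrE ?exprn_gt0 ?ltr0n //.
  by rewrite -natrX ler_nat ltnW // ltn_expl.
Qed.

End Loops.

(** * Holes enclosed by the loops *)

Section Holes.
Variables (R : realType) (w : CC R).
Local Notation C := (CC R).
Hypothesis w_root : omega_poly w = 0.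
Hypothesis w_approx : nm (zc R scale7 Z0 * w - zc R omega7_re omega7_im) <= zr R 10%ZZ.

Lemma nm_natV n (x : C) : (`|x| < (n.+1%:R)^-1) = (nm x < (n.+1%:R)^-1).
Proof.
have -> : (n.+1%:R)^-1 = ((n.+1%:R)^-1)%:C :> C by rewrite fmorphV rmorph_nat.
by rewrite normE ltcR.
Qed.

Lemma non_Mset_points (e : R) : 0 < e -> exists2 z : C, DstarM z & nm (z - w) < e.
Proof.
move=> e0; have [n0 n0P] := non_Mset_near w_root w_approx.
have Dw := near_Dstar (near_w w_approx).
have /andP[w0 w1] := iffLR (Dstar_nm w) Dw.
have k0 : 0 <= nm (hole_pt R) / nm (speed w) by rewrite divr_ge0 ?nm_ge0.
have [n nP] := expr_small (ltW w0) w1 k0 e0.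
exists (blowup w (n0 + n) (hole_pt R)); first by apply: n0P; rewrite leq_addr.
rewrite blowup_nm; apply: le_lt_trans nP.
rewrite addnA exprD; apply: ler_wpM2r => //; rewrite ler_piMl ?exprn_ge0 ?(ltW w0) //.
by rewrite exprn_ile1 // ltW.
Qed.

Lemma loops_exist : exists gam : nat -> R -> C,
     forall n, is_loop (gam n) /\
       loop_image (gam n) `<=` (@Mset R)° /\
       encircles (gam n) w /\
       loop_image (gam n.+1) `<=`
         connected_component (~` loop_image (gam n)) w /\
       (forall t : R, 0 <= t <= 1 -> `|gam n t - w| < (n.+1%:R)^-1).
Proof.
have [gam [rho gP]] := nested_loops w_root w_approx.
exists gam => n; have [[l1 l2] [bad cl] [r0 rP] nest small] := gP n.
have nw : ~ loop_image (gam n) w by apply: rP; rewrite subrr nm0.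
have inn (p : C) : loop_image (gam n) p -> nm (p - w) < (n.+1%:R)^-1.
  by move=> [t /= t01 <-]; apply: small; exact: t01.
split=> //; split=> //; split.
  split=> //; exists (nm w + (n.+1%:R)^-1) => x /(bad_component cl nw bad inn) /= xw.
  rewrite normE lecR; rewrite addrC.
  by have := nm_tri w x 0; rewrite !subr0 => h; apply: le_trans h _; rewrite lerD2r ltW.
split; last by move=> t t01; rewrite nm_natV small.
move=> _ [t /= t01 <-].
have sub : [set p | nm (p - w) < rho n] `<=` connected_component (~` loop_image (gam n)) w.
  apply: connected_component_max => //; last exact: ball_connected.
  by rewrite /= subrr nm0.
by apply: sub => /=; apply: nest; exact: t01.
Qed.

(** Take a point z outside M in the disc about w that the loop misses. The component of z together
    with this disc is connected and avoids the loop, so it lies in the bounded component of w. *)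
Lemma small_hole (e : R) : 0 < e ->
  exists2 H, is_hole (R:=R) H & H `<=` [set p | nm (p - w) < e].
Proof.
wlog e2 : e / e <= 1 / 2.
  move=> h e0; have [||H hH He] := h (Num.min e (1 / 2)).
  - by rewrite ge_min lexx orbT.
  - by rewrite lt_min e0; lra.
  by exists H => // p /He /=; rewrite lt_min => /andP[].
move=> e0; have [gam [rho gP]] := nested_loops w_root w_approx.
have [n ne] : exists n : nat, (n.+1%:R)^-1 < e.
  exists (Num.bound e^-1); rewrite invf_plt ?posrE ?ltr0n //.
  apply: lt_le_trans (archi_boundP _) _; first by rewrite invr_ge0 ltW.
  by rewrite ler_nat.
have [[_ l2] [bad cl] [r0 rP] _ small] := gP n.
have nw : ~ loop_image (gam n) w by apply: rP; rewrite subrr nm0.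
have inn (p : C) : loop_image (gam n) p -> nm (p - w) < (n.+1%:R)^-1.
  by move=> [t /= t01 <-]; apply: small; exact: t01.
have [z Dz zw] := non_Mset_points r0.
pose H := connected_component (@DstarM R) z.
have Hz : H z by apply: connected_component_refl.
have HE : H `<=` [set p | nm (p - w) < e].
  pose B := [set p : C | nm (p - w) < rho n].
  have cHB : connected (H `|` B).
    apply: connectedU; [by exists z|exact: component_connected|exact: ball_connected].
  have sub : H `|` B `<=` connected_component (~` loop_image (gam n)) w.
    apply: connected_component_max => //.
      by right; rewrite /B /= subrr nm0.
    move=> p [|]; last exact: rP.
    move=> /connected_component_sub [_ nMp] /l2 /interior_subset //.
  move=> p Hp; apply: lt_trans ne; apply: (bad_component cl nw bad inn).
  by apply: sub; left.
(* H is not the outer component: 1/4 is farther than 1/2 from w, since Im w > 1/2, while H is within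
   e <= 1/2. *)
exists H => //; exists z => //; split=> // /(_ (4^-1)) h.
have : H 4^-1.
  apply: h; rewrite /small_disk /=.
  have -> : 4^-1 = (4^-1)%:C :> C by rewrite fmorphV rmorph_nat.
  have -> : 2^-1 = (2^-1)%:C :> C by rewrite fmorphV rmorph_nat.
  rewrite normE -[0]/(0%:C) !ltcR nmR ger0_norm; lra.
move=> /HE /=; have := nm_Im (4^-1 - w).
have -> : complex.Im (4^-1 - w) = - complex.Im w.
  have -> : 4^-1 = (4^-1)%:C :> C by rewrite fmorphV rmorph_nat.
  by case: (w) => a b /=; rewrite sub0r.
rewrite normrN; have := Im_w w_approx; have := ler_norm (complex.Im w); lra.
Qed.

(** As w is in M, each hole has a point at a positive distance from w. Finitely many such distances
    have a positive minimum, and [small_hole] yields a hole closer to w than that. *)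
Lemma infinite_small_holes (e : R) : 0 < e ->
  infinite_set [set H | is_hole H /\ H `<=` [set p : C | nm (p - w) < e]].
Proof.
move=> e0; set S := [set H | _] => finS.
have Mw := omega_Mset w_root w_approx.
have [f fP] : {f : set C -> R & forall H, S H ->
    0 < f H /\ exists2 y, H y & nm (y - w) = f H}.
  apply: (choice (P := fun H r => S H -> 0 < r /\ exists2 y, H y & nm (y - w) = r)) => H.
  have [SH|] := pselect (S H); last by exists 0.
  have [[z Dz [HE _]] _] := SH; exists (nm (z - w)) => _; split.
    by rewrite nm_gt0 subr_eq0; apply/eqP => zw; case: Dz => _; rewrite zw.
  by exists z => //; rewrite HE; apply: connected_component_refl.
have /finite_seqP[s sE] : finite_set (f @` S) by exact: finite_image.
have s0 r : r \in s -> 0 < r.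
  move=> rs; have : [set` s] r by [].
  by rewrite -sE => -[H SH <-]; have [] := fP H SH.
have [d d0 ds] : exists2 d : R, 0 < d & forall r, r \in s -> d <= r.
  elim: s s0 {sE} => [|r s IHs] s0; first by exists 1.
  have [|d d0 ds] := IHs; first by move=> x xs; apply: s0; rewrite inE xs orbT.
  exists (Num.min r d); first by rewrite lt_min d0 s0 ?inE ?eqxx.
  by move=> x; rewrite inE => /orP[/eqP ->|/ds dx]; rewrite ge_min ?lexx ?dx ?orbT.
have [H hH Hd] : exists2 H, is_hole (R:=R) H & H `<=` [set p | nm (p - w) < Num.min e d].
  by apply: small_hole; rewrite lt_min e0.
have SH : S H by split=> // p /Hd /=; rewrite lt_min => /andP[].
have [_ [y Hy yE]] := fP H SH.
have := Hd y Hy; rewrite /= lt_min => /andP[_]; rewrite yE ltNge ds //.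
have : (f @` S) (f H) by exists H.
by rewrite sE.
Qed.

End Holes.

Theorem theorem9p1p1 (R : realType) (w : CC R)
  (hroot : omega_poly w = 0)
  (happrox : `|w - omega_approx| < (10 ^+ 6)%:R^-1) :
  (* (1) *)
  (Mset w /\ M0set w /\ M1set w /\
   image (Lam w) (ifs_f w) `&` image (Lam w) (ifs_g w) = [set 2^-1]) /\
  (* (2) *)
  (forall e : R, 0 < e -> exists2 z, DstarM z & `|z - w| < e%:C) /\
  (* (3) nested closed loops in the interior of M encircling w, shrinking to w *)
  (exists gam : nat -> R -> CC R,
     forall n, is_loop (gam n) /\
       loop_image (gam n) `<=` (@Mset R)° /\
       encircles (gam n) w /\
       loop_image (gam n.+1) `<=`
         connected_component (~` loop_image (gam n)) w /\
       (forall t : R, 0 <= t <= 1 -> `|gam n t - w| < (n.+1%:R)^-1)) /\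
  (* consequence: infinitely many holes, accumulating at w *)
  infinite_set (is_hole (R:=R)) /\
  (forall e : R, 0 < e ->
     infinite_set [set H | is_hole H /\ H `<=` ball w e%:C]).
Proof.
have happ := approx_close happrox.
split; first by split; [exact: omega_Mset|split; [exact: omega_M0set|
  split; [exact: omega_M1set|exact: omega_meet]]].
split; first by move=> e /(non_Mset_points hroot happ)[z Dz zw]; exists z;
  rewrite ?normE ?ltcR.
split; first exact: loops_exist.
have inf := infinite_small_holes hroot happ.
split.
  by move=> fin; apply: (inf 1 ltr01); apply: sub_finite_set fin => H [].
move=> e e0 fin; apply: (inf e e0); apply: sub_finite_set fin => H [hH He].
split; first exact: hH.
move=> p /He pe; rewrite -ball_normE; change (`|w - p| < e%:C).
by rewrite normE ltcR nmB.
Qed.
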